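(* Let $N\ge 3$ and let $\mathbf{u}\in\mathcal{D}(\mathbb{R}^N)$ be solenoidal, i.e. $\operatorname{div}\mathbf{u}=0$ (in the sense of distributions). Then \[ \int_{\mathbb{R}^N}|\nabla \mathbf{u}|^2dx\int_{\mathbb{R}^N}|\mathbf{u}|^2|\mathbf{x}|^2dx\ge C_N\left(\int_{\mathbb{R}^N}|\mathbf{u}|^2dx\right)^2 \] holds with \[ C_N=\frac{1}{4}\left(\sqrt{(N-2)^2+8}+2\right)^2, \] and this constant is the best possible. Moreover, $C_N$ is attained, i.e. there exists a solenoidal $\mathbf{u}\in\mathcal{D}(\mathbb{R}^N)\setminus\{\mathbf{0}\}$ for which equality holds.
   Context: Vector fields are real: $\mathbf{u}=(u_1,\dots,u_N):\mathbb{R}^N\to\mathbb{R}^N$. $\nabla\mathbf{u}=(\partial u_j/\partial x_k)_{j,k}$ is the Jacobian matrix, and $|\nabla\mathbf{u}|^2=\sum_{j,k}(\partial u_j/\partial x_k)^2$. The space $\mathcal{D}(\mathbb{R}^N)$ is the Hilbert space completion of $C_c^\infty(\mathbb{R}^N)^N$ with respect to the norm \[ \|\mathbf{u}\|_{\mathcal{D}}=\left(\int_{\mathbb{R}^N}|\mathbf{u}|^2dx+\int_{\mathbb{R}^N}|\mathbf{u}|^2|\mathbf{x}|^2dx+\int_{\mathbb{R}^N}|\nabla\mathbf{u}|^2dx\right)^{1/2}. \] ''Best possible'' means that $C_N$ equals the infimum of the ratio $\int|\nabla\mathbf{u}|^2\int|\mathbf{u}|^2|\mathbf{x}|^2/(\int|\mathbf{u}|^2)^2$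 over nonzero solenoidal $\mathbf{u}\in\mathcal{D}(\mathbb{R}^N)$. *)

(* Defs.v *)
From HB Require Import structures.
From mathcomp Require Import all_boot all_order all_algebra.
From mathcomp Require Import all_classical all_reals all_analysis.
Set Implicit Arguments. Unset Strict Implicit. Unset Printing Implicit Defensive.
Import Order.TTheory GRing.Theory Num.Theory.
Import numFieldNormedType.Exports.
Local Open Scope classical_set_scope.
Local Open Scope ring_scope.

Definition sqnorm (R : realType) (m : nat) (v : 'rV[R]_m) : R :=
  \sum_(i < m) (v ord0 i) ^+ 2.

Definition sqnormM (R : realType) (m : nat) (A : 'M[R]_m) : R :=
  \sum_(j < m) \sum_(k < m) (A j k) ^+ 2.

(* Lebesgue integral over R^n, written as the iterated integral over the
   coordinates x_0, x_1, ..., x_{n-1} (Tonelli: equal to the Lebesgue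
   integral for nonnegative Borel functions; Fubini for integrable ones). *)
Fixpoint iint (R : realType) (n : nat) : ('rV[R]_n -> \bar R) -> \bar R :=
  match n return ('rV[R]_n -> \bar R) -> \bar R with
  | 0 => fun f => f 0
  | m.+1 => fun f =>
      (\int[@lebesgue_measure R]_(t in [set: R])
         iint (fun y : 'rV[R]_m => f (row_mx (const_mx t : 'rV[R]_1) y)))%E
  end.

Definition evec (R : realType) (N : nat) (k : 'I_N) : 'rV[R]_N := delta_mx ord0 k.

Fixpoint iter_partial (R : realType) (N : nat) (W : normedModType R)
  (ks : seq 'I_N) (f : 'rV[R]_N -> W) : 'rV[R]_N -> W :=
  match ks with
  | [::] => f
  | k :: ks' => fun x => derive (iter_partial ks' f) x (evec R k)
  end.

Definition smooth (R : realType) (N : nat) (W : normedModType R)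
  (f : 'rV[R]_N -> W) : Prop :=
  forall ks : seq 'I_N,
    continuous (iter_partial ks f) /\
    forall (x : 'rV[R]_N) (k : 'I_N), derivable (iter_partial ks f) x (evec R k).

Definition compact_support (R : realType) (N : nat) (W : normedModType R)
  (f : 'rV[R]_N -> W) : Prop :=
  exists r : R, forall x : 'rV[R]_N, r < `|x| -> f x = 0.

Definition Cc_infty (R : realType) (N : nat) (W : normedModType R)
  (f : 'rV[R]_N -> W) : Prop := smooth f /\ compact_support f.

Definition jacobian (R : realType) (N : nat) (u : 'rV[R]_N -> 'rV[R]_N)
  (x : 'rV[R]_N) : 'M[R]_N :=
  \matrix_(j < N, k < N) (derive u x (evec R k)) ord0 j.

Definition borelN (R : realType) (N : nat) : set (set 'rV[R]_N) :=
  <<s [set: 'rV[R]_N], [set A | open A] >>.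

Definition borel_fun (R : realType) (N : nat) (T : topologicalType)
  (f : 'rV[R]_N -> T) : Prop :=
  forall B : set T, open B -> borelN (f @^-1` B).

(* Squared D-distance between a smooth field phi and the pair (u, G),
   where G plays the role of the (weak) Jacobian of u. *)
Definition Ddist2 (R : realType) (N : nat) (phi u : 'rV[R]_N -> 'rV[R]_N)
  (G : 'rV[R]_N -> 'M[R]_N) : \bar R :=
  (iint (fun x => (sqnorm (phi x - u x))%:E)
   + iint (fun x => (sqnorm (phi x - u x) * sqnorm x)%:E)
   + iint (fun x => (sqnormM (jacobian phi x - G x))%:E))%E.

(* (u, G) is (a Borel representative of) an element of the space D(R^N),
   the completion of C_c^infinity(R^N)^N for the norm ||.||_D; G is then its
   gradient (Jacobian) nabla u. *)
Definition inD (R : realType) (N : nat) (u : 'rV[R]_N -> 'rV[R]_N)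
  (G : 'rV[R]_N -> 'M[R]_N) : Prop :=
  borel_fun u /\ borel_fun G /\
  exists phi : nat -> ('rV[R]_N -> 'rV[R]_N),
    (forall n, Cc_infty (phi n)) /\
    (Ddist2 (phi n) u G @[n --> \oo] --> 0%E).

Definition solenoidal (R : realType) (N : nat) (u : 'rV[R]_N -> 'rV[R]_N) : Prop :=
  forall psi : 'rV[R]_N -> R^o, Cc_infty psi ->
    iint (fun x => (\sum_(j < N) u x ord0 j * derive psi x (evec R j))%:E) = 0%E.

Definition grad2 (R : realType) (N : nat) (G : 'rV[R]_N -> 'M[R]_N) : \bar R :=
  iint (fun x => (sqnormM (G x))%:E).
Definition mom2 (R : realType) (N : nat) (u : 'rV[R]_N -> 'rV[R]_N) : \bar R :=
  iint (fun x => (sqnorm (u x) * sqnorm x)%:E).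
Definition mass2 (R : realType) (N : nat) (u : 'rV[R]_N -> 'rV[R]_N) : \bar R :=
  iint (fun x => (sqnorm (u x))%:E).

Definition CN (R : realType) (N : nat) : R :=
  (Num.sqrt ((N%:R - 2) ^+ 2 + 8) + 2) ^+ 2 / 4.

(* Main.v *)
(* Let a > 0 solve a (a + N - 2) = 2 and put L = N + 2 a, so that C_N = L^2 / 4.
   By homogeneity the inequality follows from
     int |x|^2 |phi|^2 + lam^2 int |grad phi|^2 >= lam L int |phi|^2   (lam > 0).
   A Fourier transform (here the Hartley transform with kernel cos + s sin,
   s = 1 or -1, which keeps everything real) turns phi into v with x . v the
   transform of div phi, and the inequality into
     int |grad v|^2 + lam^2 int |x|^2 |v|^2 >= lam L int |v|^2   if x . v = 0.
   With eps-regularized weights, this last inequality is pointwise: up to O(eps)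
   and terms containing x . v, the difference of the integrands dominates the
   divergence of an explicit field. The field combines the null Lagrangian
   tr(B^2) - (tr B)^2, B = grad v, whose interplay with the part of B tangential
   to spheres yields the gain 2 in a (a + N - 2) = 2, with a radial completion
   of squares |B x - b v|^2, b = a - lam |x|^2. A general u is a limit of test
   fields phi that need not be solenoidal, but their divergences tend to 0 in L^2.

   Equality: put F(t) = exp(-t) 1F1(1 - a/2; N/2; t). The field
   u = p e_0 + x_0 F''(|x|^2 / 2) x, with p radial, determined by div u = 0, satisfies
   - Laplace u + |x|^2 u - L u = grad P, hence (test with u)
   int |grad u|^2 + int |x|^2 |u|^2 = L int |u|^2; by the inequality and AM-GM
   both sides of the uncertainty inequality agree. *)

Require Import Defs.
From HB Require Import structures.
From mathcomp Require Import all_boot all_order all_algebra.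
From mathcomp Require Import all_classical all_reals all_analysis.
From mathcomp Require Import measurable_realfun ring lra zify.
Import Order.TTheory GRing.Theory Num.Theory.
Import numFieldNormedType.Exports.
Local Open Scope classical_set_scope.
Local Open Scope ring_scope.

Set Implicit Arguments.
Unset Strict Implicit.
Unset Printing Implicit Defensive.

(** * Lebesgue measure on row vectors *)

(** On the transform side the divergence condition is the pointwise constraint x . v = 0.
    Differentiating it gives B^T x = - v, and for such tangential fields |B|^2 - |B x|^2 / |x|^2
    dominates 2 |v|^2 / |x|^2 modulo a divergence: one unit comes from |B^T x|^2 = |v|^2, the other
    from integrating v . B x / |x|^2 by parts. What remains is a radial oscillator with centrifugal
    term 2 / r^2. Its ground state f = r^a exp(- lam r^2 / 2) explains a (a + N - 2) = 2, the energy
    lam L and b = r f' / f. The obstacle is that the transform of a test field need neither be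
    tangential nor vanish at 0. The weights are therefore regularized, and the terms in x . v are
    absorbed into a small multiple of |B|^2 plus K (x . v)^2 with K independent of v: the test
    fields converge first, for fixed eps, and eps tends to 0 afterwards. Up to a factor, the field
    of the equality case is the inverse transform of |xi|^a exp(-|xi|^2 / 2) (e_0 - xi_0 xi /
    |xi|^2), the ground state times a tangential field; F arises as the transform of |xi|^(a-2)
    exp(-|xi|^2 / 2). *)

Section BorelMatrix.
Context (R : realType) (m n : nat).

(** Naming the family fixes the display of the measurable structure below. It unfolds to the
    sigma-algebra of [borelN], so that [borelNE] is a conversion. *)
Definition open_mx : set (set 'M[R]_(m, n)) := [set A | open A].

HB.instance Definition _ := @isMeasurable.Build (sigma_display open_mx)
  'M[R]_(m, n) <<s open_mx >> (@sigma_algebra0 _ setT open_mx)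
  (@sigma_algebraC _ open_mx) (@sigma_algebra_bigcup _ setT open_mx).

Lemma open_measurable_mx (A : set 'M[R]_(m, n)) : open A -> measurable A.
Proof. by move=> oA; apply: sub_sigma_algebra. Qed.

Lemma measurable_fun_openP d (T : measurableType d) (f : T -> 'M[R]_(m, n)) :
  (forall A, open A -> measurable (f @^-1` A)) -> measurable_fun setT f.
Proof.
move=> h; apply: (measurability open_mx) => //.
by move=> _ [A oA <-]; rewrite setTI; exact: h.
Qed.

(** Rational centres and radii 1/(k+1) form a countable base, which reduces measurability of
    matrix-valued maps to preimages of balls; for the sup norm these are boxes. *)
Lemma open_mx_bigcup_ball (A : set 'M[R]_(m, n)) : open A ->
  A = \bigcup_(q : 'M[rat]_(m, n)) \bigcup_(k in
     [set k : nat | ball (map_mx ratr q : 'M[R]_(m, n)) k.+1%:R^-1 `<=` A])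
     ball (map_mx ratr q : 'M[R]_(m, n)) k.+1%:R^-1.
Proof.
move=> oA; apply/seteqP; split; last by move=> x [q _ [k]] /= h /h.
move=> x Ax.
have /nbhs_ballP[e /= e0 xeA] : nbhs x A by rewrite nbhsE; exists A.
(* The radius is doubled because [y] is reached from [x] through the rational centre [q]. *)
have [k ke] : exists k : nat, (k.+1%:R^-1 : R) * 2 < e.
  have h2 : 0 < e / 2 by rewrite divr_gt0.
  have [k _ hk] := near_infty_natSinv_lt (PosNum h2).
  exists k; rewrite -ltr_pdivlMr //; exact: (hk k (leqnn k)).
set d : R := k.+1%:R^-1 in ke *.
have d0 : 0 < d by rewrite invr_gt0.
have hq i j : exists r : rat, x i j - d < ratr r < x i j + d.
  have [|r] := @rat_in_itvoo R (x i j - d) (x i j + d); first lra.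
  by rewrite in_itv; exists r.
pose q : 'M[rat]_(m, n) := \matrix_(i, j) xchoose (hq i j).
have qx : ball (map_mx ratr q : 'M[R]_(m, n)) d x.
  split => // i j; rewrite !mxE.
  have := xchooseP (hq i j) => /andP[h1 h2].
  by rewrite /ball /= /ball_ /= ltr_distlC; apply/andP; split; lra.
exists q => //; exists k => //= y qy; apply: xeA.
apply: (@le_ball _ _ _ (d + d)); first by rewrite -mulr2n -mulr_natr ltW.
by apply: ball_triangle qy; exact: ball_sym.
Qed.

Lemma measurable_fun_ballP d (T : measurableType d) (f : T -> 'M[R]_(m, n)) :
  (forall x e, measurable (f @^-1` ball x e)) -> measurable_fun setT f.
Proof.
move=> h; apply: measurable_fun_openP => A /open_mx_bigcup_ball ->.
rewrite preimage_bigcup.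
apply: countable_bigcupT_measurable => [|q]; first exact: countableP.
rewrite preimage_bigcup.
by apply: bigcup_measurable => k _; exact: h.
Qed.

Lemma continuous_measurable_mx (f : 'M[R]_(m, n) -> R) :
  continuous f -> measurable_fun setT f.
Proof.
move=> /continuousP cf; apply: (measurability _ (RGenOpens.measurableE R)).
move=> _ [_ [a [b ->] <-]]; rewrite setTI; apply: open_measurable_mx.
exact/cf/interval_open.
Qed.

End BorelMatrix.

Lemma borelNE (R : realType) n (A : set 'rV[R]_n) : borelN A = measurable A.
Proof. by []. Qed.

Section ConsRow.
Context (R : realType) (n : nat).

Definition cons_row (p : R * 'rV[R]_n) : 'rV[R]_n.+1 :=
  row_mx (const_mx p.1 : 'rV[R]_1) p.2.

Lemma cons_row0 p : cons_row p ord0 ord0 = p.1.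
Proof.
have := @row_mxEl R 1 1 n (const_mx p.1) p.2 ord0 ord0; rewrite [X in _ = X]mxE => <-.
by congr (row_mx _ _ _ _); exact: val_inj.
Qed.

Lemma cons_rowS p i : cons_row p ord0 (lift ord0 i) = p.2 ord0 i.
Proof.
have := @row_mxEr R 1 1 n (const_mx p.1) p.2 ord0 i => <-.
by congr (row_mx _ _ _ _); exact: val_inj.
Qed.

Definition uncons_row (x : 'rV[R]_n.+1) : R * 'rV[R]_n :=
  (x ord0 ord0, \row_i x ord0 (lift ord0 i)).

Lemma cons_rowK : cancel cons_row uncons_row.
Proof.
case=> t y; rewrite /uncons_row cons_row0; congr pair.
by apply/rowP => i; rewrite mxE cons_rowS.
Qed.

Lemma preimage_cons_row_ball (x : 'rV[R]_n.+1) e :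
  cons_row @^-1` ball x e = ball (uncons_row x).1 e `*` ball (uncons_row x).2 e.
Proof.
apply/seteqP; split => -[t y] /=.
  move=> [e0 h]; split; first by have := h ord0 ord0; rewrite cons_row0.
  apply: (conj e0) => i j; rewrite mxE (ord1 i).
  by have := h ord0 (lift ord0 j); rewrite cons_rowS.
move=> [ht [e0 h]]; apply: (conj e0) => i j; rewrite ord1.
case: (unliftP ord0 j) => [k|] ->; rewrite ?cons_row0 ?cons_rowS //.
by have := h ord0 k; rewrite mxE.
Qed.

Lemma measurable_cons_row :
  measurable_fun setT (cons_row : measurableTypeR R * 'rV[R]_n -> 'rV[R]_n.+1).
Proof.
apply: measurable_fun_ballP => x e; rewrite preimage_cons_row_ball.
apply: measurableX; first by apply: open_measurable; exact: ball_open.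
by apply: open_measurable_mx; exact: ball_open.
Qed.

End ConsRow.

Lemma continuous_mx (R : realType) (T : topologicalType) m n (f : T -> 'M[R]_(m, n)) :
  (forall i j, continuous (fun x => f x i j)) -> continuous f.
Proof.
move=> h x A [P hP sub]; rewrite /nbhs /=.
suff : \near x, forall i j, P i j (f x i j) by apply: filterS => y hy; exact: sub.
by apply: filter_forall => i; apply: filter_forall => j; exact: (h i j x _ (hP i j)).
Qed.

Section PushCons.
Context (R : realType) (n : nat) (mu : {sigma_finite_measure set 'rV[R]_n -> \bar R}).
Local Open Scope ereal_scope.
Let leb : {sigma_finite_measure set (measurableTypeR R) -> \bar R} := @lebesgue_measure R.
Definition push_cons : set 'rV[R]_n.+1 -> \bar R :=
  pushforward (leb \x mu) (@cons_row R n : measurableTypeR R * 'rV[R]_n -> _).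
Let pm : {measure set 'rV[R]_n.+1 -> \bar R} :=
  measure_function_pushforward__canonical__measure_function_Measure (leb \x mu) (@measurable_cons_row R n).
HB.instance Definition _ := Measure.copy push_cons pm.

Lemma continuous_uncons_row1 : continuous (fun x : 'rV[R]_n.+1 => (uncons_row x).1).
Proof. exact: coord_continuous. Qed.

Lemma continuous_uncons_row2 : continuous (fun x : 'rV[R]_n.+1 => (uncons_row x).2).
Proof.
apply: continuous_mx => i j; have := @coord_continuous R 1 n.+1 ord0 (lift ord0 j).
by under [X in _ -> continuous X]eq_fun do rewrite mxE.
Qed.

Lemma measurable_uncons_row :
  measurable_fun setT (@uncons_row R n : _ -> measurableTypeR R * 'rV[R]_n).
Proof.
apply/measurable_fun_pairP; split.
  exact: (continuous_measurable_mx continuous_uncons_row1).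
apply: measurable_fun_openP => A oA; apply: open_measurable_mx.
by have /continuousP := continuous_uncons_row2; exact.
Qed.

(** Both covers are taken nondecreasing so that one index serves the two factors; the rectangles are
    transported by the measurable left inverse [uncons_row]. *)
Lemma push_cons_sigma_finite : sigma_finite setT push_cons.
Proof.
have /sigma_finiteP[F [TF ndF Foo]] := sigma_finiteT leb.
have /sigma_finiteP[G [TG ndG Goo]] := sigma_finiteT mu.
exists (fun k => @uncons_row R n @^-1` (F k `*` G k)).
  rewrite -preimage_bigcup; apply/esym; rewrite -subTset => x _.
  have [i _ Fi] : (\bigcup_i F i) (uncons_row x).1 by rewrite -TF.
  have [j _ Gj] : (\bigcup_i G i) (uncons_row x).2 by rewrite -TG.
  exists (maxn i j) => //; split => /=.
  - by move: Fi; exact/subsetPset/ndF/leq_maxl.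
  - by move: Gj; exact/subsetPset/ndG/leq_maxr.
move=> k; have [mF Fk] := Foo k; have [mG Gk] := Goo k.
have mFG : measurable (F k `*` G k) by exact: measurableX.
split.
  by rewrite -[X in measurable X]setTI; exact: measurable_uncons_row.
rewrite /push_cons /pushforward (_ : _ @^-1` _ = F k `*` G k).
  by rewrite product_measure1E// lte_mul_pinfty// ge0_fin_numE.
by rewrite -comp_preimage (_ : _ \o _ = id) //; apply/funext => x; exact: cons_rowK.
Qed.

HB.instance Definition _ :=
  Measure_isSigmaFinite.Build _ _ _ push_cons push_cons_sigma_finite.
End PushCons.

Section Dirac0.
Context (R : realType).
Local Open Scope ereal_scope.
Definition dirac_rV0 : set 'rV[R]_0 -> \bar R := \d_(0%R : 'rV[R]_0).
HB.instance Definition _ := Measure.copy dirac_rV0 (\d_(0%R : 'rV[R]_0)).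
Lemma dirac_rV0_sf : sigma_finite setT dirac_rV0.
Proof. by apply: fin_num_fun_sigma_finite => [|A mA]; rewrite ?measure0 // /dirac_rV0 diracE. Qed.
HB.instance Definition _ := Measure_isSigmaFinite.Build _ _ _ dirac_rV0 dirac_rV0_sf.
End Dirac0.

(** The first coordinate is outermost, as in [iint], so that the two notions agree by one
    application of Fubini per step; sigma-finiteness is carried in the type for that purpose. *)
Fixpoint lebN (R : realType) (n : nat) : {sigma_finite_measure set 'rV[R]_n -> \bar R} :=
  match n return {sigma_finite_measure set 'rV[R]_n -> \bar R} with
  | 0 => @dirac_rV0 R
  | m.+1 => push_cons (lebN R m)
  end.

(** * Iterated integrals as integrals against one measure *)

Section IntegralLebN.
Context (R : realType).
Local Open Scope ereal_scope.
Let leb : {sigma_finite_measure set (measurableTypeR R) -> \bar R} := @lebesgue_measure R.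

Lemma measurable_cons_row2 n (f : 'rV[R]_n.+1 -> \bar R) : measurable_fun setT f ->
  measurable_fun setT (fun p : measurableTypeR R * 'rV[R]_n => f (cons_row p)).
Proof. by move=> mf; apply: (measurableT_comp mf); exact: measurable_cons_row. Qed.

Lemma ge0_integral_lebNS n (f : 'rV[R]_n.+1 -> \bar R) :
  measurable_fun setT f -> (forall x, 0 <= f x) ->
  \int[lebN R n.+1]_x f x = \int[leb]_t \int[lebN R n]_y f (cons_row (t, y)).
Proof.
move=> mf f0; have mf2 := measurable_cons_row2 mf.
rewrite (ge0_integral_pushforward (@measurable_cons_row R n) (leb \x lebN R n)) //.
by rewrite preimage_setT fubini_tonelli1 /=.
Qed.

Lemma integrable_lebNS n (f : 'rV[R]_n.+1 -> \bar R) :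
  (lebN R n.+1).-integrable setT f ->
  (leb \x lebN R n).-integrable setT (fun p => f (cons_row p)).
Proof.
move=> /integrableP[mf fi]; apply/integrableP; split; first exact: measurable_cons_row2.
have mf' : measurable_fun setT (fun x => `|f x|) by exact: measurableT_comp.
by move: fi; rewrite (ge0_integral_pushforward (@measurable_cons_row R n) (leb \x lebN R n)).
Qed.

Lemma integral_lebNS n (f : 'rV[R]_n.+1 -> \bar R) :
  (lebN R n.+1).-integrable setT f ->
  \int[lebN R n.+1]_x f x = \int[leb]_t \int[lebN R n]_y f (cons_row (t, y)).
Proof.
move=> fi; have fi2 := integrable_lebNS fi.
have mf := measurable_int _ fi.
rewrite (@integral_pushforward _ _ _ _ _ _ (@measurable_cons_row R n) (leb \x lebN R n)) //.
by rewrite preimage_setT -integral12_prod_meas1.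
Qed.

Lemma integral_lebNS_swap n (f : 'rV[R]_n.+1 -> \bar R) :
  (lebN R n.+1).-integrable setT f ->
  \int[lebN R n.+1]_x f x = \int[lebN R n]_y \int[leb]_t f (cons_row (t, y)).
Proof.
move=> fi; have fi2 := integrable_lebNS fi.
have mf := measurable_int _ fi.
rewrite (@integral_pushforward _ _ _ _ _ _ (@measurable_cons_row R n) (leb \x lebN R n)) //.
by rewrite preimage_setT -integral21_prod_meas1.
Qed.

Lemma integral_lebN0 (f : 'rV[R]_0 -> \bar R) : \int[lebN R 0]_x f x = f 0%R.
Proof.
have -> : f = cst (f 0%R) by apply/funext => x; rewrite [x]thinmx0.
by rewrite (@integral_dirac _ _ (0%R : 'rV[R]_0) R setT measurableT) ?diracT ?mul1e.
Qed.

Lemma iint_ge0 n (f : 'rV[R]_n -> \bar R) : (forall x, 0 <= f x) -> 0 <= iint f.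
Proof.
elim: n f => [|n IHn] f f0 /=; first exact: f0.
by apply: integral_ge0 => t _; apply: IHn => y.
Qed.

Lemma ge0_iintE n (f : 'rV[R]_n -> \bar R) :
  measurable_fun setT f -> (forall x, 0 <= f x) -> iint f = \int[lebN R n]_x f x.
Proof.
elim: n f => [|n IHn] f mf f0; first by rewrite integral_lebN0.
rewrite ge0_integral_lebNS //=; apply: eq_integral => t _; rewrite IHn //.
exact: (measurableT_comp (measurable_cons_row2 mf) (measurable_pair1 t)).
Qed.

(** Tonelli's theorem gives measurability for the positive and the negative part, and the integral
    is by definition their difference. *)
Lemma measurable_integral_param d1 d2 (X : measurableType d1) (Y : measurableType d2)
  (m : {sigma_finite_measure set Y -> \bar R}) (f : X * Y -> \bar R) :
  measurable_fun setT f -> measurable_fun setT (fun x => \int[m]_y f (x, y)).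
Proof.
move=> mf.
have -> : (fun x => \int[m]_y f (x, y)) =
    (fun x => \int[m]_y f^\+ (x, y)) \- (fun x => \int[m]_y f^\- (x, y)).
  apply/funext => x; rewrite [LHS]integralE.
  under eq_integral do rewrite funepos_comp/=.
  by under [X in _ - X = _]eq_integral do rewrite funeneg_comp/=.
apply: emeasurable_funB; apply: measurable_fun_fubini_tonelli_F => //.
  exact: measurable_funepos.
exact: measurable_funeneg.
Qed.

Lemma measurable_iint_param n d (X : measurableType d) (f : X * 'rV[R]_n -> \bar R) :
  measurable_fun setT f -> measurable_fun setT (fun x => iint (fun y => f (x, y))).
Proof.
elim: n d X f => [|n IHn] d X f mf /=.
  exact: (measurableT_comp mf (measurable_pair2 _)).
apply: (@measurable_integral_param _ _ X (measurableTypeR R) leb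
  (fun p => iint (fun y => f (p.1, cons_row (p.2, y))))).
apply: (IHn _ (X * measurableTypeR R)%type (fun p => f (p.1.1, cons_row (p.1.2, p.2)))).
apply: (measurableT_comp mf); apply/measurable_fun_pairP; split.
  exact: (measurableT_comp (@measurable_fst _ _ X (measurableTypeR R)) measurable_fst).
apply: (measurableT_comp (@measurable_cons_row R n)
  (g := fun x : X * measurableTypeR R * 'rV[R]_n => (x.1.2, x.2))).
apply/measurable_fun_pairP; split; last exact: measurable_snd.
exact: (measurableT_comp (@measurable_snd _ _ X (measurableTypeR R)) measurable_fst).
Qed.

Lemma integrable_iintE n (f : 'rV[R]_n -> \bar R) :
  (lebN R n).-integrable setT f -> iint f = \int[lebN R n]_x f x.
Proof.
elim: n f => [|n IHn] f fi; first by rewrite integral_lebN0.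
rewrite integral_lebNS //=.
have fi2 := integrable_lebNS fi; have mf2 := measurable_int _ fi2.
(* A slice is integrable only for almost every [t], so the induction hypothesis gives an equality
   almost everywhere. Both inner integrals must then be measurable in [t] on their own, which is the
   purpose of [measurable_iint_param]. *)
apply: ae_eq_integral => //.
- exact: (@measurable_iint_param n _ (measurableTypeR R) (fun p => f (cons_row p))).
- exact: (@measurable_integral_param _ _ (measurableTypeR R) _ _ (fun p => f (cons_row p))).
apply: filterS (ae_integrable1 fi2) => t /= ti _; exact: IHn.
Qed.

End IntegralLebN.

(** * Partial derivatives *)

Section Line.
Context (R : realType) (V1 V2 W : normedModType R).

(** A directional derivative sees only the restriction to a line; this transports partial
    derivatives to slices and to functions of one variable. *)
Lemma derive_line (f : V1 -> W) (g : V2 -> W) x y v w :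
  (forall h : R, f (h *: v + x) = g (h *: w + y)) ->
  (derivable f x v <-> derivable g y w) /\ 'D_v f x = 'D_w g y.
Proof.
move=> fg; have fgx : f x = g y by have := fg 0; rewrite !scale0r !add0r.
rewrite /derivable /derive.
have -> : (fun h => h^-1 *: ((f \o shift x) (h *: v) - f x)) =
         (fun h => h^-1 *: ((g \o shift y) (h *: w) - g y)).
  by apply/funext => h /=; rewrite fg fgx.
by [].
Qed.

End Line.

Section PartialDerivatives.
Context (R : realType) (n : nat).
Local Notation V := 'rV[R]_n.

Definition pd (k : 'I_n) (f : V -> R) : V -> R := fun x => 'D_(evec R k) f x.

Definition has_pd (k : 'I_n) (f g : V -> R) := forall x, is_derive x (evec R k) f (g x).

(** Iterated partial derivatives, as in [smooth], rather than differentials: passing to [pd] lowers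
    the order by construction. *)
Fixpoint Ck (m : nat) (f : V -> R) : Prop :=
  match m with
  | 0 => continuous f
  | m'.+1 => continuous f /\
      forall k, (forall x, derivable f x (evec R k)) /\ Ck m' (pd k f)
  end.

Arguments Ck : simpl never.

Lemma Ck_continuous m f : Ck m f -> continuous f.
Proof. by case: m => [//|m []]. Qed.

Lemma CkS_derivable m f k x : Ck m.+1 f -> derivable f x (evec R k).
Proof. by move=> [_ /(_ k)[]]. Qed.

Lemma CkS_pd m f k : Ck m.+1 f -> Ck m (pd k f).
Proof. by move=> [_ /(_ k)[]]. Qed.

Lemma CkW m f : Ck m.+1 f -> Ck m f.
Proof.
elim: m f => [|m IHm] f; first exact: Ck_continuous.
by move=> [cf h]; split => // k; split => [x|]; [exact: (h k).1|exact/IHm/(h k).2].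
Qed.

Lemma CkS_is_derive m f k x : Ck m.+1 f -> is_derive x (evec R k) f (pd k f x).
Proof. by move=> /CkS_derivable h; apply: DeriveDef. Qed.

Lemma has_pdE k f g : has_pd k f g -> pd k f = g.
Proof. by move=> h; apply/funext => x; exact: (@derive_val _ _ _ _ _ _ _ (h x)). Qed.

Lemma CkSI m f (g : 'I_n -> V -> R) : continuous f ->
  (forall k, has_pd k f (g k)) -> (forall k, Ck m (g k)) -> Ck m.+1 f.
Proof. by move=> cf fg cg; split => // k; rewrite (has_pdE (fg k)); split => // x; case: (fg k x). Qed.

Lemma CkS_has_pd m f k : Ck m.+1 f -> has_pd k f (pd k f).
Proof. by move=> h x; exact: (CkS_is_derive k x h). Qed.

Lemma Ck_cst m (c : R) : Ck m (cst c).
Proof.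
elim: m c => [|m IHm] c; first exact: cst_continuous.
apply: (@CkSI m _ (fun _ => cst 0)) => [|k x|k]; last exact: IHm.
  by apply: cst_continuous.
exact: is_derive_cst.
Qed.

Lemma is_derive_coord (i k : 'I_n) (x : V) :
  is_derive x (evec R k) (fun y : V => y ord0 i) ((i == k)%:R).
Proof.
have hl (h : R) : (h *: evec R k + x) ord0 i = (i == k)%:R * (h *: (1 : R) + 0) + x ord0 i.
  by rewrite !mxE eqxx /= addr0 mulrC; congr (_ * _ + _); rewrite /GRing.scale /= mulr1.
have [h1 h2] := derive_line (f := fun y : V => y ord0 i)
  (g := fun t : R => (i == k)%:R * t + x ord0 i) hl.
have hd : is_derive (0 : R) 1 (fun t : R => (i == k)%:R * t + x ord0 i) ((i == k)%:R).
  by apply: is_derive_eq; rewrite addr0 /GRing.scale /= mulr1 ?mulr0 ?addr0.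
apply: DeriveDef; first by apply/h1; case: hd.
by rewrite h2; exact: derive_val.
Qed.

Lemma Ck_coord m (i : 'I_n) : Ck m (fun y : V => y ord0 i).
Proof.
case: m => [|m]; first exact: coord_continuous.
apply: (@CkSI m _ (fun k => cst ((i == k)%:R))) => [|k x|k].
- exact: coord_continuous.
- exact: is_derive_coord.
- exact: Ck_cst.
Qed.

Lemma cont_add (f g : V -> R) : continuous f -> continuous g -> continuous (fun x => f x + g x).
Proof. by move=> cf cg x; exact: (cvgD (cf x) (cg x)). Qed.

Lemma cont_mul (f g : V -> R) : continuous f -> continuous g -> continuous (fun x => f x * g x).
Proof. by move=> cf cg x; exact: (cvgM (cf x) (cg x)). Qed.

Lemma cont_inv (f : V -> R) : (forall x, f x != 0) -> continuous f -> continuous (fun x => (f x)^-1).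
Proof. by move=> f0 cf x; exact: (cvgV (f0 x) (cf x)). Qed.

Lemma cont_comp (F : R -> R) (g : V -> R) : continuous F -> continuous g -> continuous (fun x => F (g x)).
Proof. by move=> cF cg x; exact: (continuous_comp (cg x) (cF (g x))). Qed.

Lemma CkD m f g : Ck m f -> Ck m g -> Ck m (fun x => f x + g x).
Proof.
elim: m f g => [|m IHm] f g cf cg.
  exact: cont_add.
apply: (@CkSI m _ (fun k x => pd k f x + pd k g x)) => [|k x|k].
- exact: (cont_add (Ck_continuous cf) (Ck_continuous cg)).
- exact: (is_deriveD (CkS_is_derive k x cf) (CkS_is_derive k x cg)).
- by apply: IHm; exact: CkS_pd.
Qed.

Lemma CkM m f g : Ck m f -> Ck m g -> Ck m (fun x => f x * g x).
Proof.
elim: m f g => [|m IHm] f g cf cg.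
  exact: cont_mul.
apply: (@CkSI m _ (fun k x => f x * pd k g x + g x * pd k f x)) => [|k x|k].
- exact: (cont_mul (Ck_continuous cf) (Ck_continuous cg)).
- exact: (is_deriveM (CkS_is_derive k x cf) (CkS_is_derive k x cg)).
- by apply: CkD; apply: IHm; [exact: CkW|exact: CkS_pd|exact: CkW|exact: CkS_pd].
Qed.

Lemma CkMl m c f : Ck m f -> Ck m (fun x => c * f x).
Proof. by move=> cf; apply: CkM => //; exact: Ck_cst. Qed.

Lemma CkN m f : Ck m f -> Ck m (fun x => - f x).
Proof.
move=> /(CkMl (-1)); rewrite (_ : (fun x => - f x) = (fun x => -1 * f x)) //.
by apply/funext => x; rewrite mulN1r.
Qed.

Lemma CkB m f g : Ck m f -> Ck m g -> Ck m (fun x => f x - g x).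
Proof. by move=> cf cg; apply: CkD => //; exact: CkN. Qed.

Lemma Ck_sum m (I : Type) (r : seq I) (P : pred I) (f : I -> V -> R) :
  (forall i, P i -> Ck m (f i)) -> Ck m (fun x => \sum_(i <- r | P i) f i x).
Proof.
move=> h; elim: r => [|i r IHr].
  by under eq_fun do rewrite big_nil; exact: Ck_cst.
under eq_fun do rewrite big_cons.
by case Pi: (P i) => //; apply: CkD => //; exact: h.
Qed.

Lemma CkX m f d : Ck m f -> Ck m (fun x => f x ^+ d).
Proof.
move=> cf; elim: d => [|d IHd]; first exact: Ck_cst.
by under eq_fun do rewrite exprS; exact: CkM.
Qed.

Lemma CkV m (f : V -> R) : (forall x, f x != 0) -> Ck m f -> Ck m (fun x => (f x)^-1).
Proof.
move=> f0; elim: m => [|m IHm] cf.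
  exact: cont_inv.
apply: (@CkSI m (fun x => (f x)^-1) (fun k x => - ((f x)^-1 ^+ 2) * pd k f x)) => [|k x|k].
- exact: (cont_inv f0 (Ck_continuous cf)).
- have hf := @CkS_derivable _ _ k x cf; apply: DeriveDef; first exact: derivableV.
  by rewrite deriveV // /pd exprVn /GRing.scale /= exprnN.
- by apply: (@CkM m (fun x => - ((f x)^-1 ^+ 2))); [apply/CkN/CkX/IHm/CkW|exact: CkS_pd].
Qed.

Lemma is_derive_comp1 (F : R -> R) (dF : R) (g : V -> R) x v dg :
  is_derive (g x) 1 F dF -> is_derive x v g dg -> is_derive x v (F \o g) (dF * dg).
Proof.
move=> hF hg; pose l (h : R) := g (h *: v + x).
have hl (h : R) : g (h *: v + x) = l (h *: (1 : R) + 0) by rewrite /l /GRing.scale /= mulr1 addr0.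
have [h1 h2] := derive_line hl.
have hlF (h : R) : (F \o g) (h *: v + x) = (F \o l) (h *: (1 : R) + 0) by rewrite /= hl.
have [h3 h4] := derive_line hlF.
have il : is_derive (0 : R) 1 l dg.
  by case: hg => hg1 hg2; apply: DeriveDef; [exact/h1|rewrite -h2].
have lx : l 0 = g x by rewrite /l scale0r add0r.
rewrite -lx in hF; have [c1 c2] := is_derive1_comp hF il.
by apply: DeriveDef; [exact/h3|rewrite h4].
Qed.

(** [D] lists the successive derivatives of the outer function, which replaces a chain rule of
    higher order by an induction over all [j] at once. *)
Lemma Ck_comp (D : nat -> R -> R) j m (g : V -> R) :
  (forall i (t : R), is_derive t 1 (D i) (D i.+1 t)) -> Ck m g -> Ck m (fun x => D j (g x)).
Proof.
move=> hD; have cD i : continuous (D i).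
  by move=> t; apply/differentiable_continuous/derivable1_diffP; case: (hD i t).
elim: m j g => [|m IHm] j g cg.
  exact: cont_comp.
apply: (@CkSI m _ (fun k x => D j.+1 (g x) * pd k g x)) => [|k x|k].
- exact: (cont_comp (cD j) (Ck_continuous cg)).
- exact: (is_derive_comp1 (hD j (g x)) (CkS_is_derive k x cg)).
- by apply: CkM; [exact/IHm/CkW|exact: CkS_pd].
Qed.

Lemma has_pdD k f g df dg : has_pd k f df -> has_pd k g dg ->
  has_pd k (fun x => f x + g x) (fun x => df x + dg x).
Proof. by move=> hf hg x; exact: (is_deriveD (hf x) (hg x)). Qed.

Lemma has_pdB k f g df dg : has_pd k f df -> has_pd k g dg ->
  has_pd k (fun x => f x - g x) (fun x => df x - dg x).
Proof. by move=> hf hg x; exact: (is_deriveB (hf x) (hg x)). Qed.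

Lemma has_pdM k f g df dg : has_pd k f df -> has_pd k g dg ->
  has_pd k (fun x => f x * g x) (fun x => f x * dg x + g x * df x).
Proof. by move=> hf hg x; exact: (is_deriveM (hf x) (hg x)). Qed.

Lemma has_pd_cst k c : has_pd k (cst c) (cst 0).
Proof. by move=> x; exact: is_derive_cst. Qed.

Lemma has_pd_coord k i : has_pd k (fun y : V => y ord0 i) (cst (i == k)%:R).
Proof. by move=> x; exact: is_derive_coord. Qed.

Lemma has_pd_comp k (D : R -> R) (dD : R -> R) g dg :
  (forall t : R, is_derive t 1 D (dD t)) -> has_pd k g dg ->
  has_pd k (fun x => D (g x)) (fun x => dD (g x) * dg x).
Proof. by move=> hD hg x; exact: (is_derive_comp1 (hD (g x)) (hg x)). Qed.

Lemma has_pd_eq k f g df dg : has_pd k f df -> f =1 g -> df =1 dg -> has_pd k g dg.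
Proof. by move=> h /funext <- /funext <-. Qed.

Lemma has_pd_sum k (I : Type) (r : seq I) (P : pred I) (f df : I -> V -> R) :
  (forall i, P i -> has_pd k (f i) (df i)) ->
  has_pd k (fun x => \sum_(i <- r | P i) f i x) (fun x => \sum_(i <- r | P i) df i x).
Proof.
move=> h; elim: r => [|i r IHr].
  by apply: (has_pd_eq (has_pd_cst k 0)) => x; rewrite big_nil.
case Pi: (P i).
  by apply: (has_pd_eq (has_pdD (h i Pi) IHr)) => x; rewrite big_cons Pi.
by apply: (has_pd_eq IHr) => x; rewrite big_cons Pi.
Qed.

End PartialDerivatives.

(** * Integration by parts *)

Section CompactSupport.
Context (R : realType).

(** Balls are cubes, since the norm on row vectors is the sup norm. *)
Lemma lebN_ball n (x : 'rV[R]_n) (r : R) : 0 < r -> lebN R n (ball x r) = ((r *+ 2) ^+ n)%:E.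
Proof.
move=> r0; elim: n x => [|n IHn] x.
  rewrite expr0 /= /dirac_rV0 diracE mem_set //.
  by rewrite [x]thinmx0; exact: ballxx.
rewrite /= /push_cons /pushforward preimage_cons_row_ball product_measure1E.
- by rewrite IHn exprS EFinM; congr (_ * _)%E; exact: lebesgue_measure_ball (ltW r0).
- by apply: open_measurable; exact: ball_open.
- by apply: open_measurable_mx; exact: ball_open.
Qed.

Lemma lebN_ball_lty n (x : 'rV[R]_n) (r : R) : 0 < r -> (lebN R n (ball x r) < +oo)%E.
Proof. by move=> r0; rewrite lebN_ball // ltry. Qed.

Lemma compact_support_bounded n (f : 'rV[R]_n -> R) :
  continuous f -> compact_support (f : _ -> R^o) -> exists M, 0 <= M /\ forall x, `|f x| <= M.
Proof.
move=> cf [r hr]; pose A := [set x : 'rV[R]_n | `|x| <= `|r|].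
have cA : compact A.
  apply: bounded_closed_compact.
    by exists `|r|; split => [|y ry x /= xA]; [exact: normr_real|apply: le_trans xA (ltW ry)].
  have -> : A = (fun x : 'rV[R]_n => `|x|) @^-1` [set t | t <= `|r|] by [].
  apply: closed_comp; last exact: closed_le.
  by move=> x _; exact: norm_continuous.
have A0 : A !=set0 by exists 0; rewrite /A /= normr0.
have cnf : continuous (fun x => `|f x|).
  by move=> x; apply: (continuous_comp (cf x)); exact: norm_continuous.
have [c _ hc] := EVT_max_rV A0 cA (continuous_subspaceT cnf).
exists `|f c|; split => // x.
case: (lerP `|x| `|r|) => hx; first by apply: hc; rewrite inE.
by rewrite (hr x) ?normr0 //; apply: le_lt_trans hx; exact: ler_norm.
Qed.

Lemma bounded_support_integrable n (f : 'rV[R]_n -> R) (M r : R) :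
  measurable_fun setT f -> (forall x, `|f x| <= M) -> (forall x, r < `|x| -> f x = 0) ->
  (lebN R n).-integrable setT (EFin \o f).
Proof.
move=> mf hM hr; have M0 : 0 <= M := le_trans (normr_ge0 (f 0)) (hM 0).
pose B : set 'rV[R]_n := ball 0 (`|r| + 1).
have mB : measurable B by apply: open_measurable_mx; exact: ball_open.
have r1 : 0 < `|r| + 1 by rewrite ltr_wpDl.
have iB : (lebN R n).-integrable setT (EFin \o (fun x => M * \1_B x)).
  have : (lebN R n).-integrable setT (fun x => M%:E * (\1_B x)%:E)%E.
    apply: integrableZl => //; apply/integrableP; split.
      exact/measurable_EFinP/measurable_indic.
    under eq_integral do rewrite gee0_abs ?lee_fin //.
    by rewrite integral_indic // setIT; exact: lebN_ball_lty.
  by [].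
apply: le_integrable iB => //; first exact/measurable_EFinP.
move=> x _ /=; rewrite lee_fin [leRHS]ger0_norm ?mulr_ge0 //.
have [xB|xB] := boolP (x \in B); first by rewrite indicE xB mulr1.
rewrite hr ?normr0 ?mulr_ge0 //; move: xB; rewrite notin_setE /B -ball_normE /= sub0r normrN.
move=> /negP; rewrite -leNgt => h; apply: lt_le_trans h; apply: le_lt_trans (ler_norm r) _.
by rewrite ltrDl.
Qed.

Lemma Cc_integrable n (f : 'rV[R]_n -> R) : continuous f -> compact_support (f : _ -> R^o) ->
  (lebN R n).-integrable setT (EFin \o f).
Proof.
move=> cf sf; have [M [_ hM]] := compact_support_bounded cf sf; case: sf => r hr.
exact: (bounded_support_integrable (continuous_measurable_mx cf) hM hr).
Qed.

Lemma integral_derive_compact (h h' : R -> R) (r : R) :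
  (forall t : R, is_derive t 1 h (h' t)) -> continuous h' -> (forall t, r < `|t| -> h t = 0) ->
  (\int[@lebesgue_measure R]_t (h' t)%:E = 0)%E.
Proof.
move=> hd ch' hr; pose a := `|r| + 1.
have ra : r < a by apply: le_lt_trans (ler_norm r) _; rewrite ltrDl.
have a0 : 0 < a by rewrite ltr_wpDl.
have h'0 t : r < `|t| -> h' t = 0.
  move=> rt; case: (hd t) => _ <-; rewrite -(derive_cst (0 : R) t (1 : R)).
  apply: near_eq_derive.
  near=> s; rewrite hr //; near: s.
  by apply: cvgr_gt rt; exact: norm_continuous.
have ch : continuous h.
  by move=> t; apply/differentiable_continuous/derivable1_diffP; case: (hd t).
rewrite (_ : (fun t => (h' t)%:E) = (EFin \o h') \_ `[- a, a]); last first.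
  apply/funext => t; rewrite patchE; case: ifPn => // /negP tn /=.
  rewrite h'0 //; rewrite ltNge; apply/negP => tr; apply: tn; rewrite inE /= in_itv /= -ler_norml.
  by apply: le_trans tr (ltW ra).
rewrite -integral_mkcond (@continuous_FTC2 _ _ h).
- by rewrite !hr ?sube0 // ?normrN gtr0_norm.
- by rewrite gtrN.
- exact: continuous_subspaceT.
- split => [t _||]; first by case: (hd t).
    exact/cvg_at_right_filter/ch.
  exact/cvg_at_left_filter/ch.
- by move=> t _; rewrite derive1E; case: (hd t).
Unshelve. all: by end_near. Qed.

Lemma lineE n (x : 'rV[R]_n) (h : R) k i :
  (h *: evec R k + x) ord0 i = h * (i == k)%:R + x ord0 i.
Proof. by rewrite /evec !mxE eqxx. Qed.

Lemma cons_row_shift n (t : R) (y : 'rV[R]_n) h :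
  h *: evec R ord0 + cons_row (t, y) = cons_row (h + t, y).
Proof.
apply/rowP => i; rewrite lineE; case: (unliftP ord0 i) => [j|] ->.
  by rewrite !cons_rowS /= mulr0 add0r.
by rewrite !cons_row0 /= mulr1.
Qed.

Lemma cons_row_lift_shift n (t : R) (y : 'rV[R]_n) h j :
  h *: evec R (lift ord0 j) + cons_row (t, y) = cons_row (t, h *: evec R j + y).
Proof.
apply/rowP => i; rewrite lineE; case: (unliftP ord0 i) => [i'|] ->.
  by rewrite !cons_rowS lineE (inj_eq (@lift_inj _ ord0)).
by rewrite !cons_row0 /= mulr0 add0r.
Qed.

Lemma norm_cons_row1 n (t : R) (y : 'rV[R]_n) : `|t| <= `|cons_row (t, y)|.
Proof.
rewrite [leRHS]/Num.Def.normr /= mx_normrE.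
by apply: le_trans (le_bigmax _ _ (ord0, ord0)); rewrite /= cons_row0.
Qed.

Lemma norm_cons_row2 n (t : R) (y : 'rV[R]_n) : `|y| <= `|cons_row (t, y)|.
Proof.
rewrite [leLHS]/Num.Def.normr /= mx_normrE; apply: bigmax_le => [|[i j] _ /=]; first exact: normr_ge0.
rewrite [leRHS]/Num.Def.normr /= mx_normrE (ord1 i).
by apply: le_trans (le_bigmax _ _ (ord0, lift ord0 j)); rewrite /= cons_rowS.
Qed.

Lemma continuous_cons_row1 n (y : 'rV[R]_n) : continuous (fun t : R => cons_row (t, y)).
Proof.
apply: continuous_mx => i j; rewrite ord1; case: (unliftP ord0 j) => [j'|] ->.
  have -> : (fun t : R => cons_row (t, y) 0 (lift ord0 j')) = cst (y ord0 j').
    by apply/funext => t; rewrite cons_rowS.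
  exact: cst_continuous.
have -> : (fun t : R => cons_row (t, y) 0 ord0) = id.
  by apply/funext => t; rewrite cons_row0.
by move=> t; exact: cvg_id.
Qed.

Lemma continuous_cons_row2 n (t : R) : continuous (fun y : 'rV[R]_n => cons_row (t, y)).
Proof.
apply: continuous_mx => i j; rewrite ord1; case: (unliftP ord0 j) => [j'|] ->.
  have -> : (fun y : 'rV[R]_n => cons_row (t, y) 0 (lift ord0 j')) = (fun y => y ord0 j').
    by apply/funext => y; rewrite cons_rowS.
  exact: coord_continuous.
have -> : (fun y : 'rV[R]_n => cons_row (t, y) 0 ord0) = cst t.
  by apply/funext => y; rewrite cons_row0.
exact: cst_continuous.
Qed.

Lemma Ck1_derivable n (f : 'rV[R]_n -> R) k x : Ck 1 f -> derivable f x (evec R k).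
Proof. by move=> [_ /(_ k)[]]. Qed.

Lemma Ck1_pd n (f : 'rV[R]_n -> R) k : Ck 1 f -> continuous (pd k f).
Proof. by move=> [_ /(_ k)[]]. Qed.

Lemma pd_compact_support n (f : 'rV[R]_n -> R) k :
  compact_support (f : _ -> R^o) -> compact_support (pd k f : _ -> R^o).
Proof.
move=> [r hr]; exists r => x rx; rewrite /pd -(derive_cst (0 : R) x (evec R k)).
apply: near_eq_derive; near=> s; rewrite hr //; near: s.
by apply: cvgr_gt rx; exact: norm_continuous.
Unshelve. all: by end_near. Qed.

(** Induction on the dimension. A derivative along the first coordinate has to be integrated in that
    coordinate first, hence Fubini in the swapped order; any other direction is treated on slices by
    the induction hypothesis. *)
Lemma integral_pd_compact n (f : 'rV[R]_n -> R) k :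
  Ck 1 f -> compact_support (f : _ -> R^o) -> (\int[lebN R n]_x (pd k f x)%:E = 0)%E.
Proof.
elim: n f k => [|n IHn] f k cf sf; first by case: k.
have cpf := @Ck1_pd _ _ k cf; have spf := pd_compact_support k sf.
have ipf := Cc_integrable cpf spf; case: (sf) => r hr.
case: (unliftP ord0 k) => [j|] kE; rewrite kE in cpf spf ipf *.
  rewrite integral_lebNS //; apply: integral0_eq => t _.
  pose g (y : 'rV[R]_n) := f (cons_row (t, y)).
  have hl y : (derivable f (cons_row (t, y)) (evec R (lift ord0 j)) <-> derivable g y (evec R j)) /\
     'D_(evec R (lift ord0 j)) f (cons_row (t, y)) = 'D_(evec R j) g y.
    by apply: derive_line => h; rewrite cons_row_lift_shift.
  have hg i y : (derivable f (cons_row (t, y)) (evec R (lift ord0 i)) <-> derivable g y (evec R i)) /\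
     'D_(evec R (lift ord0 i)) f (cons_row (t, y)) = 'D_(evec R i) g y.
    by apply: derive_line => h; rewrite cons_row_lift_shift.
  transitivity (\int[lebN R n]_y (pd j g y)%:E)%E.
    by apply: eq_integral => y _; rewrite /pd (hg j y).2.
  apply: IHn.
    split.
      by move=> y; apply: (continuous_comp (@continuous_cons_row2 _ t y)); exact: (Ck_continuous cf).
    move=> i; split; first by move=> y; have [[h1 _] _] := hg i y; apply: h1; exact: (@Ck1_derivable _ f _ _ cf).
    have -> : pd i g = (fun y => pd (lift ord0 i) f (cons_row (t, y))).
      by apply/funext => y; rewrite /pd (hg i y).2.
    move=> y; apply: (continuous_comp (@continuous_cons_row2 _ t y)); exact: Ck1_pd.
  by exists r => y ry; apply: hr; apply: lt_le_trans ry (norm_cons_row2 _ _).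
rewrite integral_lebNS_swap //; apply: integral0_eq => y _.
pose h t := f (cons_row (t, y)).
have hh t : (derivable f (cons_row (t, y)) (evec R ord0) <-> derivable h t (1 : R)) /\
     'D_(evec R ord0) f (cons_row (t, y)) = 'D_(1 : R) h t.
  by apply: derive_line => s; rewrite cons_row_shift /h /GRing.scale /= mulr1.
apply: (@integral_derive_compact h (fun t => pd ord0 f (cons_row (t, y))) r).
- move=> t; apply: DeriveDef; first by have [[h1 _] _] := hh t; apply: h1; exact: (@Ck1_derivable _ f ord0 _ cf).
  by rewrite -(hh t).2.
- by move=> t; apply: (continuous_comp (@continuous_cons_row1 _ y t)); exact: cpf.
- by move=> t rt; apply: hr; apply: lt_le_trans rt (norm_cons_row1 _ _).
Qed.

End CompactSupport.

(** * A smooth cut-off function on the line *)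

Section Bump.
Context (R : realType).

(** The functions p(1/t) exp(-1/t), extended by 0, are closed under derivation: p becomes X^2 (p -
    p'). This yields all derivatives of exp(-1/t) at once. *)
Definition bump (p : {poly R}) (t : R) : R := if 0 < t then p.[t^-1] * expR (- t^-1) else 0.

Definition bump_deriv (p : {poly R}) : {poly R} := 'X^2 * (p - p^`()).

(** One monomial at a time, from s^(i+1) / (i+1)! <= exp s. *)
Lemma horner_expR_bounded (p : {poly R}) :
  exists C, 0 <= C /\ forall s, 0 <= s -> `|p.[s]| * expR (- s) <= C.
Proof.
pose B i := (i.+1)`!%:R : R.
have hb i s : 0 <= s -> s ^+ i.+1 * expR (- s) <= B i.
  move=> s0; rewrite expRN -[leLHS]/(_ / _) ler_pdivrMr ?expR_gt0 //.
  have := expR_ge1Dxn i s0; have f0 : 0 < B i by rewrite ltr0n fact_gt0.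
  move=> h; rewrite mulrC -ler_pdivrMr //; apply: le_trans h; by rewrite ler_wpDl.
exists (`|p`_0| + \sum_(i < size p) `|p`_i.+1| * B i); split.
  apply: addr_ge0 => //; apply: sumr_ge0 => i _; apply: mulr_ge0 => //; exact: ler0n.
move=> s s0; have -> : p.[s] = p`_0 + \sum_(i < size p) p`_i.+1 * s ^+ i.+1.
  rewrite (@horner_coef_wide _ (size p).+1) // big_ord_recl expr0 mulr1.
  by congr (_ + _).
have e0 := expR_ge0 (- s).
have e1 : expR (- s) <= 1 by rewrite expR_le1 oppr_le0.
apply: le_trans (ler_wpM2r e0 (ler_normD _ _)) _; rewrite mulrDl; apply: lerD.
  by rewrite ler_piMr.
apply: le_trans (ler_wpM2r e0 (ler_norm_sum _ _ _)) _; rewrite mulr_suml; apply: ler_sum => i _.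
by rewrite normrM (ger0_norm (exprn_ge0 _ s0)) -mulrA ler_wpM2l // hb.
Qed.

(** Boundedness of s^2 p(s) exp(-s), read at s = 1/t. A quadratic bound forces the derivative at 0
    to vanish, and its validity for every [p] covers derivatives of all orders. *)
Lemma bump_le_sqr p : exists C, 0 <= C /\ forall t, `|bump p t| <= C * t ^+ 2.
Proof.
have [C [C0 hC]] := horner_expR_bounded ('X^2 * p); exists C; split => // t.
rewrite /bump; case: ifPn => [t0|_]; last by rewrite normr0 mulr_ge0 // sqr_ge0.
have := hC t^-1; rewrite invr_ge0 => /(_ (ltW t0)).
rewrite hornerM hornerXn [`|_ * p.[_]|]normrM [`|_ * expR _|]normrM (ger0_norm (expR_ge0 _)).
by rewrite (ger0_norm (sqr_ge0 _)) exprVn -mulrA ler_pdivrMl ?exprn_gt0 // [C * _]mulrC.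
Qed.

Lemma is_derive0_sqr (g : R -> R) C : (forall t, `|g t| <= C * t ^+ 2) -> is_derive (0 : R) 1 g 0.
Proof.
move=> h; have g0 : g 0 = 0 by apply/eqP; rewrite -normr_le0 (le_trans (h 0)) // expr0n mulr0.
have C0 : 0 <= C by have := h 1; rewrite expr1n mulr1; exact: le_trans.
have cv : h^-1 *: ((g \o shift 0) (h *: 1) - g 0) @[h --> 0^'] --> (0 : R).
  apply/cvgrPdist_le => e e0; near=> s.
  have s0 : s != 0 by near: s; exact: nbhs_dnbhs_neq.
  rewrite sub0r normrN g0 subr0 /= addr0 /GRing.scale /= mulr1 normrM normfV.
  rewrite ler_pdivrMl ?normr_gt0 // (le_trans (h s)) // (_ : s ^+ 2 = `|s| * `|s|); last first.
    by rewrite -normrM -expr2 ger0_norm ?sqr_ge0.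
  rewrite mulrA.
  rewrite mulrC ler_wpM2l //.
  have : `|s| <= e / (C + 1).
    near: s; apply: dnbhs0_le; rewrite divr_gt0 // ltr_wpDl //.
  rewrite ler_pdivlMr ?ltr_wpDl // => hs; apply: le_trans hs; rewrite mulrC ler_wpM2l //.
  by rewrite lerDl.
apply: DeriveDef; first by apply/cvg_ex; exists 0.
exact/cvg_lim.
Unshelve. all: by end_near. Qed.

Lemma is_derive_bump p (t : R) : is_derive t 1 (bump p) (bump (bump_deriv p) t).
Proof.
have [t0|t0|<-] := ltrgtP 0 t.
- have hd : is_derive t 1 (fun s => p.[s^-1] * expR (- s^-1)) (bump (bump_deriv p) t).
    have hi : is_derive t 1 (fun s : R => s^-1) (- t ^- 2).
      have := @is_deriveV R id t 1 1; rewrite gt_eqF //= => /(_ isT (is_derive_id _ _)).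
      by move=> h; apply: is_derive_eq; rewrite /GRing.scale /= mulr1.
    have hp : is_derive t 1 (fun s : R => p.[s^-1]) (p^`().[t^-1] * - t ^- 2).
      exact: (@is_derive1_comp R (horner p) (fun s => s^-1)).
    have he : is_derive t 1 (fun s : R => expR (- s^-1)) (expR (- t^-1) * t ^- 2).
      apply: (@is_derive1_comp R expR (fun s => - s^-1)).
      by have := is_deriveN hi; rewrite opprK.
    have hm : is_derive t 1 (fun s : R => p.[s^-1] * expR (- s^-1))
      (p.[t^-1] * (expR (- t^-1) / t ^+ 2) + expR (- t^-1) * (p^`().[t^-1] * - t ^- 2)).
      exact: (is_deriveM hp he).
    apply: (is_derive_eq hm).
    rewrite /bump t0 /bump_deriv hornerM hornerXn hornerD hornerN /GRing.scale /= exprVn; ring.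
  apply: near_eq_is_derive hd; near=> s.
  by rewrite /bump (_ : 0 < s) //; near: s; exact: lt_nbhsr.
- rewrite {2}/bump ltNge (ltW t0) /=; apply: near_eq_is_derive (is_derive_cst (0 : R) t (1 : R)).
  near=> s; rewrite /bump /cst ifF //; apply/negbTE; rewrite -leNgt ltW //.
  by near: s; exact: lt_nbhsl.
- have [C [_ hC]] := bump_le_sqr p; rewrite {2}/bump ltxx; exact: is_derive0_sqr hC.
Unshelve. all: by end_near. Qed.

(** The index counts derivatives. The factor e normalizes the value at 1 to 1; the cut-offs below
    use arguments at most 1, where every [cut1 j] is bounded. *)
Definition cut1 (j : nat) : R -> R := fun t => expR 1 * bump (iter j bump_deriv 1) t.

Lemma is_derive_cut1 j (t : R) : is_derive t 1 (cut1 j) (cut1 j.+1 t).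
Proof.
have := is_deriveM (is_derive_cst (expR 1 : R) t 1) (is_derive_bump (iter j bump_deriv 1) t).
by move=> h; apply: is_derive_eq; rewrite /GRing.scale /= mulr0 addr0.
Qed.

Lemma cut1_le0 j t : t <= 0 -> cut1 j t = 0.
Proof. by move=> t0; rewrite /cut1 /bump ltNge t0 mulr0. Qed.

Lemma cut1_01 t : t <= 1 -> 0 <= cut1 0 t <= 1.
Proof.
move=> t1; rewrite /cut1 /bump; case: ifPn => [t0|_]; last by rewrite mulr0 lexx ler01.
rewrite hornerC mul1r -expRD expR_ge0 expR_le1 subr_le0.
by rewrite invf_ge1.
Qed.

Lemma cut1_1 : cut1 0 1 = 1.
Proof. by rewrite /cut1 /bump ltr01 invr1 hornerC mul1r -expRD subrr expR0. Qed.

Lemma cut1_bounded j : exists C, 0 <= C /\ forall t, t <= 1 -> `|cut1 j t| <= C.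
Proof.
have [C [C0 hC]] := bump_le_sqr (iter j bump_deriv 1).
exists (expR 1 * C); split; first by rewrite mulr_ge0 // expR_ge0.
move=> t t1; case: (ltrP 0 t) => t0; last first.
  by rewrite cut1_le0 // normr0 mulr_ge0 // expR_ge0.
rewrite normrM ger0_norm ?expR_ge0 // ler_wpM2l ?expR_ge0 // (le_trans (hC t)) //.
by rewrite ler_piMr // exprn_ile1 // ltW.
Qed.

End Bump.

Lemma ler_norm_sqr (R : realType) (a b : R) : 0 <= b -> a ^+ 2 <= b ^+ 2 -> `|a| <= b.
Proof.
by move=> b0 h; rewrite -(@ler_pXn2r _ 2) ?nnegrE ?normr_ge0 // real_normK ?num_real.
Qed.

Lemma cvg_sumr (R : realType) (I : Type) (r : seq I) (T : Type) (F : set_system T) {FF : Filter F}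
  (f : I -> T -> R) (l : I -> R) :
  (forall i, f i @ F --> l i) -> \sum_(i <- r) f i x @[x --> F] --> \sum_(i <- r) l i.
Proof.
move=> h; elim: r => [|i r IHr].
  rewrite big_nil (_ : (fun _ => _) = cst 0); first exact: cvg_cst.
  by apply/funext => x; rewrite big_nil.
rewrite big_cons (_ : (fun _ => _) = (fun x => f i x + \sum_(j <- r) f j x)).
  exact: (cvgD (h i) IHr).
by apply/funext => x; rewrite big_cons.
Qed.

Lemma Rdominated_cvg d (T : measurableType d) (R : realType) (m : {measure set T -> \bar R})
    (fs : nat -> T -> R) (f g : T -> R) :
  (forall i, measurable_fun setT (fs i)) -> measurable_fun setT f ->
  (forall x, fs i x @[i --> \oo] --> f x) ->
  m.-integrable setT (EFin \o g) -> (forall i x, `|fs i x| <= g x) ->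
  m.-integrable setT (EFin \o f) /\
  \int[m]_x fs i x @[i --> \oo] --> \int[m]_x f x.
Proof.
move=> mfs mf fsf ig hg.
have := @dominated_convergence _ _ _ m setT measurableT (fun i x => (fs i x)%:E) (EFin \o f)
  (EFin \o g).
case=> [i|||||if0 _ h].
- exact/measurable_EFinP.
- exact/measurable_EFinP.
- by apply: aeW => x _; apply: cvg_EFin; [exact: nearW|exact: fsf].
- exact: ig.
- by apply: aeW => x i _; rewrite /= lee_fin.
split => //; apply: fine_cvg; rewrite fineK; last exact: integrable_fin_num.
exact: h.
Qed.

(** * Cut-offs in space and the divergence theorem *)

Section Cutoff.
Context (R : realType) (n : nat).
Local Notation V := 'rV[R]_n.
Local Notation mu := (lebN R n).

Lemma sqnorm_ge0 (x : V) : 0 <= sqnorm x.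
Proof. by apply: sumr_ge0 => i _; exact: sqr_ge0. Qed.

Lemma sqr_coord_le_sqnorm (x : V) i : x ord0 i ^+ 2 <= sqnorm x.
Proof.
rewrite /sqnorm (bigD1 i) //= lerDl; apply: sumr_ge0 => j _; exact: sqr_ge0.
Qed.

Lemma norm_sqr_le_sqnorm (x : V) : `|x| ^+ 2 <= sqnorm x.
Proof.
have s0 := sqnorm_ge0 x; rewrite -[leRHS]sqr_sqrtr // lerXn2r ?nnegrE ?sqrtr_ge0 //.
rewrite [leLHS]/Num.Def.normr /= mx_normrE; apply: bigmax_le => [|[i j] _ /=]; first exact: sqrtr_ge0.
by rewrite (ord1 i) -sqrtr_sqr ler_wsqrtr // sqr_coord_le_sqnorm.
Qed.

Lemma Ck_sqnorm m : Ck m (@sqnorm R n).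
Proof. by apply: Ck_sum => i _; apply: CkX; exact: Ck_coord. Qed.

Lemma has_pd_sqnorm k : has_pd k (@sqnorm R n) (fun x => 2 * x ord0 k).
Proof.
apply: (@has_pd_eq _ _ k _ _ _ _ (@has_pd_sum _ _ k _ (index_enum 'I_n) predT _ _
  (fun i _ => has_pdM (has_pd_coord k i) (has_pd_coord k i)))) => x /=.
  by apply: eq_bigr => i _; rewrite expr2.
rewrite (bigD1 k) //= big1 => [|i ik]; last by rewrite (negbTE ik) mulr0 addr0.
by rewrite eqxx mulr1 addr0; ring.
Qed.

Definition cutoff (m : nat) (x : V) : R := cut1 0 (1 - sqnorm x / m.+1%:R ^+ 2).

Lemma cutoff_arg_le1 m (x : V) : 1 - sqnorm x / m.+1%:R ^+ 2 <= 1.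
Proof. by rewrite gerBl divr_ge0 ?sqnorm_ge0 ?sqr_ge0. Qed.

Lemma cutoff_01 m x : 0 <= cutoff m x <= 1.
Proof. exact/cut1_01/cutoff_arg_le1. Qed.

Lemma cutoff0 m (x : V) : m.+1%:R ^+ 2 <= sqnorm x -> cutoff m x = 0.
Proof.
by move=> h; apply: cut1_le0; rewrite subr_le0 ler_pdivlMr ?mul1r // exprn_gt0.
Qed.

Lemma cutoff_support m (x : V) : m.+1%:R < `|x| -> cutoff m x = 0.
Proof.
move=> h; apply: cutoff0; apply: le_trans (norm_sqr_le_sqnorm x).
by rewrite lerXn2r ?nnegrE ?ler0n ?normr_ge0 // ltW.
Qed.

Lemma Ck_cutoff_arg j m : Ck j (fun x : V => 1 - sqnorm x / m.+1%:R ^+ 2).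
Proof.
apply: CkB; first exact: Ck_cst.
by apply: CkM; [exact: Ck_sqnorm|exact: Ck_cst].
Qed.

Lemma Ck_cutoff j m : Ck j (cutoff m).
Proof. by apply: Ck_comp; [exact: is_derive_cut1|exact: Ck_cutoff_arg]. Qed.

Lemma has_pd_cutoff k m : has_pd k (cutoff m)
  (fun x => cut1 1 (1 - sqnorm x / m.+1%:R ^+ 2) * (- (2 * x ord0 k / m.+1%:R ^+ 2))).
Proof.
apply: (@has_pd_comp _ _ k (cut1 0) (cut1 1) (fun x : V => 1 - sqnorm x / m.+1%:R ^+ 2)).
  exact: is_derive_cut1.
apply: (@has_pd_eq _ _ k _ _ _ _ (has_pdB (has_pd_cst k 1)
   (has_pdM (has_pd_sqnorm k) (has_pd_cst k (m.+1%:R ^+ 2)^-1)))) => x //=.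
by rewrite /cst; ring.
Qed.

(** The Japanese bracket, a substitute for |x| in decay rates that stays away from 0. *)
Definition jap (x : V) : R := Num.sqrt (1 + sqnorm x).

Lemma jap_sqr x : jap x ^+ 2 = 1 + sqnorm x.
Proof. by rewrite sqr_sqrtr // addr_ge0 // sqnorm_ge0. Qed.

Lemma jap_ge1 x : 1 <= jap x.
Proof. by rewrite -[leLHS]sqrtr1 ler_wsqrtr // lerDl sqnorm_ge0. Qed.

Lemma jap_gt0 x : 0 < jap x.
Proof. exact: lt_le_trans (jap_ge1 x). Qed.

Lemma continuous_sqnorm : continuous (@sqnorm R n).
Proof. exact: (Ck_sqnorm 0). Qed.

Lemma continuous_jap : continuous jap.
Proof.
move=> x; apply: (@continuous_comp _ _ _ (fun y : V => 1 + sqnorm y) Num.sqrt); last exact: sqrt_continuous.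
by apply: (@cont_add _ _ (cst 1)); [exact: cst_continuous|exact: continuous_sqnorm].
Qed.

Lemma abs_coord_le_jap (x : V) i : `|x ord0 i| <= jap x.
Proof.
rewrite -sqrtr_sqr ler_wsqrtr // (le_trans (sqr_coord_le_sqnorm x i)) //.
by rewrite lerDr.
Qed.

(** The gradient lives where |x| < m + 1, and there [jap x] is at most 2 (m + 1). The bound by C /
    jap is uniform in m and serves for domination; the bound by C / (m + 1) gives convergence to
    0. *)
Lemma pd_cutoff_bound : exists C, 0 <= C /\
  forall m k x, `|pd k (cutoff m) x| <= C / jap x /\ `|pd k (cutoff m) x| <= C / m.+1%:R.
Proof.
have [C [C0 hC]] := @cut1_bounded R 1; exists (4 * C); split; first by rewrite mulr_ge0.
move=> m k x; rewrite (has_pdE (@has_pd_cutoff k m)); set M : R := m.+1%:R.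
have M0 : 0 < M by rewrite ltr0n.
have M1 : 1 <= M by rewrite ler1n.
case: (lerP (M ^+ 2) (sqnorm x)) => hx.
  rewrite cut1_le0; last by rewrite subr_le0 ler_pdivlMr ?mul1r // exprn_gt0.
  by rewrite mul0r normr0 !divr_ge0 ?mulr_ge0 // ltW // jap_gt0.
have xM : `|x ord0 k| <= M.
  apply: ler_norm_sqr; first exact: ltW.
  exact: le_trans (sqr_coord_le_sqnorm x k) (ltW hx).
have jM : jap x <= 2 * M.
  rewrite -[leLHS]ger0_norm ?(ltW (jap_gt0 _)) //; apply: ler_norm_sqr; rewrite ?mulr_ge0 ?(ltW M0) // jap_sqr.
  rewrite exprMn; have : 1 <= M ^+ 2 by rewrite expr_ge1 // ltW.
  move: (ltW hx) => {hx hC} hx h1; lra.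
have key : `|cut1 1 (1 - sqnorm x / M ^+ 2) * - (2 * x ord0 k / M ^+ 2)| <= 2 * C / M.
  rewrite normrM normrN; apply: le_trans (ler_wpM2r (normr_ge0 _) (hC _ (cutoff_arg_le1 m x))) _.
  rewrite normrM normrM ger0_norm // normfV (ger0_norm (sqr_ge0 M)).
  rewrite [leRHS](_ : _ = C * (2 * M / M ^+ 2)); last by field; rewrite gt_eqF.
  by rewrite ler_wpM2l // ler_wpM2r ?invr_ge0 ?sqr_ge0 // ler_wpM2l.
split; apply: le_trans key _.
  rewrite ler_pdivrMr // mulrAC ler_pdivlMr ?jap_gt0 //.
  apply: le_trans (ler_wpM2l _ jM) _; first by rewrite mulr_ge0.
  by rewrite le_eqVlt; apply/orP; left; apply/eqP; ring.
by rewrite ler_wpM2r ?invr_ge0 ?ler0n // ler_wpM2r // ler_nat.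
Qed.

Lemma cvg_cutoff (x : V) : cutoff m x @[m --> \oo] --> (1 : R).
Proof.
rewrite -[X in _ --> X](@cut1_1 R).
have c0 : continuous (cut1 0 : R -> R).
  by move=> t; apply/differentiable_continuous/derivable1_diffP; case: (is_derive_cut1 0 t).
apply: (continuous_cvg _ (c0 1)); rewrite -[X in _ --> X]subr0; apply: cvgB; first exact: cvg_cst.
rewrite -[X in _ --> X](mulr0 (sqnorm x)); apply: cvgM; first exact: cvg_cst.
have h : (m.+1%:R^-1 : R) @[m --> \oo] --> (0 : R) by exact: cvg_harmonic.
rewrite (_ : (fun m : nat => (m.+1%:R ^- 2 : R)) = (fun m => m.+1%:R^-1 * m.+1%:R^-1)).
  by rewrite -[X in _ --> X](mulr0 (0 : R)); exact: cvgM.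
by apply/funext => m; rewrite expr2 invfM.
Qed.

Lemma cutoff_compact_support m (f : V -> R) :
  compact_support ((fun x => cutoff m x * f x) : V -> R^o).
Proof. by exists m.+1%:R => x /cutoff_support ->; rewrite mul0r. Qed.

Lemma cvg_pd_cutoff (x : V) k : pd k (cutoff m) x @[m --> \oo] --> (0 : R).
Proof.
have [C [C0 hC]] := pd_cutoff_bound; apply/norm_cvg0P.
have h : (m.+1%:R^-1 : R) @[m --> \oo] --> (0 : R) by exact: cvg_harmonic.
have h2 : C * m.+1%:R^-1 @[m --> \oo] --> (0 : R).
  by rewrite -[X in _ --> X](mulr0 C); apply: cvgM => //; exact: cvg_cst.
apply: (squeeze_cvgr _ (cvg_cst 0) h2); near=> m.
by rewrite normr_ge0 /=; have [_] := hC m k x.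
Unshelve. all: by end_near. Qed.

(** The divergence of the cut-off field integrates to 0. The extra term F . grad cutoff tends to 0
    and is dominated by C times the sum of the |F k| / jap, so the weight 1 / jap in the hypothesis
    is the decay of the gradient of the cut-offs. The one-sided bound by [D] is the form in which
    pointwise inequalities are integrated later. *)
Lemma integral_div_le (F : 'I_n -> V -> R) (D : V -> R) :
  (forall k, Ck 1 (F k)) ->
  (forall k, mu.-integrable setT (EFin \o (fun x => F k x / jap x))) ->
  mu.-integrable setT (EFin \o D) -> (forall x, \sum_k pd k (F k) x <= D x) ->
  0 <= \int[mu]_x D x.
Proof.
move=> cF iF iD FD; have [C [C0 hC]] := pd_cutoff_bound.
pose g m (x : V) : R := \sum_k pd k (fun y => cutoff m y * F k y) x.
pose h m (x : V) : R := cutoff m x * D x + \sum_k F k x * pd k (cutoff m) x.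
have gh m x : g m x <= h m x.
  have -> : g m x = cutoff m x * (\sum_k pd k (F k) x) + \sum_k F k x * pd k (cutoff m) x.
    rewrite /g mulr_sumr -big_split /=; apply: eq_bigr => k _.
    by rewrite (has_pdE (has_pdM (CkS_has_pd k (Ck_cutoff 1 m)) (CkS_has_pd k (cF k)))).
  by rewrite lerD2r ler_wpM2l // (andP (cutoff_01 m x)).1.
have cg m k : Ck 1 (fun y => cutoff m y * F k y) by apply: CkM => //; exact: Ck_cutoff.
have icg m k : mu.-integrable setT (EFin \o pd k (fun y => cutoff m y * F k y)).
  apply: Cc_integrable; first exact: Ck1_pd.
  by apply: pd_compact_support; exact: cutoff_compact_support.
have ig m : mu.-integrable setT (EFin \o g m).
  have : mu.-integrable setT (fun x => \sum_k (pd k (fun y => cutoff m y * F k y) x)%:E)%E.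
    by apply: integrable_sum => // k _; exact: icg.
  by apply: eq_integrable => // x _ /=; rewrite -sumEFin.
have g0 m : \int[mu]_x g m x = 0.
  rewrite /Rintegral (_ : (fun x => (g m x)%:E) = (fun x => \sum_k (pd k (fun y => cutoff m y * F k y) x)%:E)%E).
    rewrite integral_sum //; first by rewrite big1 // => k _; apply: integral_pd_compact => //; exact: cutoff_compact_support.
    by move=> k; exact: icg.
  by apply/funext => x; rewrite -sumEFin.
pose B (x : V) : R := `|D x| + C * \sum_k `|F k x / jap x|.
have iB : mu.-integrable setT (EFin \o B).
  have i2 : mu.-integrable setT (EFin \o (fun x => \sum_k `|F k x / jap x|)).
    have : mu.-integrable setT (fun x => \sum_(k < n) (`|F k x / jap x|%:E))%E.
      by apply: integrable_sum => // k _; have := integrable_abse (iF k).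
    by apply: eq_integrable => // x _ /=; rewrite sumEFin.
  have i3 : mu.-integrable setT (EFin \o (fun x => C * \sum_k `|F k x / jap x|)).
    by have := integrableZl measurableT C i2.
  by have := integrableD measurableT (integrable_abse iD) i3.
have mD : measurable_fun setT D by exact/measurable_EFinP/measurable_int/iD.
have mh m : measurable_fun setT (h m).
  apply: measurable_funD.
    by apply: measurable_funM => //; apply: continuous_measurable_mx; exact: (Ck_cutoff 0).
  have c0 : Ck 0 (fun x => \sum_k F k x * pd k (cutoff m) x).
    apply: Ck_sum => k _; apply: CkM; first exact: Ck_continuous (cF k).
    by apply: Ck1_pd; exact: Ck_cutoff.
  exact: (continuous_measurable_mx c0).
have hB m x : `|h m x| <= B x.
  apply: le_trans (ler_normD _ _) _; apply: lerD.
    have /andP[c0 c1] := cutoff_01 m x; by rewrite normrM ger0_norm // ler_piMl.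
  apply: le_trans (ler_norm_sum _ _ _) _; rewrite mulr_sumr; apply: ler_sum => k _.
  have [hk _] := hC m k x; rewrite !normrM normfV (ger0_norm (ltW (jap_gt0 x))) mulrCA.
  by rewrite ler_wpM2l.
have ih m : mu.-integrable setT (EFin \o h m).
  apply: le_integrable iB => //; first exact/measurable_EFinP.
  by move=> x _ /=; rewrite lee_fin (le_trans (hB m x)) // ler_norm.
have hD x : h m x @[m --> \oo] --> D x.
  have : cutoff m x * D x + \sum_k F k x * pd k (cutoff m) x @[m --> \oo] --> 1 * D x + \sum_(k < n) F k x * 0.
    apply: cvgD; first by apply: cvgM; [exact: cvg_cutoff|exact: cvg_cst].
    by apply: cvg_sumr => k; apply: cvgM; [exact: cvg_cst|exact: cvg_pd_cutoff].
  by rewrite mul1r [X in D x + X]big1 ?addr0 // => k _; rewrite mulr0.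
have [_ cv] := Rdominated_cvg mh mD hD iB hB.
rewrite -(cvg_lim (@Rhausdorff R) cv); apply: limr_ge; first by apply/cvg_ex; eexists; exact: cv.
by apply: nearW => m; rewrite -(g0 m); apply: le_Rintegral.
Qed.

Lemma integral_div0 (F : 'I_n -> V -> R) :
  (forall k, Ck 1 (F k)) ->
  (forall k, mu.-integrable setT (EFin \o (fun x => F k x / jap x))) ->
  mu.-integrable setT (EFin \o (fun x => \sum_k pd k (F k) x)) ->
  \int[mu]_x (\sum_k pd k (F k) x) = 0.
Proof.
move=> cF iF iD; apply/eqP; rewrite eq_le; apply/andP; split; last first.
  by apply: (integral_div_le cF iF iD) => x.
rewrite -oppr_ge0 -[leRHS]mulN1r -(RintegralZl _ measurableT iD).
apply: (@integral_div_le (fun k x => -1 * F k x)).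
- by move=> k; exact: CkMl.
- move=> k; have := integrableZl measurableT (-1) (iF k).
  by apply: eq_integrable => // x _ /=; rewrite -EFinM mulrA.
- by have := integrableZl measurableT (-1) iD.
- move=> x; rewrite mulr_sumr; apply: ler_sum => k _.
  by rewrite (has_pdE (has_pdM (has_pd_cst k (-1)) (CkS_has_pd k (cF k)))) /= mulr0 addr0.
Qed.

End Cutoff.

Section UnderIntegral.
Context (R : realType) d (Y : measurableType d) (mu : {measure set Y -> \bar R}).

Lemma is_derive_under_integral (f df : R -> Y -> R) (G : Y -> R) (a : R) :
  (forall (t : R) y, is_derive t 1 (f^~ y) (df t y)) ->
  (forall t, mu.-integrable setT (EFin \o f t)) ->
  mu.-integrable setT (EFin \o G) ->
  (forall t y, a - 1 < t < a + 1 -> `|df t y| <= G y) ->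
  is_derive a 1 (fun t => \int[mu]_y f t y) (\int[mu]_y df a y).
Proof.
move=> hd fi Gi hG.
have Ia : (`]a - 1, a + 1[%classic : set R) a by rewrite /= in_itv /=; apply/andP; split; lra.
have G0 y : 0 <= G y.
  by apply: le_trans (normr_ge0 _) (hG a y _); apply/andP; split; lra.
have d1 t y : partial1of2 f t y = df t y.
  by rewrite partial1of2E; case: (hd t y).
have hub t y : (`]a - 1, a + 1[%classic : set R) t -> setT y -> `|partial1of2 f t y| <= G y.
  by move=> /=; rewrite in_itv /= d1 => h _; exact: hG.
have hder t y : (`]a - 1, a + 1[%classic : set R) t -> setT y -> derivable (f^~ y) t 1.
  by move=> _ _; case: (hd t y).
apply: DeriveDef.
  exact: (@derivable_under_integral _ _ _ mu f setT measurableT a (a - 1) (a + 1) Ia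
    (fun t _ => fi t) hder G G0 Gi hub).
rewrite -derive1E (@differentiation_under_integral _ _ _ mu f setT measurableT a (a - 1) (a + 1) Ia
    (fun t _ => fi t) hder G G0 Gi hub).
by apply: eq_Rintegral => y _; rewrite d1.
Qed.

End UnderIntegral.

(** * The Gaussian and its Fourier integrals *)

Section Gaussian.
Context (R : realType).

Definition gauss (n : nat) (c : R) (x : 'rV[R]_n) : R := expR (- (c * sqnorm x)).

Lemma gauss_gt0 n c (x : 'rV[R]_n) : 0 < gauss c x.
Proof. exact: expR_gt0. Qed.

Lemma Ck_gauss n m c : Ck m (@gauss n c).
Proof.
apply: (@Ck_comp _ _ (fun _ => expR) 0 m (fun x => - (c * sqnorm x)) (fun _ t => is_derive_expR t)).
by apply: CkN; apply: CkMl; exact: Ck_sqnorm.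
Qed.

Lemma has_pd_gauss n c k : has_pd k (@gauss n c) (fun x => gauss c x * (- (2 * c * x ord0 k))).
Proof.
apply: (@has_pd_comp _ _ k expR expR (fun x : 'rV[R]_n => - (c * sqnorm x)) _ (@is_derive_expR R)).
apply: (@has_pd_eq _ _ k _ _ _ _ (has_pdM (has_pd_cst k (- c)) (has_pd_sqnorm k))) => x /=.
  by rewrite mulNr.
by rewrite /cst; ring.
Qed.

Definition gauss1_mass (c : R) := Num.sqrt (pi / c).

Lemma integral_gauss1 (m c : R) : 0 < c ->
  (\int[@lebesgue_measure R]_t (expR (- (c * (t - m) ^+ 2)))%:E = (gauss1_mass c)%:E)%E.
Proof.
(* The normal density of variance 1/(2c) has the given exponent. *)
move=> c0; pose s := Num.sqrt (2 * c)^-1.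
have c2 : 0 < (2 * c)^-1 by rewrite invr_gt0 mulr_gt0.
have s0 : s != 0 by rewrite gt_eqF // sqrtr_gt0.
have s2 : s ^+ 2 = (2 * c)^-1 by rewrite sqr_sqrtr // ltW.
have p0 := normal_peak_gt0 s0.
have hpk : (normal_peak s)^-1 = gauss1_mass c.
  rewrite /normal_peak invrK s2 /gauss1_mass; congr Num.sqrt.
  by field; rewrite gt_eqF.
have hE t : expR (- (c * (t - m) ^+ 2)) = (normal_peak s)^-1 * normal_pdf m s t.
  rewrite normal_pdfE // mulrA mulVf ?gt_eqF // mul1r /normal_fun s2; congr expR.
  by rewrite -mulr_natr; field; rewrite gt_eqF.
under eq_integral do rewrite hE EFinM.
rewrite integralZl //; last exact: integrable_normal_pdf.
by rewrite integral_normal_pdf ?mule1 // hpk.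
Qed.

Lemma measurable_gauss n c : measurable_fun setT (@gauss n c).
Proof. exact: (continuous_measurable_mx (Ck_gauss n 0 c)). Qed.

Lemma continuous_gauss_shift n c (z : 'rV[R]_n) : continuous (fun x : 'rV[R]_n => gauss c (x - z)).
Proof.
have h : Ck 0 (fun x : 'rV[R]_n => expR (- (c * \sum_k (x ord0 k - z ord0 k) ^+ 2))).
  apply: (@Ck_comp _ _ (fun _ => expR) 0 0 _ (fun _ t => is_derive_expR t)).
  apply: CkN; apply: CkMl; apply: Ck_sum => k _; apply: CkX.
  by apply: CkB; [exact: Ck_coord|exact: Ck_cst].
rewrite (_ : (fun x => _) = (fun x : 'rV[R]_n => expR (- (c * \sum_k (x ord0 k - z ord0 k) ^+ 2)))) //.
apply/funext => x; rewrite /gauss /sqnorm; congr (expR (- (c * _))).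
by apply: eq_bigr => k _; rewrite !mxE.
Qed.

Lemma subrowE n (x z : 'rV[R]_n) i : (x - z) ord0 i = x ord0 i - z ord0 i.
Proof. by rewrite !mxE. Qed.

Lemma ge0_integral_gauss_shift n (c : R) (z : 'rV[R]_n) : 0 < c ->
  (\int[lebN R n]_x (gauss c (x - z))%:E = (gauss1_mass c ^+ n)%:E)%E.
Proof.
move=> c0; elim: n z => [|n IHn] z.
  rewrite integral_lebN0 expr0 /gauss /sqnorm big_ord0 mulr0 oppr0 expR0 //.
rewrite ge0_integral_lebNS; last 2 first.
- by apply/measurable_EFinP; apply: continuous_measurable_mx; exact: continuous_gauss_shift.
- by move=> x; rewrite lee_fin ltW // gauss_gt0.
pose w := (uncons_row z).2; pose m := (uncons_row z).1.
have hE t y : gauss c (cons_row (t, y) - z) = gauss c (y - w) * expR (- (c * (t - m) ^+ 2)).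
  rewrite /gauss -expRD -opprD -mulrDr; congr (expR (- (c * _))).
  rewrite /sqnorm big_ord_recl subrowE cons_row0 addrC; congr (_ + _).
  by apply: eq_bigr => i _; rewrite !subrowE cons_rowS /w mxE.
transitivity (\int[@lebesgue_measure R]_t ((gauss1_mass c ^+ n)%:E * (expR (- (c * (t - m) ^+ 2)))%:E))%E.
  apply: eq_integral => t _.
  under eq_integral do rewrite hE EFinM.
  rewrite ge0_integralZr ?lee_fin ?expR_ge0 //; first by rewrite IHn.
    by apply/measurable_EFinP; apply: continuous_measurable_mx; exact: continuous_gauss_shift.
  by move=> x _; rewrite lee_fin ltW // gauss_gt0.
rewrite ge0_integralZl ?lee_fin ?exprn_ge0 ?sqrtr_ge0 //.
- by rewrite integral_gauss1 // -EFinM exprSr.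
- apply/measurable_EFinP; apply: (@measurableT_comp _ _ _ _ _ _ (@expR R)) => //.
  apply: measurableT_comp => //; apply: measurable_funM => //; apply: measurable_funX.
  exact: measurable_funB.
Qed.

Lemma ge0_integral_gauss n (c : R) : 0 < c ->
  (\int[lebN R n]_x (gauss c x)%:E = (gauss1_mass c ^+ n)%:E)%E.
Proof.
by move=> c0; rewrite -(ge0_integral_gauss_shift 0 c0); apply: eq_integral => x _; rewrite subr0.
Qed.

Lemma integrable_gauss n (c : R) : 0 < c -> (lebN R n).-integrable setT (EFin \o @gauss n c).
Proof.
move=> c0; apply/integrableP; split; first by apply/measurable_EFinP; exact: measurable_gauss.
under eq_integral do rewrite gee0_abs ?lee_fin ?(ltW (gauss_gt0 _ _)) //.
by rewrite ge0_integral_gauss // ltry.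
Qed.

Lemma integrable_gauss_shift n (c : R) (z : 'rV[R]_n) : 0 < c ->
  (lebN R n).-integrable setT (EFin \o (fun x => gauss c (x - z))).
Proof.
move=> c0; apply/integrableP; split.
  by apply/measurable_EFinP; apply: continuous_measurable_mx; exact: continuous_gauss_shift.
under eq_integral do rewrite gee0_abs ?lee_fin ?(ltW (gauss_gt0 _ _)) //.
by rewrite ge0_integral_gauss_shift // ltry.
Qed.

Lemma integral_gauss_shift n (c : R) (z : 'rV[R]_n) : 0 < c ->
  \int[lebN R n]_x gauss c (x - z) = gauss1_mass c ^+ n.
Proof. by move=> c0; rewrite /Rintegral ge0_integral_gauss_shift. Qed.

Lemma integral_gauss n (c : R) : 0 < c -> \int[lebN R n]_x gauss c x = gauss1_mass c ^+ n.
Proof. by move=> c0; rewrite /Rintegral ge0_integral_gauss. Qed.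

(** Half of the exponent pays for the factor |x|^2, by 1 + y <= exp y. *)
Lemma sqnorm_gauss_le n c (x : 'rV[R]_n) : 0 < c -> sqnorm x * gauss c x <= 2 / c * gauss (c / 2) x.
Proof.
move=> c0; have -> : gauss c x = gauss (c / 2) x * gauss (c / 2) x.
  by rewrite /gauss -expRD; congr expR; field.
rewrite mulrA; apply: ler_wpM2r; first exact: ltW (gauss_gt0 _ _).
rewrite /gauss expRN -[leLHS]/(_ / _) ler_pdivrMr ?expR_gt0 //.
apply: le_trans (ler_wpM2l _ (expR_ge1Dx _)); last by rewrite divr_ge0 // ltW.
rewrite mulrDr mulr1 (_ : 2 / c * (c / 2 * sqnorm x) = sqnorm x); last by field; rewrite gt_eqF.
by rewrite lerDr divr_ge0 // ltW.
Qed.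

Lemma integrable_poly_gauss n (f : 'rV[R]_n -> R) (c C : R) : 0 < c -> 0 <= C ->
  measurable_fun setT f -> (forall x, `|f x| <= C * (1 + sqnorm x)) ->
  (lebN R n).-integrable setT (EFin \o (fun x => f x * gauss c x)).
Proof.
move=> c0 C0 mf hf.
have i1 : (lebN R n).-integrable setT (EFin \o (fun x => C * (1 + 2 / c) * gauss (c / 2) x)).
  have := integrableZl measurableT (C * (1 + 2 / c)) (integrable_gauss n (divr_gt0 c0 (ltr0n R 2))).
  by [].
apply: le_integrable i1 => //.
  by apply/measurable_EFinP; apply: measurable_funM => //; exact: measurable_gauss.
move=> x _ /=; rewrite lee_fin normrM (ger0_norm (ltW (gauss_gt0 _ _))).
apply: le_trans (ler_wpM2r (ltW (gauss_gt0 _ _)) (hf x)) _.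
rewrite ger0_norm; last first.
  by apply: mulr_ge0; [apply: mulr_ge0 => //; apply: addr_ge0 => //; apply: divr_ge0 => //; exact: ltW|exact: ltW (gauss_gt0 _ _)].
rewrite -!mulrA ler_wpM2l // mulrDl mul1r mulrDl mul1r; apply: lerD; last first.
  exact: sqnorm_gauss_le.
rewrite ler_expR lerN2 ler_wpM2r ?sqnorm_ge0 // ler_pdivrMr //.
by rewrite mulr_natr mulr2n lerDl ltW.
Qed.

Definition dot n (x y : 'rV[R]_n) : R := \sum_k x ord0 k * y ord0 k.

Lemma Ck_dot n m (z : 'rV[R]_n) : Ck m (dot z).
Proof. by apply: Ck_sum => k _; apply: CkMl; exact: Ck_coord. Qed.

Lemma has_pd_dot n (z : 'rV[R]_n) k : has_pd k (dot z) (cst (z ord0 k)).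
Proof.
apply: (@has_pd_eq _ _ k _ _ _ _ (@has_pd_sum _ _ k _ (index_enum 'I_n) predT _ _
  (fun i _ => has_pdM (has_pd_cst k (z ord0 i)) (has_pd_coord k i)))) => x //=.
rewrite (bigD1 k) //= big1 => [|i ik]; last by rewrite /cst (negbTE ik) !mulr0 addr0.
by rewrite /cst eqxx mulr1 mulr0 !addr0.
Qed.

Lemma abs_dot_le n (z x : 'rV[R]_n) : `|dot z x| <= (\sum_k `|z ord0 k|) * jap x.
Proof.
rewrite mulr_suml; apply: le_trans (ler_norm_sum _ _ _) _; apply: ler_sum => k _.
by rewrite normrM ler_wpM2l // abs_coord_le_jap.
Qed.

Lemma jap_le n (x : 'rV[R]_n) : jap x <= 1 + sqnorm x.
Proof.
rewrite -jap_sqr expr2 ler_peMr // ?jap_ge1 //; exact: ltW (jap_gt0 x).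
Qed.

Lemma is_derive_scale (u v : R -> R) (b t : R) :
  (forall t : R, is_derive t 1 u (v t)) -> is_derive t 1 (fun s => u (s * b)) (b * v (t * b)).
Proof.
move=> uv; have hb : is_derive t 1 (fun s : R => s * b) b.
  have := is_deriveM (is_derive_id t (1 : R)) (is_derive_cst b t (1 : R)).
  by move=> h; apply: is_derive_eq; rewrite /GRing.scale /= mulr0 add0r mulr1.
by have := @is_derive1_comp R u (fun s => s * b) t _ _ (uv (t * b)) hb; rewrite mulrC.
Qed.

Lemma integrable_bounded_gauss n (u : R -> R) (g : 'rV[R]_n -> R) (z : 'rV[R]_n) (c : R) : 0 < c ->
  continuous u -> (forall s, `|u s| <= 1) -> continuous g ->
  (exists C, 0 <= C /\ forall x, `|g x| <= C * (1 + sqnorm x)) ->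
  (lebN R n).-integrable setT (EFin \o (fun x => g x * u (dot z x) * gauss c x)).
Proof.
move=> c0 cu u1 cg [C [C0 hC]]; apply: (integrable_poly_gauss c0 C0).
  by apply: continuous_measurable_mx; apply: cont_mul => //; apply: cont_comp => //; exact: (Ck_dot 0).
by move=> x; rewrite normrM (le_trans _ (hC x)) // ler_piMr.
Qed.

(* The pairs (u, v) = (cos, - sin) and (sin, cos) are treated at once. *)
Lemma gauss_fourier n (z : 'rV[R]_n) (u v : R -> R) (c : R) : 0 < c ->
  (forall t : R, is_derive t 1 u (v t)) -> (forall t : R, is_derive t 1 v (- u t)) ->
  (forall s, `|u s| <= 1) -> (forall s, `|v s| <= 1) ->
  \int[lebN R n]_x (u (dot z x) * gauss c x) =
  u 0 * gauss1_mass c ^+ n * expR (- (sqnorm z / (4 * c))).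
Proof.
move=> c0 uv vu u1 v1.
have cu : continuous u by move=> t; apply/differentiable_continuous/derivable1_diffP; case: (uv t).
have cv : continuous v by move=> t; apply/differentiable_continuous/derivable1_diffP; case: (vu t).
have dotS t x : dot (t *: z) x = t * dot z x.
  by rewrite /dot mulr_sumr; apply: eq_bigr => k _; rewrite !mxE mulrA.
pose Cz : R := \sum_k `|z ord0 k|.
have Cz0 : 0 <= Cz by apply: sumr_ge0.
have hdz x : `|dot z x| <= Cz * (1 + sqnorm x).
  by apply: le_trans (abs_dot_le _ _) _; rewrite ler_wpM2l // jap_le.
have cdz : continuous (dot z) by exact: (Ck_dot 0).
pose f t := \int[lebN R n]_x (u (t * dot z x) * gauss c x).
pose g t := \int[lebN R n]_x (dot z x * v (t * dot z x) * gauss c x).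
have iu t : (lebN R n).-integrable setT (EFin \o (fun x => u (t * dot z x) * gauss c x)).
  have hC : exists C, 0 <= C /\ forall x : 'rV[R]_n, `|(cst 1 : _ -> R) x| <= C * (1 + sqnorm x).
    by exists 1; split => // x; rewrite normr1 mul1r lerDl sqnorm_ge0.
  have := integrable_bounded_gauss (t *: z) c0 cu u1 (@Ck_cst R n 0 1) hC.
  by apply: eq_integrable => // x _ /=; rewrite mul1r dotS.
have df (t : R) : is_derive t 1 f (g t).
  apply: (@is_derive_under_integral R _ _ (lebN R n) (fun t x => u (t * dot z x) * gauss c x)
    (fun t x => dot z x * v (t * dot z x) * gauss c x) (fun x => `|dot z x| * gauss c x)).
  - move=> s y; have := is_deriveM (is_derive_scale (dot z y) s uv) (is_derive_cst (gauss c y) s (1 : R)).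
    by move=> h; apply: is_derive_eq; rewrite /GRing.scale /= mulr0 add0r mulrC.
  - exact: iu.
  - apply: (integrable_poly_gauss c0 Cz0) => [|x]; last by rewrite normr_id.
    by apply: measurableT_comp => //; exact: continuous_measurable_mx.
  - move=> s y _; rewrite !normrM (ger0_norm (ltW (gauss_gt0 _ _))).
    by rewrite ler_wpM2r ?(ltW (gauss_gt0 _ _)) // ler_piMr.
have iv t : (lebN R n).-integrable setT (EFin \o (fun x => dot z x * v (t * dot z x) * gauss c x)).
  have := integrable_bounded_gauss (t *: z) c0 cv v1 cdz (ex_intro _ Cz (conj Cz0 hdz)).
  by apply: eq_integrable => // x _ /=; rewrite dotS.
(* The divergence of the field z v(t z . x) exp(-c |x|^2) integrates to 0. As [g] is the derivative
   of [f], this is a linear differential equation in t, solved in [hfc]. *)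
have hg t : g t = - (t * sqnorm z / (2 * c)) * f t.
  pose F k (x : 'rV[R]_n) := z ord0 k * (v (t * dot z x) * gauss c x).
  pose G j k (x : 'rV[R]_n) := z ord0 k * (v (t * dot z x) * (gauss c x * - (2 * c * x ord0 j))
      + gauss c x * (- u (t * dot z x) * (t * z ord0 j))).
  have hF j k : has_pd j (F k) (G j k).
    have h1 : has_pd j (fun x => t * dot z x) (fun x => t * z ord0 j).
      apply: (@has_pd_eq _ _ j _ _ _ _ (has_pdM (has_pd_cst j t) (has_pd_dot z j))) => x //=.
      by rewrite /cst mulr0 addr0.
    have h2 := has_pd_comp vu h1.
    have h3 := has_pdM h2 (has_pd_gauss c j).
    apply: (@has_pd_eq _ _ j _ _ _ _ (has_pdM (has_pd_cst j (z ord0 k)) h3)) => x //=.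
    by rewrite /cst /G mulr0 addr0.
  have c0u : Ck 0 (fun x : 'rV[R]_n => u (t * dot z x)).
    by apply: cont_comp => //; exact: (CkMl t (Ck_dot 0 z)).
  have c0v : Ck 0 (fun x : 'rV[R]_n => v (t * dot z x)).
    by apply: cont_comp => //; exact: (CkMl t (Ck_dot 0 z)).
  have cG j k : Ck 0 (G j k).
    apply: CkMl; apply: CkD.
      apply: CkM => //; apply: CkM; first exact: Ck_gauss.
      by apply: CkN; apply: CkMl; exact: Ck_coord.
    apply: CkM; first exact: Ck_gauss.
    by apply: CkM; [exact: CkN|exact: Ck_cst].
  have cF k : Ck 1 (F k).
    apply: (@CkSI _ _ 0 (F k) (fun j => G j k)) => //.
    have : Ck 0 (F k) by apply: CkMl; apply: CkM => //; exact: Ck_gauss.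
    by [].
  have hdiv x : \sum_k pd k (F k) x =
      - (2 * c) * (dot z x * v (t * dot z x) * gauss c x) + - (t * sqnorm z) * (u (t * dot z x) * gauss c x).
    under eq_bigr => k _ do rewrite (has_pdE (hF k k)) /G.
    move: (v (t * dot z x)) (u (t * dot z x)) (gauss c x) => V U W.
    rewrite /dot /sqnorm !(mulr_sumr, mulr_suml, =^~ sumrN) -big_split /=.
    by apply: eq_bigr => k _; ring.
  have i1 := integrableZl measurableT (- (2 * c)) (iv t).
  have i2 := integrableZl measurableT (- (t * sqnorm z)) (iu t).
  have iD : (lebN R n).-integrable setT (EFin \o (fun x => \sum_k pd k (F k) x)).
    have := integrableD measurableT i1 i2.
    by apply: eq_integrable => // x _ /=; rewrite hdiv EFinD !EFinM.
  have iF k : (lebN R n).-integrable setT (EFin \o (fun x => F k x / jap x)).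
    have hk : (lebN R n).-integrable setT (EFin \o (fun x => z ord0 k * v (t * dot z x) / jap x * gauss c x)).
      apply: (@integrable_poly_gauss _ _ c `|z ord0 k|) => // [|x].
        apply: continuous_measurable_mx; apply: cont_mul; first exact: (CkMl _ c0v).
        by apply: cont_inv; [move=> x; rewrite gt_eqF // jap_gt0|exact: continuous_jap].
      rewrite !normrM -mulrA ler_wpM2l // normfV (ger0_norm (ltW (jap_gt0 x))).
      rewrite ler_pdivrMr ?jap_gt0 //; apply: le_trans (v1 _) _.
      by rewrite mulr_ege1 ?jap_ge1 // lerDl sqnorm_ge0.
    by apply: eq_integrable hk => // x _ /=; rewrite /F; congr EFin; ring.
  have := integral_div0 cF iF iD.
  under eq_Rintegral do rewrite hdiv.
  rewrite RintegralD // RintegralZl // RintegralZl // -/(f t) -/(g t) => h.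
  have c2 : 2 * c != 0 by rewrite mulf_neq0 ?gt_eqF.
  apply: (mulfI c2); apply/eqP; rewrite -subr_eq0 -oppr_eq0 -h; apply/eqP; field.
  by rewrite gt_eqF.
have hfc t : f t = f 0 * expR (- (t ^+ 2 * (sqnorm z / (4 * c)))).
  pose A := sqnorm z / (4 * c); pose h s := f s * expR (s ^+ 2 * A).
  have hh (s : R) : is_derive s 1 h 0.
    have d1 : is_derive s 1 (fun r : R => r ^+ 2 * A) (2 * s * A).
      have e1 := is_deriveM (is_derive_id s (1 : R)) (is_derive_id s (1 : R)).
      have e2 := is_deriveM e1 (is_derive_cst A s (1 : R)).
      have e3 : is_derive s 1 (fun r : R => r ^+ 2 * A) _ := e2.
      by apply: (is_derive_eq e3); rewrite /GRing.scale /=; ring.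
    have d2 := @is_derive1_comp R expR (fun r => r ^+ 2 * A) s _ _ (is_derive_expR _) d1.
    have d3 : is_derive s 1 h _ := is_deriveM (df s) d2.
    apply: (is_derive_eq d3); rewrite /GRing.scale /= hg /A; field.
    by rewrite gt_eqF.
  have := @is_derive_0_is_cst R h t 0 hh; rewrite /h expr0n mul0r expR0 mulr1 => <-.
  by rewrite -mulrA -expRD addrN expR0 mulr1.
transitivity (f 1); first by apply: eq_Rintegral => x _; rewrite mul1r.
rewrite hfc expr1n mul1r; congr (_ * _).
rewrite /f; under eq_Rintegral do rewrite mul0r.
rewrite RintegralZl //; last exact: integrable_gauss.
by rewrite integral_gauss.
Qed.
End Gaussian.

Section RFubini.
Context d1 d2 (T1 : measurableType d1) (T2 : measurableType d2) (R : realType).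
Variables (m1 : {sigma_finite_measure set T1 -> \bar R})
  (m2 : {sigma_finite_measure set T2 -> \bar R}).

(** A bound by a product A(x) B(y) yields integrability on the product space and on every section,
    so that real-valued inner integrals lose nothing. *)
Lemma Rfubini_dom (f : T1 * T2 -> R) (A : T1 -> R) (B : T2 -> R) :
  measurable_fun setT f -> m1.-integrable setT (EFin \o A) -> m2.-integrable setT (EFin \o B) ->
  (forall x, 0 <= A x) -> (forall y, 0 <= B y) ->
  (forall x y, `|f (x, y)| <= A x * B y) ->
  \int[m1]_x \int[m2]_y f (x, y) = \int[m2]_y \int[m1]_x f (x, y).
Proof.
move=> mf iA iB A0 B0 hf.
have mEf : measurable_fun setT (EFin \o f) by exact/measurable_EFinP.
have i1 x : m2.-integrable setT (EFin \o (fun y => f (x, y))).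
  have iAB := integrableZl measurableT (A x) iB.
  apply: le_integrable iAB => //.
    by apply/measurable_EFinP; exact: (measurableT_comp mf (measurable_pair1 x)).
  by move=> y _ /=; rewrite lee_fin (le_trans (hf x y)) // ler_norm.
have i2 y : m1.-integrable setT (EFin \o (fun x => f (x, y))).
  have iAB := integrableZr measurableT (B y) iA.
  apply: le_integrable iAB => //.
    by apply/measurable_EFinP; exact: (measurableT_comp mf (measurable_pair2 y)).
  by move=> x _ /=; rewrite lee_fin (le_trans (hf x y)) // ler_norm.
have ip : (m1 \x m2)%E.-integrable setT (EFin \o f).
  apply/(@integrable12ltyP _ _ _ _ _ m1 m2) => //.
  apply: (@le_lt_trans _ _ (\int[m1]_x ((A x)%:E * \int[m2]_y (B y)%:E))%E).
    apply: ge0_le_integral => //.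
    - by move=> x _; exact: integral_ge0.
    - apply: (@measurable_fun_fubini_tonelli_F _ _ _ _ _ m2 (fun p => `|(f p)%:E|)%E) => //.
      exact: measurableT_comp.
    - apply: emeasurable_funM => //; exact: measurable_int iA.
    - move=> x _; have -> : ((A x)%:E * \int[m2]_y (B y)%:E = \int[m2]_y ((A x)%:E * (B y)%:E))%E.
        rewrite ge0_integralZl ?lee_fin //; try exact: measurable_int iB.
        by move=> y _; rewrite lee_fin.
      apply: ge0_le_integral => //.
      + by apply: measurableT_comp => //; exact: measurable_int (i1 x).
      + by apply: emeasurable_funM => //; exact: measurable_int iB.
      + by move=> y _ /=; rewrite lee_fin hf.
  rewrite ge0_integralZr //; last 3 first.
  - exact: measurable_int iA.
  - by move=> x _; rewrite lee_fin.
  - by apply: integral_ge0 => y _; rewrite lee_fin.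
  by rewrite lte_mul_pinfty ?integral_ge0 ?(integrable_fin_num _ iA) //
     ?(integrable_lty _ iB) // => x _; rewrite lee_fin.
have := @Fubini _ _ _ _ _ m1 m2 (EFin \o f) ip.
move=> h; rewrite /Rintegral; congr fine.
transitivity (\int[m1]_x \int[m2]_y (EFin \o f) (x, y))%E.
  by apply: eq_integral => x _; rewrite fineK //; exact: (integrable_fin_num _ (i1 x)).
rewrite h; apply: eq_integral => y _; rewrite fineK //; exact: (integrable_fin_num _ (i2 y)).
Qed.

End RFubini.

(** * The Hartley transform *)

Section Hartley.
Context (R : realType) (n : nat).
Local Notation V := 'rV[R]_n.
Local Notation mu := (lebN R n).

(** The kernel of the Hartley transform. The derivative of [cas s] is s [cas (- s)], so the two
    signs alternate under differentiation and both have to be carried along. *)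
Definition cas (s t : R) : R := cos t + s * sin t.

Lemma is_derive_cas s (t : R) : s ^+ 2 = 1 -> is_derive t 1 (cas s) (s * cas (- s) t).
Proof.
move=> s2; have h1 := is_deriveM (is_derive_cst s t (1 : R)) (is_derive_sin t).
have h2 : is_derive t 1 (cas s) _ := is_deriveD (is_derive_cos t) h1.
apply: (is_derive_eq h2); rewrite /GRing.scale /= mulr0 addr0 /cas.
rewrite -[- sin t]mul1r -s2; ring.
Qed.

Lemma sqr1_norm (s : R) : s ^+ 2 = 1 -> `|s| = 1.
Proof. by move=> s2; apply/eqP; rewrite -sqrp_eq1 // real_normK ?num_real // s2. Qed.

Lemma cas_le2 s t : s ^+ 2 = 1 -> `|cas s t| <= 2.
Proof.
move=> s2; apply: le_trans (ler_normD _ _) _; rewrite normrM (sqr1_norm s2) mul1r.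
have c1 : `|cos t| <= 1 by rewrite ler_norml cos_geN1 cos_le1.
have s1 : `|sin t| <= 1 by rewrite ler_norml sin_geN1 sin_le1.
by apply: le_trans (lerD c1 s1) _; rewrite -mulr2n.
Qed.

Lemma sqrN1 (s : R) : s ^+ 2 = 1 -> (- s) ^+ 2 = 1. Proof. by rewrite sqrrN. Qed.

Lemma continuous_cas s : s ^+ 2 = 1 -> continuous (cas s).
Proof.
by move=> s2 t; apply/differentiable_continuous/derivable1_diffP; case: (is_derive_cas t s2).
Qed.

Lemma cas_lip s a b : s ^+ 2 = 1 -> `|cas s a - cas s b| <= 2 * `|a - b|.
Proof.
move=> s2; wlog ab : a b / b <= a.
  move=> h; case: (leP b a) => [|/ltW] ab; first exact: h.
  by rewrite distrC [`|a - b|]distrC; exact: h.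
have [c _ ->] := @MVT_segment R (cas s) (fun t => s * cas (- s) t) b a ab
  (fun t _ => is_derive_cas t s2) (continuous_subspaceT (continuous_cas s2)).
rewrite normrM ler_wpM2r // normrM (sqr1_norm s2) mul1r; exact/cas_le2/sqrN1.
Qed.

Definition Cc (m : nat) (f : V -> R) := Ck m f /\ compact_support (f : _ -> R^o).

Lemma Cc_mulr m f g : Cc m f -> Ck m g -> Cc m (fun x => f x * g x).
Proof.
move=> [cf [r hr]] cg; split; first exact: CkM.
by exists r => x rx; rewrite hr // mul0r.
Qed.

Lemma Cc_mull m f g : Cc m f -> Ck m g -> Cc m (fun x => g x * f x).
Proof.
move=> [cf [r hr]] cg; split; first exact: CkM.
by exists r => x rx; rewrite hr // mulr0.
Qed.

Lemma CcS_pd m f k : Cc m.+1 f -> Cc m (pd k f).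
Proof. by move=> [cf sf]; split; [exact: CkS_pd|exact: pd_compact_support]. Qed.

Lemma CcW m f : Cc m.+1 f -> Cc m f.
Proof. by move=> [cf sf]; split => //; exact: CkW. Qed.

Lemma CcD m f g : Cc m f -> Cc m g -> Cc m (fun x => f x + g x).
Proof.
move=> [cf [r hr]] [cg [s hs]]; split; first exact: CkD.
by exists (Num.max r s) => x; rewrite gt_max => /andP[rx sx]; rewrite hr // hs // addr0.
Qed.

Lemma Cc_sum m (I : Type) (r : seq I) (f : I -> V -> R) :
  (forall i, Cc m (f i)) -> Cc m (fun x => \sum_(i <- r) f i x).
Proof.
move=> h; elim: r => [|i r IHr].
  under eq_fun do rewrite big_nil; split; first exact: Ck_cst.
  by exists 0.
by under eq_fun do rewrite big_cons; exact: CcD.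
Qed.

Lemma Cc_int m f : Cc m f -> mu.-integrable setT (EFin \o f).
Proof. by move=> [cf sf]; exact: Cc_integrable (Ck_continuous cf) sf. Qed.

Lemma Cc0 m f : Cc m f -> Cc 0 f.
Proof. by move=> [cf sf]; split => //; exact: (Ck_continuous cf). Qed.

Definition hartley s (f : V -> R) (xi : V) : R := \int[mu]_x (f x * cas s (dot x xi)).

Lemma dotC (x y : V) : dot x y = dot y x.
Proof. by apply: eq_bigr => k _; rewrite mulrC. Qed.

Lemma Ck0_cas_dot s xi : s ^+ 2 = 1 -> Ck 0 (fun x : V => cas s (dot x xi)).
Proof.
move=> s2; apply: cont_comp; first exact: continuous_cas.
rewrite (_ : (fun x : V => dot x xi) = dot xi); first exact: (Ck_dot 0).
by apply/funext => x; rewrite dotC.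
Qed.

Lemma hartley_integrable s f xi : s ^+ 2 = 1 -> Cc 0 f ->
  mu.-integrable setT (EFin \o (fun x => f x * cas s (dot x xi))).
Proof. by move=> s2 cf; apply: (@Cc_int 0); apply: Cc_mulr => //; exact: Ck0_cas_dot. Qed.

Lemma Cc_coordM m f k : Cc m f -> Cc m (fun x => x ord0 k * f x).
Proof. by move=> cf; apply: Cc_mull => //; exact: Ck_coord. Qed.

Lemma has_pd_hartley s f k : s ^+ 2 = 1 -> Cc 0 f ->
  has_pd k (hartley s f) (fun xi => s * hartley (- s) (fun x => x ord0 k * f x) xi).
Proof.
move=> s2 cf xi; pose g t := \int[mu]_x (f x * cas s (t * x ord0 k + dot x xi)).
have dE (t : R) x : dot x (t *: evec R k + xi) = t * x ord0 k + dot x xi.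
  rewrite /dot (eq_bigr (fun i => t * (x ord0 i * (i == k)%:R) + x ord0 i * xi ord0 i)); last first.
    by move=> i _; rewrite lineE; ring.
  rewrite big_split /= -mulr_sumr (bigD1 k) //= eqxx mulr1 big1 ?addr0 // => i /negbTE ->.
  by rewrite mulr0.
have hl (h : R) : hartley s f (h *: evec R k + xi) = g (h *: (1 : R) + 0).
  by apply: eq_Rintegral => x _; rewrite dE addr0 /GRing.scale /= mulr1.
have [h1 h2] := derive_line hl.
have hx := Cc_coordM k cf.
have dg : is_derive (0 : R) 1 g (\int[mu]_x (f x * (x ord0 k * (s * cas (- s) (0 * x ord0 k + dot x xi))))).
  apply: (@is_derive_under_integral R _ _ mu (fun t x => f x * cas s (t * x ord0 k + dot x xi))
     (fun t x => f x * (x ord0 k * (s * cas (- s) (t * x ord0 k + dot x xi))))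
     (fun x => 2 * `|x ord0 k * f x|)).
  - move=> t x; have d1 : is_derive t 1 (fun r : R => r * x ord0 k + dot x xi) (x ord0 k).
      have e1 := is_deriveM (is_derive_id t (1 : R)) (is_derive_cst (x ord0 k) t (1 : R)).
      have e2 : is_derive t 1 (fun r : R => r * x ord0 k + dot x xi) _ :=
        is_deriveD e1 (is_derive_cst (dot x xi) t (1 : R)).
      by apply: (is_derive_eq e2); rewrite /GRing.scale /= mulr0 add0r addr0 mulr1.
    have d2 := @is_derive1_comp R (cas s) _ t _ _ (is_derive_cas _ s2) d1.
    have d3 : is_derive t 1 (fun r : R => f x * cas s (r * x ord0 k + dot x xi)) _ :=
      is_deriveM (is_derive_cst (f x) t (1 : R)) d2.
    by apply: (is_derive_eq d3); rewrite /GRing.scale /= mulr0 addr0; ring.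
  - move=> t; have := hartley_integrable (t *: evec R k + xi) s2 cf.
    by apply: eq_integrable => // x _ /=; rewrite dE.
  - have := integrableZl measurableT 2 (integrable_abse (Cc_int hx)).
    by [].
  - move=> t y _; rewrite !normrM (sqr1_norm s2) mul1r mulrA [`|f y| * _]mulrC [leRHS]mulrC.
    by rewrite ler_wpM2l ?mulr_ge0 //; exact/cas_le2/sqrN1.
have dv : \int[mu]_x (f x * (x ord0 k * (s * cas (- s) (0 * x ord0 k + dot x xi)))) =
   s * hartley (- s) (fun x => x ord0 k * f x) xi.
  rewrite /hartley -RintegralZl //; last exact: hartley_integrable (sqrN1 s2) hx.
  by apply: eq_Rintegral => x _; rewrite mul0r add0r; ring.
case: dg => dg1 dg2; apply: DeriveDef; first exact/h1.
by rewrite h2 dg2.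
Qed.

(** The transform is Lipschitz with constant [L], because the kernel is. *)
Lemma continuous_hartley s f : s ^+ 2 = 1 -> Cc 0 f -> continuous (hartley s f).
Proof.
move=> s2 cf; pose L := \int[mu]_x (2 * \sum_(k < n) `|x ord0 k * f x|).
have iL : mu.-integrable setT (EFin \o (fun x : V => 2 * \sum_(k < n) `|x ord0 k * f x|)).
  have : mu.-integrable setT (fun x => 2%:E * \sum_(k < n) (`|x ord0 k * f x|%:E))%E.
    apply: integrableZl => //; apply: integrable_sum => // k _.
    exact: (integrable_abse (Cc_int (Cc_coordM k cf))).
  by apply: eq_integrable => // x _ /=; rewrite sumEFin.
have L0 : 0 <= L.
  by apply: Rintegral_ge0 => x _; rewrite mulr_ge0 // sumr_ge0.
have lip xi eta : `|hartley s f xi - hartley s f eta| <= L * `|xi - eta|.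
  rewrite /hartley -RintegralB //; [|exact: hartley_integrable..].
  have ib := integrableB measurableT (hartley_integrable xi s2 cf) (hartley_integrable eta s2 cf).
  apply: le_trans (le_normr_Rintegral _ _) _ => //.
  rewrite /L -RintegralZr //; apply: le_Rintegral => //.
  - exact: (integrable_abse ib).
  - by have := integrableZr measurableT `|xi - eta| iL.
  move=> x _; rewrite -mulrBr normrM.
  apply: le_trans (ler_wpM2l (normr_ge0 _) (cas_lip _ _ s2)) _.
  rewrite mulrCA -mulrA ler_wpM2l // mulr_suml.
  have -> : dot x xi - dot x eta = \sum_k x ord0 k * (xi - eta) ord0 k.
    by rewrite /dot -sumrB; apply: eq_bigr => k _; rewrite subrowE mulrBr.
  apply: le_trans (ler_wpM2l (normr_ge0 _) (ler_norm_sum _ _ _)) _.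
  rewrite mulr_sumr; apply: ler_sum => k _; rewrite !normrM mulrA [`|f x| * _]mulrC.
  rewrite ler_wpM2l ?mulr_ge0 // [leRHS]/Num.Def.normr /= mx_normrE.
  by apply: le_trans (le_bigmax _ _ (ord0, k)).
move=> xi A /nbhs_ballP[e /= e0 hA]; have L1 : 0 < L + 1 by rewrite ltr_wpDl.
apply/nbhs_ballP; exists (e / (L + 1)) => /=; first by rewrite divr_gt0.
move=> eta; rewrite -ball_normE /= ltr_pdivlMr // => h; apply: hA; rewrite -ball_normE /=.
by apply: le_lt_trans (lip _ _) (le_lt_trans _ h); rewrite mulrC ler_wpM2l // lerDl.
Qed.

Lemma Ck_hartley m s f : s ^+ 2 = 1 -> Cc 0 f -> Ck m (hartley s f).
Proof.
elim: m s f => [|m IHm] s f s2 cf; first exact: continuous_hartley.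
apply: (@CkSI _ _ m _ (fun k xi => s * hartley (- s) (fun x => x ord0 k * f x) xi)).
- exact: continuous_hartley.
- by move=> k; exact: has_pd_hartley.
- by move=> k; apply: CkMl; apply: IHm; [exact: sqrN1|exact: Cc_coordM].
Qed.

Lemma hartley_pd s f k xi : s ^+ 2 = 1 -> Cc 1 f ->
  hartley s (pd k f) xi = - (s * xi ord0 k * hartley (- s) f xi).
Proof.
move=> s2 cf.
have d1 : has_pd k (fun x : V => cas s (dot x xi)) (fun x => s * cas (- s) (dot x xi) * xi ord0 k).
  have h := has_pd_comp (fun t => is_derive_cas t s2) (has_pd_dot xi k).
  by apply: (@has_pd_eq _ _ k _ _ _ _ h) => x; rewrite dotC.
have d2 := has_pdM (CkS_has_pd k cf.1) d1.
have c1 : Ck 1 (fun x : V => cas s (dot x xi)).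
  apply: (@CkSI _ _ 0 _ (fun k x => s * cas (- s) (dot x xi) * xi ord0 k)).
  - exact: Ck0_cas_dot.
  - move=> j; have h := has_pd_comp (fun t => is_derive_cas t s2) (has_pd_dot xi j).
    by apply: (@has_pd_eq _ _ j _ _ _ _ h) => x; rewrite dotC.
  - by move=> j; apply: CkM; [apply: CkMl; exact/Ck0_cas_dot/sqrN1|exact: Ck_cst].
have c2 := Cc_mulr cf c1.
have := integral_pd_compact k c2.1 c2.2.
rewrite (has_pdE d2) => h0.
have i1 := hartley_integrable xi (sqrN1 s2) (CcW cf).
have i2 := hartley_integrable xi s2 (CcS_pd k cf).
have : \int[mu]_x (s * xi ord0 k * (f x * cas (- s) (dot x xi)) + pd k f x * cas s (dot x xi)) = 0.
  rewrite /Rintegral -[RHS]/(fine 0%E) -h0; congr fine; apply: eq_integral => x _.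
  by congr EFin; ring.
rewrite RintegralD //; last by have := integrableZl measurableT (s * xi ord0 k) i1.
by rewrite RintegralZl // -/(hartley (- s) f xi) -/(hartley s (pd k f) xi) => /eqP; rewrite addrC addr_eq0 => /eqP.
Qed.

Lemma hartley_bound s f xi : s ^+ 2 = 1 -> Cc 0 f ->
  `|hartley s f xi| <= \int[mu]_x (2 * `|f x|).
Proof.
move=> s2 cf; have ih := hartley_integrable xi s2 cf.
apply: le_trans (le_normr_Rintegral _ ih) _ => //; apply: le_Rintegral => //.
- exact: (integrable_abse ih).
- by have := integrableZl measurableT 2 (integrable_abse (Cc_int cf)).
by move=> x _; rewrite normrM mulrC ler_wpM2r // cas_le2.
Qed.

Lemma casM s a b : s ^+ 2 = 1 -> cas s a * cas s b = cos (a - b) + s * sin (a + b).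
Proof.
move=> s2; rewrite cosB sinD /cas.
rewrite (_ : (cos a + s * sin a) * (cos b + s * sin b) = cos a * cos b + s ^+ 2 * (sin a * sin b)
  + s * (sin a * cos b + cos a * sin b)); last by ring.
by rewrite s2 mul1r.
Qed.

Lemma cos_norm_le1 (t : R) : `|cos t| <= 1.
Proof. by rewrite ler_norml cos_geN1 cos_le1. Qed.

Lemma sin_norm_le1 (t : R) : `|sin t| <= 1.
Proof. by rewrite ler_norml sin_geN1 sin_le1. Qed.

Lemma measurable_dot2 : measurable_fun setT (fun p : V * V => dot p.1 p.2).
Proof.
apply: measurable_sum => k; apply: measurable_funM.
  exact: (measurableT_comp (continuous_measurable_mx (@coord_continuous R 1 n ord0 k)) measurable_fst).
exact: (measurableT_comp (continuous_measurable_mx (@coord_continuous R 1 n ord0 k)) measurable_snd).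
Qed.

End Hartley.

(** * Plancherel's identity by Gaussian summation *)

Section Plancherel.
Context (R : realType) (n : nat).
Local Notation V := 'rV[R]_n.
Local Notation mu := (lebN R n).

(** The product of the kernels is the cosine of a difference plus s times the sine of a sum. The
    sine integrates to 0 against the even Gaussian, so the result is the same as for the complex
    exponential. *)
Lemma cas_gauss_kernel s c (x y : V) : s ^+ 2 = 1 -> 0 < c ->
  \int[mu]_xi (cas s (dot x xi) * cas s (dot y xi) * gauss c xi) =
  gauss1_mass c ^+ n * gauss (4 * c)^-1 (y - x).
Proof.
move=> s2 c0.
have sN (t : R) : `|- sin t| <= 1 by rewrite normrN; exact: sin_norm_le1.
have sP (t : R) : `|sin t| <= 1 by exact: sin_norm_le1.
have cP (t : R) : `|cos t| <= 1 by exact: cos_norm_le1.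
have dN (t : R) : is_derive t 1 (fun t => - sin t) (- cos t) by exact: is_deriveN.
have dC (t : R) : is_derive t 1 cos (- sin t) by exact: is_derive_cos.
have dS (t : R) : is_derive t 1 (@sin R) (cos t) by exact: is_derive_sin.
have icos := gauss_fourier (y - x) c0 dC dN cP sN.
have isin := gauss_fourier (x + y) c0 dS dC sP cP.
have hC : exists C, 0 <= C /\ forall x : V, `|(cst 1 : V -> R) x| <= C * (1 + sqnorm x).
  by exists 1; split => // z; rewrite normr1 mul1r lerDl sqnorm_ge0.
have i1 : mu.-integrable setT (EFin \o (fun xi => cos (dot (y - x) xi) * gauss c xi)).
  have := integrable_bounded_gauss (y - x) c0 (@continuous_cos R) cP (@Ck_cst R n 0 1) hC.
  by apply: eq_integrable => // z _ /=; rewrite mul1r.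
have i2 : mu.-integrable setT (EFin \o (fun xi => sin (dot (x + y) xi) * gauss c xi)).
  have := integrable_bounded_gauss (x + y) c0 (@continuous_sin R) sP (@Ck_cst R n 0 1) hC.
  by apply: eq_integrable => // z _ /=; rewrite mul1r.
transitivity (\int[mu]_xi (cos (dot (y - x) xi) * gauss c xi + s * (sin (dot (x + y) xi) * gauss c xi))).
  apply: eq_Rintegral => xi _; rewrite casM //.
  have -> : dot (y - x) xi = dot y xi - dot x xi.
    by rewrite /dot -sumrB; apply: eq_bigr => k _; rewrite subrowE mulrBl.
  have -> : dot (x + y) xi = dot x xi + dot y xi.
    by rewrite /dot -big_split /=; apply: eq_bigr => k _; rewrite !mxE mulrDl.
  by rewrite -[dot y xi - _]opprB cosN; ring.
rewrite RintegralD //; last by have := integrableZl measurableT s i2.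
rewrite RintegralZl // isin icos sin0 cos0 !mul0r mulr0 addr0 mul1r /gauss.
by congr (_ * expR (- _)); rewrite mulrC.
Qed.

Lemma measurable_fst_fun (f : V -> R) : continuous f -> measurable_fun setT (fun p : V * V => f p.1).
Proof. by move=> cf; exact: (measurableT_comp (continuous_measurable_mx cf) measurable_fst). Qed.

Lemma measurable_snd_fun (f : V -> R) : continuous f -> measurable_fun setT (fun p : V * V => f p.2).
Proof. by move=> cf; exact: (measurableT_comp (continuous_measurable_mx cf) measurable_snd). Qed.

Lemma measurable_cas_dot2 s : s ^+ 2 = 1 -> measurable_fun setT (fun p : V * V => cas s (dot p.1 p.2)).
Proof.
move=> s2; apply: (@measurableT_comp _ _ _ _ _ _ (cas s)); last exact: measurable_dot2.
exact: continuous_measurable_fun (continuous_cas s2).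
Qed.

Lemma hartley_gauss_inner s c f x : s ^+ 2 = 1 -> 0 < c -> Cc 0 f ->
  \int[mu]_xi (hartley s f xi * gauss c xi * cas s (dot x xi)) =
  gauss1_mass c ^+ n * \int[mu]_y (f y * gauss (4 * c)^-1 (y - x)).
Proof.
move=> s2 c0 cf.
pose F (p : V * V) := f p.2 * cas s (dot p.2 p.1) * (gauss c p.1 * cas s (dot x p.1)).
have h1 : \int[mu]_xi \int[mu]_y F (xi, y) = \int[mu]_y \int[mu]_xi F (xi, y).
  apply: (@Rfubini_dom _ _ _ _ R mu mu F (fun xi => 4 * gauss c xi) (fun y => `|f y|)).
  - apply: measurable_funM.
      apply: measurable_funM; first exact: measurable_snd_fun cf.1.
      rewrite (_ : (fun p : V * V => _) = (fun p => cas s (dot p.1 p.2))); first exact: measurable_cas_dot2.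
      by apply/funext => p; rewrite dotC.
    apply: measurable_funM; first by apply: measurable_fst_fun; exact: (Ck_gauss n 0 c).
    apply: (@measurable_fst_fun (fun xi => cas s (dot x xi))).
    by apply: cont_comp; [exact: continuous_cas|exact: (Ck_dot 0)].
  - by have := integrableZl measurableT 4 (integrable_gauss n c0).
  - exact: (integrable_abse (Cc_int cf)).
  - by move=> xi; rewrite mulr_ge0 // ltW // gauss_gt0.
  - by move=> y; exact: normr_ge0.
  - move=> xi y; rewrite /F /= !normrM (ger0_norm (ltW (gauss_gt0 c xi))).
    have := cas_le2 (dot y xi) s2; have := cas_le2 (dot x xi) s2.
    set A := `|cas s (dot x xi)|; set B := `|cas s (dot y xi)| => hA hB.
    rewrite (_ : `|f y| * B * (gauss c xi * A) = (B * A) * (gauss c xi * `|f y|)); last by ring.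
    rewrite -[leRHS]mulrA; apply: ler_wpM2r; first by rewrite mulr_ge0 // ltW // gauss_gt0.
    have -> : 4 = 2 * 2 :> R by ring.
    by apply: ler_pM => //; exact: normr_ge0.
transitivity (\int[mu]_xi \int[mu]_y F (xi, y)).
  apply: eq_Rintegral => xi _; rewrite /F /=.
  by rewrite (RintegralZr _ measurableT (hartley_integrable xi s2 cf)) mulrA.
have ci : Cc 0 (fun y => f y * gauss (4 * c)^-1 (y - x)) := Cc_mulr cf (@continuous_gauss_shift R n (4 * c)^-1 x).
rewrite h1 -(RintegralZl (gauss1_mass c ^+ n) measurableT (Cc_int ci)) {h1 ci}.
apply: eq_Rintegral => y _; rewrite mulrCA -(cas_gauss_kernel x y s2 c0).
have h : mu.-integrable setT (EFin \o (fun xi => (cas s (dot x xi) * cas s (dot y xi)) * gauss c xi)).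
  apply: (@integrable_poly_gauss R n _ c 4) => // [|xi].
    apply: continuous_measurable_mx; apply: cont_mul.
      by apply: cont_comp; [exact: continuous_cas|exact: (Ck_dot 0)].
    by apply: cont_comp; [exact: continuous_cas|exact: (Ck_dot 0)].
  rewrite normrM; apply: le_trans (ler_pM (normr_ge0 _) (normr_ge0 _) (cas_le2 _ s2) (cas_le2 _ s2)) _.
  by rewrite -natrM ler_peMr // lerDl sqnorm_ge0.
rewrite -(RintegralZl (f y) measurableT h).
by apply: eq_Rintegral => xi _; rewrite /F /=; ring.
Qed.

Lemma measurable_gauss_conv b (f : V -> R) : continuous f ->
  measurable_fun setT (fun x : V => \int[mu]_y (f y * gauss b (y - x))).
Proof.
move=> cf; apply: (@measurableT_comp _ _ _ _ _ _ fine) => //.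
apply: (@measurable_integral_param R _ _ V V mu (fun p => (f p.2 * gauss b (p.2 - p.1))%:E)).
apply/measurable_EFinP; apply: measurable_funM; first exact: measurable_snd_fun.
rewrite (_ : (fun _ => _) = (fun p : V * V => expR (- (b * \sum_k (p.2 ord0 k - p.1 ord0 k) ^+ 2)))); last first.
  by apply/funext => p; rewrite /gauss /sqnorm; under eq_bigr do rewrite subrowE.
apply: (@measurableT_comp _ _ _ _ _ _ (@expR R)) => //.
apply: (@measurableT_comp _ _ _ _ _ _ (@GRing.opp R)) => //.
apply: measurable_funM => //; apply: measurable_sum => k; apply: measurable_funX.
apply: measurable_funB.
  by apply: (@measurable_snd_fun (fun v => v ord0 k)); exact: coord_continuous.
by apply: (@measurable_fst_fun (fun v => v ord0 k)); exact: coord_continuous.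
Qed.

Lemma gauss_conv_bound b (f : V -> R) C x : 0 < b -> continuous f -> (forall y, `|f y| <= C) ->
  mu.-integrable setT (EFin \o (fun y => f y * gauss b (y - x))) /\
  `|\int[mu]_y (f y * gauss b (y - x))| <= C * gauss1_mass b ^+ n.
Proof.
move=> b0 cf hC.
have iC : mu.-integrable setT (EFin \o (fun y => C * gauss b (y - x))).
  by have := integrableZl measurableT C (integrable_gauss_shift x b0).
have hb y : `|f y * gauss b (y - x)| <= C * gauss b (y - x).
  by rewrite normrM (ger0_norm (ltW (gauss_gt0 _ _))) ler_wpM2r // ltW // gauss_gt0.
have ic : mu.-integrable setT (EFin \o (fun y => f y * gauss b (y - x))).
  apply: le_integrable iC => //.
    by apply/measurable_EFinP; apply: continuous_measurable_mx; apply: cont_mul => //; exact: continuous_gauss_shift.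
  by move=> y _ /=; rewrite lee_fin (le_trans (hb y)) // ler_norm.
split => //; apply: le_trans (le_normr_Rintegral _ ic) _ => //.
rewrite -(integral_gauss_shift x b0) -RintegralZl //; last exact: integrable_gauss_shift.
by apply: le_Rintegral => //; exact: (integrable_abse ic).
Qed.

(** Plancherel's identity with a summability factor: the Gaussian makes the integral over x and xi
    absolutely convergent, so that Fubini applies. *)
Lemma hartley_gauss s c f : s ^+ 2 = 1 -> 0 < c -> Cc 0 f ->
  \int[mu]_xi (hartley s f xi ^+ 2 * gauss c xi) =
  gauss1_mass c ^+ n * \int[mu]_x (f x * \int[mu]_y (f y * gauss (4 * c)^-1 (y - x))).
Proof.
move=> s2 c0 cf; pose M := \int[mu]_x (2 * `|f x|).
have hM xi : `|hartley s f xi| <= M := hartley_bound xi s2 cf.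
have M0 : 0 <= M := le_trans (normr_ge0 _) (hM 0).
have ch := continuous_hartley s2 cf.
pose F (p : V * V) := hartley s f p.1 * gauss c p.1 * (f p.2 * cas s (dot p.2 p.1)).
have h1 : \int[mu]_xi \int[mu]_x F (xi, x) = \int[mu]_x \int[mu]_xi F (xi, x).
  apply: (@Rfubini_dom _ _ _ _ R mu mu F (fun xi => M * gauss c xi) (fun y => 2 * `|f y|)).
  - apply: measurable_funM.
      apply: (@measurable_fst_fun (fun xi => hartley s f xi * gauss c xi)).
      by apply: cont_mul => //; exact: (Ck_gauss n 0 c).
    apply: measurable_funM; first exact: measurable_snd_fun cf.1.
    rewrite (_ : (fun p : V * V => _) = (fun p => cas s (dot p.1 p.2))); first exact: measurable_cas_dot2.
    by apply/funext => p; rewrite dotC.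
  - by have := integrableZl measurableT M (integrable_gauss n c0).
  - by have := integrableZl measurableT 2 (integrable_abse (Cc_int cf)).
  - by move=> xi; rewrite mulr_ge0 // ltW // gauss_gt0.
  - by move=> y; rewrite mulr_ge0.
  - move=> xi y; rewrite /F /= !normrM (ger0_norm (ltW (gauss_gt0 c xi))).
    apply: ler_pM; rewrite ?mulr_ge0 ?(ltW (gauss_gt0 _ _)) //.
      by rewrite ler_wpM2r // ltW // gauss_gt0.
    by rewrite mulrC ler_wpM2r // cas_le2.
transitivity (\int[mu]_xi \int[mu]_x F (xi, x)).
  apply: eq_Rintegral => xi _; rewrite /F /= (RintegralZl _ measurableT (hartley_integrable xi s2 cf)).
  by rewrite -/(hartley s f xi); ring.
have iQ : mu.-integrable setT (EFin \o (fun x => f x * \int[mu]_y (f y * gauss (4 * c)^-1 (y - x)))).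
  have [C [C0 hC]] := compact_support_bounded cf.1 cf.2.
  have b0 : 0 < (4 * c)^-1 by rewrite invr_gt0 mulr_gt0.
  have := integrableZl measurableT (C * gauss1_mass (4 * c)^-1 ^+ n) (integrable_abse (Cc_int cf)).
  apply: le_integrable => //.
    apply/measurable_EFinP; apply: measurable_funM; first exact: continuous_measurable_mx cf.1.
    exact: measurable_gauss_conv cf.1.
  move=> x _ /=; rewrite lee_fin normrM mulrC [leRHS]normrM normr_id ler_wpM2r //.
  apply: le_trans (gauss_conv_bound x b0 cf.1 hC).2 _; exact: ler_norm.
rewrite h1 -(RintegralZl (gauss1_mass c ^+ n) measurableT iQ) {h1 iQ}.
apply: eq_Rintegral => x _; rewrite mulrCA -(hartley_gauss_inner x s2 c0 cf).
have iK : mu.-integrable setT (EFin \o (fun xi => hartley s f xi * gauss c xi * cas s (dot x xi))).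
  have := integrableZl measurableT (M * 2) (integrable_gauss n c0).
  apply: le_integrable => //.
    apply/measurable_EFinP; apply: continuous_measurable_mx; apply: cont_mul.
      by apply: cont_mul => //; exact: (Ck_gauss n 0 c).
    by apply: cont_comp; [exact: continuous_cas|exact: (Ck_dot 0)].
  move=> xi _ /=; rewrite lee_fin !normrM (ger0_norm (ltW (gauss_gt0 c xi))) mulrAC.
  rewrite ler_wpM2r ?(ltW (gauss_gt0 _ _)) //.
  apply: ler_pM => //; first by rewrite (le_trans (hM xi)) // ler_norm.
  by apply: le_trans (cas_le2 _ s2) _; rewrite ger0_norm.
rewrite -(RintegralZl (f x) measurableT iK).
by apply: eq_Rintegral => xi _; rewrite /F /=; ring.
Qed.

End Plancherel.

Section Plancherel2.
Context (R : realType) (n : nat).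
Local Notation V := 'rV[R]_n.
Local Notation mu := (lebN R n).

Lemma gauss1_mass_gt0 (b : R) : 0 < b -> 0 < gauss1_mass b.
Proof. by move=> b0; rewrite sqrtr_gt0 divr_gt0 // pi_gt0. Qed.

Lemma gauss1_mass_half (b : R) : 0 < b -> gauss1_mass (b / 2) = Num.sqrt 2 * gauss1_mass b.
Proof.
move=> b0; rewrite /gauss1_mass -sqrtrM //; congr Num.sqrt; field.
by rewrite gt_eqF.
Qed.

(** The origin of the factor (2 pi)^n in Plancherel's identity. *)
Lemma gauss1_mass_dual (c : R) : 0 < c -> gauss1_mass c * gauss1_mass (4 * c)^-1 = 2 * pi.
Proof.
move=> c0; rewrite /gauss1_mass -sqrtrM; last by rewrite divr_ge0 ?pi_ge0 // ltW.
rewrite (_ : pi / c * _ = (2 * pi) ^+ 2); first by rewrite sqrtr_sqr ger0_norm // mulr_ge0 // pi_ge0.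
by field; rewrite gt_eqF.
Qed.

Lemma cvg_gauss_conv (f : V -> R) x : Cc 0 f ->
  (\int[mu]_y (f y * gauss m.+1%:R (y - x))) / gauss1_mass m.+1%:R ^+ n @[m --> \oo] --> f x.
Proof.
move=> cf; have [C [C0 hC]] := compact_support_bounded cf.1 cf.2.
apply/cvgrPdist_le => e e0.
have e2 : 0 < e / 2 by rewrite divr_gt0.
have [d d0 hd] : exists2 d, 0 < d & forall y, `|y - x| < d -> `|f y - f x| <= e / 2.
  have /cvgrPdist_le/(_ _ e2)/nbhs_ballP[d /= d0 hd] := cf.1 x.
  exists d => // y yx; rewrite distrC; apply: hd.
  by rewrite -ball_normE /= distrC.
(* In [hb] the quadratic term covers the points far from x. Against the Gaussian of parameter b it
   costs 2/b times a Gaussian of parameter b/2, whose mass is larger by the factor sqrt(2)^n. *)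
pose K := 2 * C / d ^+ 2 * (2 * Num.sqrt 2 ^+ n).
have hb y : `|f y - f x| <= e / 2 + 2 * C / d ^+ 2 * sqnorm (y - x).
  have d2 : 0 < d ^+ 2 by rewrite exprn_gt0.
  case: (ltP `|y - x| d) => [yx|dy].
    by rewrite (le_trans (hd _ yx)) // lerDl mulr_ge0 ?sqnorm_ge0 // divr_ge0 ?mulr_ge0 // ltW.
  have h1 : d ^+ 2 <= sqnorm (y - x).
    apply: le_trans (norm_sqr_le_sqnorm _).
    by rewrite lerXn2r // nnegrE ?(ltW d0).
  apply: (@le_trans _ _ (2 * C)).
    by rewrite mulr_natl mulr2n (le_trans (ler_normB _ _)) // lerD.
  rewrite -[leLHS]add0r lerD ?(ltW e2) // mulrAC ler_pdivlMr // ler_wpM2l //.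
  by rewrite mulr_ge0.
have key m : `|f x - (\int[mu]_y (f y * gauss m.+1%:R (y - x))) / gauss1_mass m.+1%:R ^+ n|
    <= e / 2 + K / m.+1%:R.
  set b := m.+1%:R; have b0 : 0 < b by rewrite ltr0n.
  have bh : 0 < b / 2 by rewrite divr_gt0.
  have m0 : 0 < gauss1_mass b ^+ n by rewrite exprn_gt0 // gauss1_mass_gt0.
  rewrite -(ler_pM2r m0) -[X in `|_| * X](gtr0_norm m0) -normrM mulrBl divfK ?gt_eqF //.
  have ig := integrable_gauss_shift x b0.
  have ig2 := integrable_gauss_shift x bh.
  have [ifg _] := gauss_conv_bound x b0 cf.1 hC.
  have ifx : mu.-integrable setT (EFin \o (fun y => f x * gauss b (y - x))).
    by have := integrableZl measurableT (f x) ig.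
  rewrite -(integral_gauss_shift x b0) -(RintegralZl (f x) measurableT ig) -RintegralB // integral_gauss_shift //.
  have ih1 : mu.-integrable setT (EFin \o (fun y => e / 2 * gauss b (y - x))).
    by have := integrableZl measurableT (e / 2) ig.
  have ih2 : mu.-integrable setT (EFin \o (fun y => 2 * C / d ^+ 2 * (2 / b) * gauss (b / 2) (y - x))).
    by have := integrableZl measurableT (2 * C / d ^+ 2 * (2 / b)) ig2.
  have ihd : mu.-integrable setT (EFin \o (fun y => f x * gauss b (y - x) - f y * gauss b (y - x))).
    by have := integrableB measurableT ifx ifg.
  have -> : (e / 2 + K / b) * gauss1_mass b ^+ n = \int[mu]_y (e / 2 * gauss b (y - x) +
      2 * C / d ^+ 2 * (2 / b) * gauss (b / 2) (y - x)).
    rewrite (RintegralD measurableT ih1 ih2) (RintegralZl _ measurableT ig) (RintegralZl _ measurableT ig2).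
    rewrite !integral_gauss_shift // gauss1_mass_half // exprMn /K.
    by ring.
  apply: le_trans (le_normr_Rintegral measurableT ihd) _.
  apply: le_Rintegral => //; first exact: (integrable_abse ihd).
    exact: (integrableD measurableT ih1 ih2).
  move=> y _; rewrite -mulrBl normrM (ger0_norm (ltW (gauss_gt0 _ _))) distrC.
  apply: le_trans (ler_wpM2r (ltW (gauss_gt0 _ _)) (hb y)) _.
  rewrite mulrDl lerD2l -!mulrA ler_wpM2l // ler_wpM2l // ler_wpM2l ?invr_ge0 ?exprn_ge0 ?(ltW d0) //.
  by rewrite mulrA; exact: sqnorm_gauss_le.
have K0 : 0 <= K by rewrite /K !mulr_ge0 ?invr_ge0 ?exprn_ge0 ?(ltW d0) // sqrtr_ge0.
have hK : (K * m.+1%:R^-1) @[m --> \oo] --> K * 0 by apply: cvgM; [exact: cvg_cst|exact: cvg_harmonic].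
move/cvgrPdist_le: hK => /(_ _ e2); rewrite mulr0; apply: filterS => m.
rewrite sub0r normrN ger0_norm; last by rewrite mulr_ge0 // invr_ge0.
move=> hm; apply: le_trans (key m) _.
by rewrite [leRHS](splitr e) lerD2l.
Qed.

(** The damped integrals [I m] have two limits: in x by dominated convergence, the Gaussians being
    an approximate identity, and in xi by monotone convergence. The second also gives integrability
    of the square. *)
Lemma plancherel s f : s ^+ 2 = 1 -> Cc 0 f ->
  mu.-integrable setT (EFin \o (fun xi => hartley s f xi ^+ 2)) /\
  \int[mu]_xi hartley s f xi ^+ 2 = (2 * pi) ^+ n * \int[mu]_x f x ^+ 2.
Proof.
move=> s2 cf; have ch := continuous_hartley s2 cf.
(* Chosen so that the dual Gaussian has parameter m + 1. *)
pose c m : R := (4 * m.+1%:R)^-1.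
have c0 m : 0 < c m by rewrite invr_gt0 mulr_gt0.
have cE m : (4 * c m)^-1 = m.+1%:R.
  by rewrite /c invfM invrK; field.
pose I m := \int[mu]_xi (hartley s f xi ^+ 2 * gauss (c m) xi).
have mH : measurable_fun setT (fun xi => hartley s f xi ^+ 2).
  by apply: measurable_funX; exact: continuous_measurable_mx.
have I1 : I m @[m --> \oo] --> (2 * pi) ^+ n * \int[mu]_x f x ^+ 2.
  rewrite (_ : I = (fun m => (2 * pi) ^+ n * \int[mu]_x
      (f x * (\int[mu]_y (f y * gauss m.+1%:R (y - x)) / gauss1_mass m.+1%:R ^+ n)))); last first.
    apply/funext => m; rewrite /I (hartley_gauss s2 (c0 m) cf) cE -(gauss1_mass_dual (c0 m)) cE.
    have b0 : 0 < m.+1%:R :> R by [].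
    have m0 : gauss1_mass m.+1%:R ^+ n != 0 :> R by rewrite gt_eqF // exprn_gt0 // gauss1_mass_gt0.
    rewrite exprMn -mulrA; congr (_ * _).
    have [C [C0 hC]] := compact_support_bounded cf.1 cf.2.
    have iQ : mu.-integrable setT (EFin \o (fun x => f x *
        (\int[mu]_y (f y * gauss m.+1%:R (y - x)) / gauss1_mass m.+1%:R ^+ n))).
      have := integrableZl measurableT C (integrable_abse (Cc_int cf)).
      apply: le_integrable => //.
        apply/measurable_EFinP; apply: measurable_funM; first exact: continuous_measurable_mx cf.1.
        by apply: measurable_funM => //; exact: measurable_gauss_conv cf.1.
      move=> x _ /=; rewrite lee_fin normrM mulrC [leRHS]normrM normr_id ler_wpM2r //.
      rewrite normrM normfV [`|_ ^+ n|]gtr0_norm ?exprn_gt0 ?gauss1_mass_gt0 //.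
      rewrite ler_pdivrMr ?exprn_gt0 ?gauss1_mass_gt0 //.
      apply: le_trans (gauss_conv_bound x b0 cf.1 hC).2 _.
      by rewrite ler_wpM2r ?exprn_ge0 ?(ltW (gauss1_mass_gt0 b0)) // ler_norm.
    rewrite -(RintegralZl _ measurableT iQ) {iQ}.
    by apply: eq_Rintegral => x _; field.
  apply: cvgM; first exact: cvg_cst.
  have [C [C0 hC]] := compact_support_bounded cf.1 cf.2.
  have iC : mu.-integrable setT (EFin \o (fun x => C * `|f x|)).
    by have := integrableZl measurableT C (integrable_abse (Cc_int cf)).
  have mf := continuous_measurable_mx cf.1.
  have hh := @Rdominated_cvg _ _ R mu (fun m x => f x * (\int[mu]_y (f y * gauss m.+1%:R (y - x)) / gauss1_mass m.+1%:R ^+ n))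
    (fun x => f x ^+ 2) (fun x => C * `|f x|).
  apply: (hh _ _ _ iC _).2 => {hh}.
  - move=> m; apply: measurable_funM => //.
    by apply: measurable_funM => //; exact: measurable_gauss_conv cf.1.
  - exact: measurable_funX.
  - by move=> x; rewrite expr2; apply: cvgM; [exact: cvg_cst|exact: cvg_gauss_conv].
  - move=> m x; have b0 : 0 < m.+1%:R :> R by [].
    rewrite normrM mulrC ler_wpM2r //.
    rewrite normrM normfV [`|_ ^+ n|]gtr0_norm ?exprn_gt0 ?gauss1_mass_gt0 //.
    rewrite ler_pdivrMr ?exprn_gt0 ?gauss1_mass_gt0 //.
    exact: (gauss_conv_bound x b0 cf.1 hC).2.
have Ii m : mu.-integrable setT (EFin \o (fun xi => hartley s f xi ^+ 2 * gauss (c m) xi)).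
  apply: (@integrable_poly_gauss R n _ (c m) ((\int[mu]_x (2 * `|f x|)) ^+ 2)) => //; first exact: sqr_ge0.
  move=> xi; rewrite normrX (le_trans (y := (\int[mu]_x (2 * `|f x|)) ^+ 2)) //.
    have h := hartley_bound xi s2 cf.
    by rewrite lerXn2r // nnegrE // (le_trans _ h).
  by rewrite ler_peMr ?sqr_ge0 // lerDl sqnorm_ge0.
have I2 : (\int[mu]_xi (hartley s f xi ^+ 2 * gauss (c m) xi)%:E)%E @[m --> \oo] -->
    (\int[mu]_xi (hartley s f xi ^+ 2)%:E)%E.
  pose g m xi := (hartley s f xi ^+ 2 * gauss (c m) xi)%:E.
  have gl xi : g m xi @[m --> \oo] --> (hartley s f xi ^+ 2)%:E.
    apply: cvg_EFin; first exact: nearW.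
    rewrite -[X in _ --> X]mulr1 /=; apply: cvgM; first exact: cvg_cst.
    rewrite -expR0 -oppr0 /gauss.
    have h0 : c m * sqnorm xi @[m --> \oo] --> (0 : R).
      rewrite -[X in _ --> X](mul0r (sqnorm xi)); apply: cvgM; last exact: cvg_cst.
      rewrite -[X in _ --> X](mulr0 (4^-1)).
      rewrite (_ : c = fun m => 4^-1 * m.+1%:R^-1); last by apply/funext => m; rewrite /c invfM.
      by apply: cvgM; [exact: cvg_cst|exact: cvg_harmonic].
    by apply: continuous_cvg; [exact: continuous_expR|exact: cvgN].
  rewrite (_ : (\int[mu]_xi (hartley s f xi ^+ 2)%:E)%E = (\int[mu]_xi limn (fun m => g m xi))%E); last first.
    by apply: eq_integral => xi _; apply/esym/cvg_lim => //; exact: gl.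
  apply: (@cvg_monotone_convergence _ _ _ mu _ measurableT g).
  - by move=> m; exact: measurable_int (Ii m).
  - by move=> m xi _; rewrite lee_fin mulr_ge0 ?sqr_ge0 // ltW // gauss_gt0.
  - move=> xi _ i j ij; rewrite lee_fin ler_wpM2l ?sqr_ge0 // ler_expR lerN2.
    by rewrite ler_wpM2r ?sqnorm_ge0 // lef_pV2 ?posrE ?mulr_gt0 // ler_wpM2l // ler_nat ltnS.
have I3 : (\int[mu]_xi (hartley s f xi ^+ 2)%:E)%E = ((2 * pi) ^+ n * \int[mu]_x f x ^+ 2)%:E.
  apply: (cvg_unique (@ereal_hausdorff R) I2).
  rewrite (_ : (fun m => _) = EFin \o I); first by apply: cvg_EFin => //; exact: nearW.
  by apply/funext => m; rewrite /= /I /Rintegral fineK //; exact: integrable_fin_num (Ii m).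
split; last by rewrite {1}/Rintegral I3.
apply/integrableP; split; first exact/measurable_EFinP.
rewrite (eq_integral (fun xi => (hartley s f xi ^+ 2)%:E)); first by rewrite I3 ltry.
by move=> xi _ /=; rewrite ger0_norm // sqr_ge0.
Qed.

End Plancherel2.

(** * The pointwise inequality *)

Section MatrixIneq.
Context (R : realType) (n : nat).
Implicit Types (A B C : 'I_n -> 'I_n -> R) (x y z : 'I_n -> R).

Definition vdot x y := \sum_i x i * y i.
Definition mdot A B := \sum_i \sum_j A i j * B i j.
Definition mulv B x i := \sum_j B i j * x j.
Definition trm B i j := B j i.
Definition mtr B := \sum_i B i i.

Lemma vdotC x y : vdot x y = vdot y x.
Proof. by apply: eq_bigr => i _; rewrite mulrC. Qed.

Lemma vdot_lin a b x y z : vdot (fun i => a * x i + b * y i) z = a * vdot x z + b * vdot y z.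
Proof. by rewrite !mulr_sumr -big_split; apply: eq_bigr => i _ /=; ring. Qed.

Lemma vdot_ge0 x : 0 <= vdot x x.
Proof. by apply: sumr_ge0 => i _; rewrite -expr2 sqr_ge0. Qed.

Lemma vdot_cauchy x y : vdot x y ^+ 2 <= vdot x x * vdot y y.
Proof.
have h (a b : R) : 0 <= a ^+ 2 * vdot x x + 2 * (a * b) * vdot x y + b ^+ 2 * vdot y y.
  have := vdot_ge0 (fun i => a * x i + b * y i).
  rewrite vdot_lin ![vdot _ (fun i => _ + _)]vdotC !vdot_lin [vdot y x]vdotC.
  by rewrite (_ : a * _ + _ = a ^+ 2 * vdot x x + 2 * (a * b) * vdot x y + b ^+ 2 * vdot y y); last ring.
have := vdot_ge0 x; rewrite le_eqVlt => /predU1P[x0|x0].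
  (* For x . x = 0 these coefficients turn [h] into 0 <= - (x . y)^4 (y . y + 2), which forces x . y
     = 0. *)
  have := h (vdot x y * (vdot y y + 1)) (- vdot x y ^+ 2 ) ; rewrite -x0 mul0r.
  have := vdot_ge0 y; set Y := vdot y y; set X := vdot x y => Y0 h1.
  have X4 : 0 <= X ^+ 4 * (Y + 2) by rewrite mulr_ge0 ?addr_ge0 // exprn_even_ge0.
  by nra.
have := h (- vdot x y) (vdot x x); set Y := vdot y y; set X := vdot x y; set Z := vdot x x in x0 *.
rewrite (_ : _ + _ = Z * (Z * Y - X ^+ 2)); last by ring.
by rewrite pmulr_rge0 // subr_ge0.
Qed.

Lemma mdotE A B : mdot A B = \sum_i vdot (A i) (B i).
Proof. by []. Qed.

Lemma mdotC A B : mdot A B = mdot B A.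
Proof. by rewrite !mdotE; apply: eq_bigr => i _; exact: vdotC. Qed.

Lemma mdot_lin a b A B C : mdot (fun i j => a * A i j + b * B i j) C = a * mdot A C + b * mdot B C.
Proof.
by rewrite !mdotE !mulr_sumr -big_split; apply: eq_bigr => i _ /=; exact: vdot_lin.
Qed.

Lemma mdot_sqr a b A B : mdot (fun i j => a * A i j + b * B i j) (fun i j => a * A i j + b * B i j) =
  a ^+ 2 * mdot A A + 2 * a * b * mdot A B + b ^+ 2 * mdot B B.
Proof.
rewrite mdot_lin [mdot A _]mdotC [mdot B _]mdotC !mdot_lin [mdot B A]mdotC; ring.
Qed.

Lemma mdot_ge0 A : 0 <= mdot A A.
Proof. by rewrite mdotE; apply: sumr_ge0 => i _; exact: vdot_ge0. Qed.

Lemma mdot_rank1 x y B : mdot (fun i j => x i * y j) B = vdot x (mulv B y).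
Proof.
rewrite mdotE; apply: eq_bigr => i _; rewrite /mulv mulr_sumr; apply: eq_bigr => j _.
by ring.
Qed.

Lemma mdot_trm A B : mdot (trm A) B = mdot A (trm B).
Proof. by rewrite /mdot exchange_big. Qed.

Lemma mdot_trm2 A B : mdot (trm A) (trm B) = mdot A B.
Proof. by rewrite /mdot exchange_big. Qed.

Lemma vdot_mulv x B y : vdot x (mulv B y) = vdot (mulv (trm B) x) y.
Proof.
transitivity (\sum_i \sum_j x i * B i j * y j).
  by apply: eq_bigr => i _; rewrite /mulv mulr_sumr; apply: eq_bigr => j _; ring.
rewrite exchange_big; apply: eq_bigr => j _; rewrite /mulv mulr_suml.
by apply: eq_bigr => i _; rewrite /trm; ring.
Qed.

Lemma mdot_id B : mdot (fun i j => (i == j)%:R) B = mtr B.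
Proof.
apply: eq_bigr => i _; rewrite (bigD1 i) //= eqxx mul1r big1 ?addr0 // => j.
by rewrite eq_sym => /negbTE ->; rewrite mul0r.
Qed.

Lemma mtr_id : mtr (fun i j => (i == j)%:R) = n%:R.
Proof. by rewrite /mtr (eq_bigr (fun=> 1)) => [|i _]; rewrite ?sumr_const ?card_ord // eqxx. Qed.

Lemma mdot_cauchy_trm A : mdot A (trm A) <= mdot A A.
Proof.
have := mdot_ge0 (fun i j => 1 * A i j + (-1) * trm A i j).
rewrite mdot_sqr mdot_trm2.
by lra.
Qed.

(* [C] acts on the hyperplane orthogonal to [x], of dimension [n - 1]. *)
Lemma tangential_ineq x C : (3 <= n)%N -> 0 < vdot x x -> vdot x (mulv C x) = 0 ->
  mtr C ^+ 2 <= (n%:R - 2) * mdot C C + mdot C (trm C).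
Proof.
move=> n3 t0 xCx; have N3 : 3 <= n%:R :> R by rewrite ler_nat.
set t := vdot x x in t0; set tau := mtr C.
have N1 : (n%:R - 1 : R) != 0 by rewrite gt_eqF //; lra.
have tN : t != 0 by rewrite gt_eqF.
pose S i j := 1 * C i j + 1 * trm C i j.
(* [Q] is t times the orthogonal projection onto the hyperplane. Testing the symmetric matrix [S]
   against it, instead of the identity, gives the factor n - 1 in place of n. *)
pose Q i j := t * (i == j)%:R + (-1) * (x i * x j).
have SS : mdot S S = 2 * mdot C C + 2 * mdot C (trm C).
  by rewrite mdot_sqr mdot_trm2; ring.
have trT : mtr (trm C) = tau by [].
have xCTx : vdot x (mulv (trm C) x) = 0 by rewrite vdot_mulv vdotC.
have QS : mdot Q S = 2 * t * tau.
  rewrite mdot_lin mdot_id mdot_rank1 vdot_mulv [X in vdot X _](_ : _ = mulv S x); last first.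
    by apply/funext => i; apply: eq_bigr => j _; rewrite /trm /S /trm; ring.
  have -> : mulv S x = (fun i => 1 * mulv C x i + 1 * mulv (trm C) x i).
    by apply/funext => i; rewrite /mulv !mulr_sumr -big_split; apply: eq_bigr => j _ /=; rewrite /S; ring.
  rewrite vdot_lin ![vdot _ x]vdotC xCx xCTx.
  have -> : mtr S = 2 * tau.
    by rewrite /tau /mtr mulr_sumr; apply: eq_bigr => i _; rewrite /S /trm; ring.
  by ring.
have QQ : mdot Q Q = t ^+ 2 * (n%:R - 1).
  rewrite mdot_lin mdot_id mdot_rank1.
  have -> : mulv Q x = fun i => 0 * x i + 0 * x i.
    apply/funext => i; rewrite /mulv /Q; under eq_bigr do rewrite mulrDl.
    rewrite big_split /= (bigD1 i) //= big1 ?addr0; last first.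
      by move=> j; rewrite eq_sym => /negbTE ->; rewrite mulr0 mul0r.
    rewrite eqxx mulr1 (eq_bigr (fun j => - x i * (x j * x j))) => [|j _]; last ring.
    by rewrite -mulr_sumr -/(vdot x x) -/t; ring.
  rewrite vdotC vdot_lin; have -> : mtr Q = t * n%:R - t.
    rewrite -mtr_id /mtr mulr_sumr -sumrB; apply: eq_bigr => i _; rewrite /Q; ring.
  by ring.
(* The coefficient of the projection of [S] on [Q], so that the square below expresses
   Cauchy-Schwarz. *)
pose kap := 2 * tau / ((n%:R - 1) * t).
have := mdot_ge0 (fun i j => 1 * S i j + (- kap) * Q i j).
rewrite mdot_sqr [mdot S Q]mdotC SS QS QQ.
have -> : 1 ^+ 2 * (2 * mdot C C + 2 * mdot C (trm C)) + 2 * 1 * (- kap) * (2 * t * tau) +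
   (- kap) ^+ 2 * (t ^+ 2 * (n%:R - 1)) =
   (2 * (n%:R - 1) * (mdot C C + mdot C (trm C)) - 4 * tau ^+ 2) / (n%:R - 1).
  by rewrite /kap; field; rewrite ?N1 ?tN.
rewrite pmulr_lge0 ?invr_gt0; last by lra.
have := mdot_cauchy_trm C; set a := mdot C C; set b := mdot C (trm C) => ab h.
(* The right side (n - 2) a + b is (n - 1)/2 times a + b plus (n - 3)/2 times a - b; for n >= 3 the
   second weight is nonnegative. *)
have : 0 <= (n%:R - 3) * (a - b) by rewrite mulr_ge0; lra.
by lra.
Qed.

(** This is [tangential_ineq] for the two-sided compression of B to the hyperplane orthogonal to x,
    expanded and scaled so that no division by t occurs. For B = grad v, [G] is r times the radial
    derivative, and [H] becomes - v when x . v = 0. *)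
Lemma matrix_ineq x B : (3 <= n)%N ->
  let t := vdot x x in let G := mulv B x in let H := mulv (trm B) x in
  let k := vdot x G in let tau := mtr B in
  (n%:R - 2) * (t * vdot H H - k ^+ 2) + t ^+ 2 * (tau ^+ 2 - mdot B (trm B))
     + 2 * t * vdot H G - 2 * t * k * tau
  <= (n%:R - 2) * (t * (t * mdot B B - vdot G G)).
Proof.
move=> n3; cbv zeta; set t := vdot x x; set G := mulv B x; set H := mulv (trm B) x.
set k := vdot x G; set tau := mtr B.
have := vdot_ge0 x; rewrite -/t le_eqVlt => /predU1P[t0|t0].
  have x0 i : x i = 0.
    have /eqP := esym t0; rewrite psumr_eq0 => [|j _]; last by rewrite -expr2 sqr_ge0.
    by move=> /allP/(_ i); rewrite mem_index_enum => /(_ isT) /eqP /eqP; rewrite mulf_eq0 orbb => /eqP.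
  have k0 : k = 0 by rewrite /k /vdot big1 // => i _; rewrite x0 mul0r.
  by rewrite -t0 k0; lra.
have kH : k = vdot H x by rewrite /k vdot_mulv.
(* With P the orthogonal projection off x, [M] is t P B and the matrix [C] below is t^2 P B P. *)
pose M i j := t * B i j + (-1) * (x i * H j).
pose g := mulv M x.
have gE : g = fun i => t * G i + (- k) * x i.
  apply/funext => i; rewrite /g /mulv.
  rewrite (eq_bigr (fun j => t * (B i j * x j) + (- x i) * (H j * x j))) => [|j _]; last by rewrite /M; ring.
  by rewrite big_split /= -!mulr_sumr -/(vdot H x) -kH /G /mulv; ring.
pose C i j := t * M i j + (-1) * (g i * x j).
have xM y : vdot x (mulv M y) = 0.
  rewrite vdot_mulv (_ : mulv (trm M) x = fun i => 0 * x i + 0 * x i) ?vdot_lin ?mul0r ?addr0 //.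
  apply/funext => i; rewrite /mulv /trm /M.
  rewrite (eq_bigr (fun j => t * (B j i * x j) + (- H i) * (x j * x j))) => [|j _]; last by ring.
  by rewrite big_split /= -!mulr_sumr -/(vdot x x) -/t /H /mulv /trm; ring.
have xg : vdot x g = 0 by exact: xM.
have MM : mdot M M = t * (t * mdot B B - vdot H H).
  have MB : mdot B M = t * mdot B B - vdot H H.
    by rewrite mdotC mdot_lin mdot_rank1 vdot_mulv -/H; ring.
  by rewrite mdot_lin mdot_rank1 xM MB; ring.
have MMT : mdot M (trm M) = t ^+ 2 * mdot B (trm B) - 2 * t * vdot H G + k ^+ 2.
  have MB : mdot B (trm M) = t * mdot B (trm B) - vdot H G.
    rewrite -mdot_trm mdotC mdot_lin mdot_rank1 vdot_mulv.
    by rewrite (_ : mulv (trm (trm B)) x = G) // [vdot G H]vdotC; ring.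
  rewrite mdot_lin mdot_rank1 MB vdot_mulv (_ : mulv (trm (trm M)) x = g) //.
  by rewrite gE vdot_lin [vdot G H]vdotC [vdot x H]vdotC -kH; ring.
have gg : vdot g g = t * (t * vdot G G - k ^+ 2).
  rewrite {1}gE vdot_lin xg vdotC gE vdot_lin -/k; ring.
have CC : mdot C C = t ^+ 2 * (t ^+ 2 * mdot B B - t * vdot H H - t * vdot G G + k ^+ 2).
  have Cx : mulv C x = fun i => 0 * x i + 0 * x i.
    apply/funext => i; rewrite /mulv /C.
    rewrite (eq_bigr (fun j => t * (M i j * x j) + (- g i) * (x j * x j))) => [|j _]; last by ring.
    by rewrite big_split /= -!mulr_sumr -/(vdot x x) -/t /g /mulv; ring.
  rewrite mdot_lin mdot_rank1 Cx [vdot g _]vdotC vdot_lin mdotC mdot_lin mdot_rank1 -/g gg MM.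
  by ring.
have CCT : mdot C (trm C) = t ^+ 2 * (t ^+ 2 * mdot B (trm B) - 2 * t * vdot H G + k ^+ 2).
  have xC : mulv (trm C) x = fun i => 0 * x i + 0 * x i.
    apply/funext => i; rewrite /mulv /C /trm.
    rewrite (eq_bigr (fun j => t * (trm M i j * x j) + (- x i) * (x j * g j))) => [|j _]; last by rewrite /trm; ring.
    rewrite big_split /= -!mulr_sumr -/(vdot x g) xg -/(mulv (trm M) x i).
    have -> : mulv (trm M) x i = 0.
      rewrite /mulv /trm /M.
      rewrite (eq_bigr (fun j => t * (B j i * x j) + (- H i) * (x j * x j))) => [|j _]; last by ring.
      by rewrite big_split /= -!mulr_sumr -/(vdot x x) -/t /H /mulv /trm; ring.
    by ring.
  have MC : mdot M (trm C) = t * mdot M (trm M).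
    rewrite -mdot_trm mdotC mdot_lin mdot_rank1 [vdot g _](_ : _ = 0) ?mulr0 ?addr0 //.
    by rewrite vdot_mulv vdotC; exact: xM.
  rewrite mdot_lin mdot_rank1 xC [vdot g _]vdotC vdot_lin MC MMT.
  by ring.
have CT : mtr C = t ^+ 2 * tau - t * k.
  rewrite /mtr (eq_bigr (fun i => t ^+ 2 * B i i + (- t) * (H i * x i) + (- 1) * (x i * g i))) => [|i _]; last by rewrite /C /M; ring.
  rewrite !big_split /= -!mulr_sumr -/(mtr B) -/(vdot H x) -/(vdot x g) xg -kH -/tau; ring.
have xCx : vdot x (mulv C x) = 0.
  rewrite vdot_mulv (_ : mulv (trm C) x = fun i => 0 * x i + 0 * x i) ?vdot_lin ?mul0r ?addr0 //.
  apply/funext => i; rewrite /mulv /C /trm.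
  rewrite (eq_bigr (fun j => t * (M j i * x j) + (- x i) * (x j * g j))) => [|j _]; last by ring.
  rewrite big_split /= -!mulr_sumr -/(vdot x g) xg /M.
  rewrite (eq_bigr (fun j => t * (B j i * x j) + (- H i) * (x j * x j))) => [|j _]; last by ring.
  by rewrite big_split /= -!mulr_sumr -/(vdot x x) -/t /H /mulv /trm; ring.
have := tangential_ineq n3 t0 xCx; rewrite CC CCT CT.
have -> : (t ^+ 2 * tau - t * k) ^+ 2 = t ^+ 2 * (t * tau - k) ^+ 2 by ring.
rewrite [X in _ <= X + _]mulrCA -mulrDr ler_pM2l ?exprn_gt0 // => h.
by lra.
Qed.

End MatrixIneq.

(** * The scalar inequality for the radial weights *)

Section CoreScalar.
Context (R : realFieldType).
Variables (N a lam eps t u w : R).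
(* Read t = |x|^2, u = (|x|^2 + eps)^-1, w = (|x|^2 + eps / 4)^-1. Each [c_m] is a
   radial weight m, and [c_m1] is m'(r) / r, so that grad m = c_m1 x. The scales
   eps and eps / 4 and the shift 3 eps u in [c_b] are tuned so that the first
   bracket in [radial_coef_ge] stays nonnegative near the origin. *)
Definition c_zeta := t * u * w.
Definition c_zeta1 := 2 * (u * w) * (1 - t * (u + w)).
Definition c_om := t ^+ 2 * u * w.
Definition c_om1 := 2 * (t * u * w) * (2 - t * (u + w)).
Definition c_c := t * u * w * (8 - 2 * N - 2 * (t * (u + w))).
Definition c_c1 := 2 * (u * w) * (1 - t * (u + w)) * (8 - 2 * N - 2 * (t * (u + w)))
  - 4 * (t * u * w) * (u + w - t * (u ^+ 2 + w ^+ 2)).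
Definition c_b := a - 3 * eps * u - lam * t.
Definition c_rb := u * c_b.
Definition c_rb1 := 2 * (u * (3 * eps * u ^+ 2 - lam) - u ^+ 2 * c_b).
(** [c_e1], [c_e2], [c_e3] are the coefficients of q tau, q k and q^2, with q = x . v, that identity
    [eA] of [scalar_core] leaves over. *)
Definition c_e1 := (2 * N * c_zeta + 2 * t * c_zeta1 - c_om1 - c_c) / (N - 2).
Definition c_e2 := (2 * (N - 2) * (u * w) - 2 * c_zeta1) / (N - 2).
Definition c_e3 := ((N - 2) * (u * w) - c_c1) / (N - 2).

(** The bound 1 <= 4 a + 3 N - 12 is an equality for N = 3, where a = 1; it controls the term linear
    in eps u in [radial_coef_ge]. *)
Definition core_hyps := [/\ 3 <= N, 0 <= a, a * (a + N - 2) = 2 & 1 <= 4 * a + 3 * N - 12] /\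
  [/\ 0 < lam, 0 < eps, 0 <= t, (t + eps) * u = 1 & (t + eps / 4) * w = 1].

Lemma coef_bounds : 0 < eps -> 0 <= t -> (t + eps) * u = 1 -> (t + eps / 4) * w = 1 ->
  [/\ 0 < u, 0 < w, t * u <= 1 & t * w <= 1].
Proof.
move=> e0 t0 hu hw.
have u0 : 0 < u by have : 0 < (t + eps) * u; [rewrite hu|rewrite pmulr_rgt0 // ltr_wpDl].
have e4 : 0 < eps / 4 by rewrite divr_gt0.
have w0 : 0 < w by have : 0 < (t + eps / 4) * w; [rewrite hw|rewrite pmulr_rgt0 // ltr_wpDl].
split => //; first by rewrite -hu mulrDl lerDl mulr_ge0 // ltW.
by rewrite -hw mulrDl lerDl mulr_ge0 ?ltW.
Qed.

Local Notation Lam := (N + 2 * a).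

(** The right side is the coefficient of |v|^2 left after completing the square. At eps = 0 it is
    exactly lam L, because a (a + N - 2) = 2 cancels the terms in 1 / |x|^2. For eps > 0 the loss
    lam (L + 4) p, with p = eps u, is paid by u p / 2 and a constant times eps, by way of the
    perfect square in [h3]. *)
Lemma radial_coef_ge : core_hyps ->
  lam * Lam - eps * (lam ^+ 2 * (Lam + 4) ^+ 2 / 2) <=
  2 * c_zeta - u * c_b ^+ 2 - N * c_rb - t * c_rb1 + lam ^+ 2 * t.
Proof.
move=> [[N3 a0 ha h4] [lam0 eps0 t0 hu hw]].
have [u0 w0 tu1 tw1] := coef_bounds eps0 t0 hu hw.
pose p := eps * u; pose p' := eps / 4 * w.
have p0 : 0 < p by rewrite mulr_gt0.
have p1 : p <= 1 by move: hu t0 u0; rewrite /p mulrDl => <- h1 h2; rewrite lerDr mulr_ge0 // ltW.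
have tE : t = u^-1 - eps.
  by apply: (mulIf (lt0r_neq0 u0)); rewrite mulrBl mulVf ?gt_eqF // -hu; ring.
have -> : 2 * c_zeta - u * c_b ^+ 2 - N * c_rb - t * c_rb1 + lam ^+ 2 * t =
  u * (p * (4 * a + 3 * N - 12) + 3 * p ^+ 2 - 2 * p') + lam * (Lam - (Lam + 4) * p + 4 * p ^+ 2)
   + lam ^+ 2 * eps * (1 - p) + u * (2 - a * (a + N - 2)).
  have -> : c_zeta = u * (1 - p') by rewrite /c_zeta -hw /p'; ring.
  rewrite /c_rb1 /c_rb /c_b {}/p' /p tE; field.
  by rewrite gt_eqF.
rewrite ha subrr mulr0 addr0.
(* Far out p' is close to p / 4, because of the scale eps / 4, and p / 2 suffices; near the origin
   both are close to 1 and 3 p^2 pays. After multiplication by suitable factors (t + eps) u = 1 and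
   (t + eps / 4) w = 1 the difference has nonnegative coefficients. *)
have hp : 2 * p' <= p / 2 + 3 * p ^+ 2.
  rewrite -subr_ge0; have -> : p / 2 + 3 * p ^+ 2 - 2 * p' = eps / 2 * u ^+ 2 * w * (21 / 4 * eps * t + 3 / 4 * eps ^+ 2).
    transitivity (eps * u * ((t + eps) * u) / 2 * ((t + eps / 4) * w) + 3 * eps ^+ 2 * u ^+ 2 * ((t + eps / 4) * w)
      - eps / 2 * w * ((t + eps) * u) ^+ 2).
      by rewrite hu hw /p /p'; field.
    by field.
  rewrite !mulr_ge0 ?exprn_ge0 ?(ltW u0) ?(ltW w0) ?(ltW eps0) //.
  by rewrite addr_ge0 ?mulr_ge0 ?sqr_ge0 ?divr_ge0 ?(ltW eps0).
have h1 : u * (p / 2) <= u * (p * (4 * a + 3 * N - 12) + 3 * p ^+ 2 - 2 * p').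
  rewrite ler_wpM2l ?(ltW u0) //; have : p <= p * (4 * a + 3 * N - 12) by rewrite ler_peMr // ltW.
  by lra.
have h2 : 0 <= lam ^+ 2 * eps * (1 - p) by rewrite mulr_ge0 ?subr_ge0 // mulr_ge0 ?sqr_ge0 // ltW.
have h3 : u * (p / 2) - lam * (Lam + 4) * p + eps * (lam ^+ 2 * (Lam + 4) ^+ 2 / 2) =
    eps / 2 * (u - lam * (Lam + 4)) ^+ 2 by rewrite /p; field.
have h5 : 0 <= eps / 2 * (u - lam * (Lam + 4)) ^+ 2 by rewrite mulr_ge0 ?sqr_ge0 // divr_ge0 // ltW.
have h6 : 0 <= 4 * lam * p ^+ 2 by rewrite !mulr_ge0 ?sqr_ge0 // ltW.
by lra.
Qed.

Lemma scalar_core (V2 B2 G2 H2 T2 HG vH vG q k tau : R) : core_hyps ->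
  (N - 2) * (t * H2 - k ^+ 2) + t ^+ 2 * (tau ^+ 2 - T2) + 2 * t * HG - 2 * t * k * tau
    <= (N - 2) * (t * (t * B2 - G2)) ->
  (k + q) ^+ 2 <= t * (H2 + 2 * vH + V2) ->
  G2 <= t * B2 -> 0 <= B2 -> 0 <= V2 ->
  0 <= G2 - 2 * c_b * vG + c_b ^+ 2 * V2 ->
  (N - 2)^-1 * (- (c_om1 * (vH - q * tau) + c_om * (T2 - tau ^+ 2))
    + 2 * (c_zeta1 * (q * (k - t * tau)) + c_zeta * (HG + vG - tau * (k + q) + q * (1 - N) * tau))
    - (c_zeta1 * (t * V2) + c_zeta * (N * V2 + 2 * vG))
    + (c_c1 * q ^+ 2 + c_c * (tau * q + vH + V2)))
  + (c_rb1 * (t * V2) + c_rb * (N * V2 + 2 * vG))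
  <= B2 + lam ^+ 2 * (t * V2) - (lam * Lam - eps * (lam ^+ 2 * (Lam + 4) ^+ 2 / 2)) * V2
     - (c_e1 * (q * tau) + c_e2 * (q * k) + c_e3 * q ^+ 2).
Proof.
move=> h0; have [[N3 a0 ha h4] [lam0 eps0 t0 hu hw]] := h0.
have [u0 w0 tu1 tw1] := coef_bounds eps0 t0 hu hw.
move=> i1 i2 i3 B0 V0 i4.
have N2 : N - 2 != 0 by rewrite gt_eqF //; lra.
have uw : 0 <= u * w by rewrite mulr_ge0 ?ltW.
have W := ler_wpM2r V0 (radial_coef_ge h0).
have k1 := ler_wpM2l uw i1.
have k2 : (N - 2) * (u * w) * (k + q) ^+ 2 <= (N - 2) * (u * w) * (t * (H2 + 2 * vH + V2)).
  by rewrite ler_wpM2l // mulr_ge0 //; lra.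
(* [B2] is u [G2], kept for the completed square, plus [c_zeta] (t B2 - G2), kept for the tangential
   gain, plus this rest. *)
have k3 : 0 <= (u - c_zeta) * (t * B2 - G2) + B2 * (1 - t * u).
  have -> : u - c_zeta = u * (1 - t * w) by rewrite /c_zeta; ring.
  by rewrite addr_ge0 ?mulr_ge0 ?subr_ge0 // ?ltW.
have k4 : 0 <= u * (G2 - 2 * c_b * vG + c_b ^+ 2 * V2) by apply: mulr_ge0 i4; exact: ltW.
set L := (N - 2)^-1 * _; set Err := c_e1 * _ + _ + _.
have k5 : (N - 2)^-1 * (u * w * ((N - 2) * (t * H2 - k ^+ 2) + t ^+ 2 * (tau ^+ 2 - T2) + 2 * t * HG - 2 * t * k * tau))
    <= (N - 2)^-1 * (u * w * ((N - 2) * (t * (t * B2 - G2)))).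
  by rewrite ler_wpM2l // invr_ge0; lra.
have k6 : (u * w) * (k + q) ^+ 2 <= (u * w) * (t * (H2 + 2 * vH + V2)) by rewrite ler_wpM2l.
(* The gain 2 [c_zeta] |v|^2 becomes visible: up to the divergence [L] and the terms in q, the
   difference is the slack of the matrix inequality plus that of Cauchy-Schwarz. *)
have eA : c_zeta * (t * B2 - G2) - (L + 2 * c_zeta * V2 + Err) =
  ((N - 2)^-1 * (u * w * ((N - 2) * (t * (t * B2 - G2)))) -
   (N - 2)^-1 * (u * w * ((N - 2) * (t * H2 - k ^+ 2) + t ^+ 2 * (tau ^+ 2 - T2) + 2 * t * HG - 2 * t * k * tau)))
  + ((u * w) * (t * (H2 + 2 * vH + V2)) - (u * w) * (k + q) ^+ 2).
  by rewrite /L /Err /c_e1 /c_e2 /c_e3 /c_c1 /c_c /c_om1 /c_om /c_zeta1 /c_zeta; field.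
have k7 : 0 <= c_zeta * (t * B2 - G2) - (L + 2 * c_zeta * V2 + Err).
  by rewrite eA addr_ge0 // subr_ge0.
move: W k3 k4 k7; rewrite /c_rb => {i1 i2 i3 i4 k1 k2 eA k5 k6}; move: L Err => L Err; lra.
Qed.

End CoreScalar.

(** * The integrated inequality *)

Section L2.
Context (R : realType) (n : nat).
Local Notation V := 'rV[R]_n.
Local Notation mu := (lebN R n).
Implicit Types f g m : V -> R.

Definition L2c f := continuous f /\ mu.-integrable setT (EFin \o (fun x => f x ^+ 2)).

Definition bddc m := continuous m /\ exists K, forall x, `|m x| <= K.

Lemma bddc_cst c : bddc (cst c).
Proof. by split; [exact: (@Ck_cst R n 0)|exists `|c|]. Qed.

Lemma bddcD f g : bddc f -> bddc g -> bddc (fun x => f x + g x).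
Proof.
move=> [cf [K hK]] [cg [L hL]]; split; first exact: cont_add.
by exists (K + L) => x; rewrite (le_trans (ler_normD _ _)) // lerD.
Qed.

Lemma bddcM f g : bddc f -> bddc g -> bddc (fun x => f x * g x).
Proof.
move=> [cf [K hK]] [cg [L hL]]; split; first exact: cont_mul.
by exists (K * L) => x; rewrite normrM ler_pM.
Qed.

Lemma bddcN f : bddc f -> bddc (fun x => - f x).
Proof.
by move=> [cf [K hK]]; split; [exact: (@CkN _ _ 0)|exists K => x; rewrite normrN].
Qed.

Lemma bddc_eq f g : bddc f -> f =1 g -> bddc g.
Proof. by move=> bf /funext <-. Qed.

Lemma L2c_mul f g : L2c f -> L2c g -> mu.-integrable setT (EFin \o (fun x => f x * g x)).
Proof.
move=> [cf sf] [cg sg].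
have := integrableD measurableT sf sg; apply: le_integrable => //.
  by apply/measurable_EFinP; apply: continuous_measurable_mx; exact: cont_mul.
move=> x _ /=; rewrite lee_fin [leRHS]ger0_norm ?addr_ge0 ?sqr_ge0 //.
rewrite normrM -(real_normK (num_real (f x))) -(real_normK (num_real (g x))).
have := sqr_ge0 (`|f x| - `|g x|); have := normr_ge0 (f x); have := normr_ge0 (g x).
by set F := `|f x|; set G := `|g x|; nra.
Qed.

Lemma L2c_mulr m f : bddc m -> L2c f -> L2c (fun x => m x * f x).
Proof.
move=> [cm [K hK]] [cf sf]; split; first exact: cont_mul.
have := integrableZl measurableT (K ^+ 2) sf; apply: le_integrable => //.
  apply/measurable_EFinP; apply: measurable_funX; apply: continuous_measurable_mx.
  exact: cont_mul.
move=> x _ /=; rewrite lee_fin [leLHS]ger0_norm ?sqr_ge0 // [leRHS]ger0_norm ?(mulr_ge0 (sqr_ge0 _) (sqr_ge0 _)) //.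
rewrite exprMn ler_wpM2r ?sqr_ge0 // -[leLHS]real_normK ?num_real //.
by rewrite lerXn2r // nnegrE (le_trans _ (hK x)).
Qed.

Lemma L2cD f g : L2c f -> L2c g -> L2c (fun x => f x + g x).
Proof.
move=> lf lg; split; first exact: cont_add lf.1 lg.1.
have i1 := integrableD measurableT lf.2 lg.2.
have i2 := integrableZl measurableT 2 (L2c_mul lf lg).
have := integrableD measurableT i1 i2.
by apply: eq_integrable => // x _ /=; rewrite -EFinM -!EFinD; congr EFin; ring.
Qed.

Lemma L2c0 : L2c (cst 0).
Proof.
split; first exact: (@Ck_cst R n 0).
by under eq_fun do rewrite expr0n /=; exact: integrable0.
Qed.

Lemma L2c_sum (I : Type) (r : seq I) (f : I -> V -> R) :
  (forall i, L2c (f i)) -> L2c (fun x => \sum_(i <- r) f i x).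
Proof.
move=> h; elim: r => [|i r IHr]; first by under eq_fun do rewrite big_nil; exact: L2c0.
by under eq_fun do rewrite big_cons; exact: L2cD.
Qed.

Lemma int_sum (I : Type) (r : seq I) (f : I -> V -> R) :
  (forall i, mu.-integrable setT (EFin \o f i)) ->
  mu.-integrable setT (EFin \o (fun x => \sum_(i <- r) f i x)).
Proof.
move=> h; have : mu.-integrable setT (fun x => \sum_(i <- r) (f i x)%:E)%E.
  by apply: integrable_sum => // i _; exact: h.
by apply: eq_integrable => // x _ /=; rewrite sumEFin.
Qed.

Lemma intD f g : mu.-integrable setT (EFin \o f) -> mu.-integrable setT (EFin \o g) ->
  mu.-integrable setT (EFin \o (fun x => f x + g x)).
Proof. by move=> h1 h2; have := integrableD measurableT h1 h2. Qed.

Lemma intZ c f : mu.-integrable setT (EFin \o f) -> mu.-integrable setT (EFin \o (fun x => c * f x)).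
Proof. by move=> h; have := integrableZl measurableT c h. Qed.

Lemma intB f g : mu.-integrable setT (EFin \o f) -> mu.-integrable setT (EFin \o g) ->
  mu.-integrable setT (EFin \o (fun x => f x - g x)).
Proof. by move=> h1 h2; have := integrableB measurableT h1 h2. Qed.

Lemma int_jap f : continuous f -> mu.-integrable setT (EFin \o f) ->
  mu.-integrable setT (EFin \o (fun x => f x / jap x)).
Proof.
move=> cf i; apply: le_integrable i => //.
  apply/measurable_EFinP; apply: continuous_measurable_mx; apply: cont_mul => //.
  by apply: cont_inv; [move=> x; rewrite gt_eqF // jap_gt0|exact: continuous_jap].
move=> x _ /=; rewrite lee_fin normrM ler_piMr // normfV ger0_norm ?(ltW (jap_gt0 x)) //.
by rewrite invf_le1 ?jap_gt0 // jap_ge1.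
Qed.

End L2.

(** * Divergences of the basic vector fields *)

Section VectorIdentities.
Context (R : realType) (n : nat).
Local Notation V := 'rV[R]_n.

Definition xc (x : V) : 'I_n -> R := fun i => x ord0 i.

Lemma vdot_xc x : vdot (xc x) (xc x) = sqnorm x.
Proof. by apply: eq_bigr => i _; rewrite expr2. Qed.

Lemma Ck_vdot m (f g : 'I_n -> V -> R) : (forall i, Ck m (f i)) -> (forall i, Ck m (g i)) ->
  Ck m (fun x => vdot (f ^~ x) (g ^~ x)).
Proof. by move=> cf cg; apply: Ck_sum => i _; exact: CkM. Qed.

Lemma has_pd_vdot k (f g df dg : 'I_n -> V -> R) :
  (forall i, has_pd k (f i) (df i)) -> (forall i, has_pd k (g i) (dg i)) ->
  has_pd k (fun x => vdot (f ^~ x) (g ^~ x))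
    (fun x => vdot (f ^~ x) (dg ^~ x) + vdot (g ^~ x) (df ^~ x)).
Proof.
move=> hf hg; apply: (@has_pd_eq _ _ k _ _ _ _
  (@has_pd_sum _ _ k _ (index_enum 'I_n) predT _ _ (fun i _ => has_pdM (hf i) (hg i)))) => x //=.
by rewrite -big_split.
Qed.

Lemma vdot_delta (y : 'I_n -> R) k : vdot y (fun i => (i == k)%:R) = y k.
Proof.
rewrite /vdot (bigD1 k) //= eqxx mulr1 big1 ?addr0 // => i /negbTE ->.
by rewrite mulr0.
Qed.

(** The gradient of the weight is [m1] x. Only the total divergence is used, so the partial
    derivatives stay existential here and for the fields below. *)
Lemma div_radial (m m1 : V -> R) (Y dY : 'I_n -> V -> R) :
  (forall k, has_pd k m (fun x => m1 x * x ord0 k)) -> (forall k, has_pd k (Y k) (dY k)) ->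
  exists dF : 'I_n -> V -> R, (forall k, has_pd k (fun x => m x * Y k x) (dF k)) /\
  forall x, \sum_k dF k x = m1 x * vdot (xc x) (Y ^~ x) + m x * \sum_k dY k x.
Proof.
move=> hm hY; exists (fun k x => m x * dY k x + Y k x * (m1 x * x ord0 k)); split.
  by move=> k; exact: has_pdM.
move=> x; rewrite big_split /= addrC -mulr_sumr; congr (_ + _).
by rewrite mulr_sumr; apply: eq_bigr => k _; rewrite /xc; ring.
Qed.

Section Fields.
Variables (v : 'I_n -> V -> R) (B : 'I_n -> 'I_n -> V -> R) (D : 'I_n -> 'I_n -> 'I_n -> V -> R).

Local Notation vx x := (v ^~ x).
Local Notation Bx x := (fun l i => B l i x).
(** [Gx] is r times the radial derivative of v. The gradient of [qx] is [Hx] + v, so that [Hx] is -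
    v on tangential fields. *)
Definition Gx x := mulv (Bx x) (xc x).
Definition Hx x := mulv (trm (Bx x)) (xc x).
Definition qx x := vdot (xc x) (vx x).
Definition tau x := mtr (Bx x).
Definition V2x x := vdot (vx x) (vx x).

(** [Y1] is a potential of the null Lagrangian and [Y3] is the radial field of density |v|^2. [Y2]
    and [Y4] carry the factor x . v: through grad (x . v) = [Hx] + v they trade v . H for - |v|^2
    and H . G for - v . G, up to terms in x . v. *)
Definition Y1 k x := vdot (vx x) (Bx x k) - vx x k * tau x.
Definition Y2 k x := vx x k * qx x.
Definition Y3 k x := xc x k * V2x x.
Definition Y4 k x := qx x * (Gx x k - xc x k * tau x).

Hypothesis hv : forall l i, has_pd i (v l) (B l i).
Hypothesis hB : forall l i k, has_pd k (B l i) (D l i k).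
Hypothesis Dsym : forall l i k x, D l i k x = D l k i x.

Lemma has_pd_tau k : has_pd k tau (fun x => \sum_i D i i k x).
Proof.
exact: (@has_pd_sum _ _ k _ (index_enum 'I_n) predT _ _ (fun i _ => hB i i k)).
Qed.

Lemma has_pd_qx k : has_pd k qx (fun x => Hx x k + vx x k).
Proof.
apply: (@has_pd_eq _ _ k _ _ _ _ (has_pd_vdot (fun i => has_pd_coord k i) (fun i => hv i k))) => x //=.
rewrite vdot_delta; congr (_ + _).
by apply: eq_bigr => i _; rewrite mulrC.
Qed.

(** The second derivatives of v cancel by symmetry, which is what makes the quadratic form a null
    Lagrangian. *)
Lemma div_Y1 : exists dY : 'I_n -> V -> R, (forall k, has_pd k (Y1 k) (dY k)) /\
  forall x, \sum_k dY k x = mdot (Bx x) (trm (Bx x)) - tau x ^+ 2.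
Proof.
exists (fun k x => vdot (vx x) (fun i => D k i k x) + vdot (Bx x k) (fun i => B i k x)
   - (vx x k * (\sum_i D i i k x) + tau x * B k k x)); split.
  move=> k; apply: has_pdB; last by apply: has_pdM; [exact: hv|exact: has_pd_tau].
  exact: (has_pd_vdot (fun i => hv i k) (fun i => hB k i k)).
move=> x; rewrite sumrB !big_split /=.
have -> : \sum_k vdot (vx x) (fun i => D k i k x) = \sum_k vx x k * \sum_i D i i k x.
  rewrite /vdot exchange_big; apply: eq_bigr => i _ /=; rewrite mulr_sumr.
  by apply: eq_bigr => k _; rewrite Dsym.
have -> : \sum_k tau x * B k k x = tau x ^+ 2 by rewrite -mulr_sumr expr2.
by rewrite opprD addrACA subrr add0r.
Qed.

Lemma xc_Y1 x : vdot (xc x) (Y1 ^~ x) = vdot (vx x) (Hx x) - qx x * tau x.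
Proof.
rewrite [vdot (vx x) _]vdotC -vdot_mulv vdotC.
transitivity (\sum_k ((mulv (Bx x) (vx x) k * xc x k) - tau x * (xc x k * vx x k))).
  apply: eq_bigr => k _; rewrite /Y1.
  have -> : vdot (vx x) (Bx x k) = mulv (Bx x) (vx x) k by apply: eq_bigr => i _; rewrite mulrC.
  by ring.
by rewrite sumrB -mulr_sumr -/(vdot _ _) -/(vdot _ _) vdotC mulrC.
Qed.

Lemma div_Y2 : exists dY : 'I_n -> V -> R, (forall k, has_pd k (Y2 k) (dY k)) /\
  forall x, \sum_k dY k x = tau x * qx x + vdot (vx x) (Hx x) + V2x x.
Proof.
exists (fun k x => vx x k * (Hx x k + vx x k) + qx x * B k k x); split.
  by move=> k; apply: has_pdM; [exact: hv|exact: has_pd_qx].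
move=> x; rewrite big_split /= -mulr_sumr.
under eq_bigr do rewrite mulrDr.
by rewrite big_split /= addrC addrA mulrC.
Qed.

Lemma xc_Y2 x : vdot (xc x) (Y2 ^~ x) = qx x ^+ 2.
Proof.
by rewrite expr2 {1}/qx /vdot mulr_suml; apply: eq_bigr => k _; rewrite /Y2 mulrA.
Qed.

Lemma div_Y3 : exists dY : 'I_n -> V -> R, (forall k, has_pd k (Y3 k) (dY k)) /\
  forall x, \sum_k dY k x = n%:R * V2x x + 2 * vdot (vx x) (Gx x).
Proof.
exists (fun k x => xc x k * (vdot (vx x) (fun l => B l k x) + vdot (vx x) (fun l => B l k x))
   + V2x x * (k == k)%:R); split.
  move=> k; apply: has_pdM; first exact: has_pd_coord.
  exact: (has_pd_vdot (fun l => hv l k) (fun l => hv l k)).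
move=> x; rewrite big_split /= [X in _ + X](eq_bigr (fun=> V2x x)) => [|k _]; last by rewrite eqxx mulr1.
rewrite sumr_const card_ord -[X in _ + X]mulr_natl addrC; congr (_ + _).
rewrite vdot_mulv [vdot _ (xc x)]vdotC /vdot mulr_sumr; apply: eq_bigr => k _.
rewrite mulrCA; congr (_ * _); rewrite mulr_natl mulr2n.
by congr (_ + _); apply: eq_bigr => l _; rewrite mulrC.
Qed.

Lemma xc_Y3 x : vdot (xc x) (Y3 ^~ x) = sqnorm x * V2x x.
Proof. by rewrite -vdot_xc {1}/vdot mulr_suml; apply: eq_bigr => k _; rewrite /Y3 mulrA. Qed.

Lemma div_Y4 : exists dY : 'I_n -> V -> R, (forall k, has_pd k (Y4 k) (dY k)) /\
  forall x, \sum_k dY k x = vdot (Hx x) (Gx x) + vdot (vx x) (Gx x)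
    - tau x * (vdot (xc x) (Gx x) + qx x) + qx x * (1 - n%:R) * tau x.
Proof.
exists (fun k x => qx x * ((vdot (Bx x k) (fun i => (i == k)%:R) + vdot (xc x) (fun i => D k i k x))
     - (xc x k * (\sum_i D i i k x) + tau x * (k == k)%:R))
   + (Gx x k - xc x k * tau x) * (Hx x k + vx x k)); split.
  move=> k; apply: has_pdM; first exact: has_pd_qx.
  apply: has_pdB; last by apply: has_pdM; [exact: has_pd_coord|exact: has_pd_tau].
  exact: (has_pd_vdot (fun i => hB k i k) (fun i => has_pd_coord k i)).
move=> x; rewrite big_split /= addrC; congr (_ + _).
  have kE : vdot (xc x) (Gx x) = vdot (xc x) (Hx x) by rewrite vdot_mulv vdotC.
  transitivity (\sum_k (Hx x k * Gx x k + vx x k * Gx x k - tau x * (xc x k * Hx x k + xc x k * vx x k))).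
    by apply: eq_bigr => k _; ring.
  by rewrite sumrB -mulr_sumr !big_split /= kE.
rewrite -mulr_sumr -mulrA; congr (_ * _).
rewrite sumrB !big_split /=.
have -> : \sum_k vdot (xc x) (fun i => D k i k x) = \sum_k xc x k * \sum_i D i i k x.
  rewrite /vdot exchange_big; apply: eq_bigr => i _ /=; rewrite mulr_sumr.
  by apply: eq_bigr => k _; rewrite Dsym.
have -> : \sum_(k < n) tau x * (k == k)%:R = n%:R * tau x.
  under eq_bigr do rewrite eqxx mulr1.
  by rewrite sumr_const card_ord mulr_natl.
have -> : \sum_k vdot (Bx x k) (fun i => (i == k)%:R) = tau x.
  by apply: eq_bigr => k _; rewrite vdot_delta.
by ring.
Qed.

Lemma xc_Y4 x : vdot (xc x) (Y4 ^~ x) = qx x * (vdot (xc x) (Gx x) - sqnorm x * tau x).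
Proof.
transitivity (\sum_k (qx x * (xc x k * Gx x k) - qx x * tau x * (xc x k * xc x k))).
  by apply: eq_bigr => k _; rewrite /Y4; ring.
by rewrite sumrB -!mulr_sumr -/(vdot _ _) -/(vdot _ _) vdot_xc mulrBr; ring.
Qed.

End Fields.

End VectorIdentities.
Section Coefficients.
Context (R : realType) (n : nat).
Local Notation V := 'rV[R]_n.
Local Notation mu := (lebN R n).

Lemma has_pdV k (f df : V -> R) : (forall x, f x != 0) -> has_pd k f df ->
  has_pd k (fun x => (f x)^-1) (fun x => - (f x)^-1 ^+ 2 * df x).
Proof.
move=> f0 hf x; have [h1 h2] := hf x; apply: DeriveDef; first exact: derivableV.
by rewrite deriveV // h2 /GRing.scale /= exprVn.
Qed.

Definition radial (m m1 : V -> R) := forall k, has_pd k m (fun x => m1 x * x ord0 k).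

Lemma radial_cst c : radial (cst c) (cst 0).
Proof. by move=> k; apply: has_pd_eq (has_pd_cst k c) _ _ => // x; rewrite mul0r. Qed.

Lemma radialD m m1 p p1 : radial m m1 -> radial p p1 ->
  radial (fun x => m x + p x) (fun x => m1 x + p1 x).
Proof. by move=> hm hp k; apply: has_pd_eq (has_pdD (hm k) (hp k)) _ _ => // x; rewrite mulrDl. Qed.

Lemma radialM m m1 p p1 : radial m m1 -> radial p p1 ->
  radial (fun x => m x * p x) (fun x => m x * p1 x + p x * m1 x).
Proof. by move=> hm hp k; apply: has_pd_eq (has_pdM (hm k) (hp k)) _ _ => // x; ring. Qed.

Lemma radial_eq m m1 p p1 : radial m m1 -> m =1 p -> m1 =1 p1 -> radial p p1.
Proof. by move=> hm /funext <- /funext <-. Qed.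

Local Notation t := (@sqnorm R n).

Definition uinv (e : R) (x : V) := (sqnorm x + e)^-1.

Lemma uinv_eq e x : 0 < e -> (sqnorm x + e) * uinv e x = 1.
Proof. by move=> e0; rewrite mulfV // gt_eqF // ltr_wpDl // sqnorm_ge0. Qed.

Lemma uinv_gt0 e x : 0 < e -> 0 < uinv e x.
Proof. by move=> e0; rewrite invr_gt0 ltr_wpDl // sqnorm_ge0. Qed.

Lemma Ck_uinv m e : 0 < e -> Ck m (uinv e).
Proof.
move=> e0; apply: CkV; first by move=> x; rewrite gt_eqF // ltr_wpDl // sqnorm_ge0.
by apply: CkD; [exact: Ck_sqnorm|exact: Ck_cst].
Qed.

Lemma radial_sqnorm : radial t (cst 2).
Proof. by move=> k; exact: has_pd_sqnorm. Qed.

Lemma radial_uinv e : 0 < e -> radial (uinv e) (fun x => - (2 * uinv e x ^+ 2)).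
Proof.
move=> e0 k; apply: has_pd_eq (has_pdV _ (has_pdD (has_pd_sqnorm k) (has_pd_cst k e))) _ _ => // x.
  by rewrite gt_eqF // ltr_wpDl // sqnorm_ge0.
by rewrite /uinv /=; ring.
Qed.

Lemma bddc_uinv e : 0 < e -> bddc (uinv e).
Proof.
move=> e0; split; first exact: (Ck_uinv 0).
exists e^-1 => x; rewrite ger0_norm ?(ltW (uinv_gt0 _ _)) // lef_pV2 ?posrE ?lerDr ?sqnorm_ge0 //.
by rewrite ltr_wpDl // sqnorm_ge0.
Qed.

Lemma bddc_sqnorm_uinv e : 0 < e -> bddc (fun x => sqnorm x * uinv e x).
Proof.
move=> e0; split; first by apply: cont_mul; [exact: continuous_sqnorm|exact: (Ck_uinv 0)].
exists 1 => x; rewrite ger0_norm ?mulr_ge0 ?sqnorm_ge0 ?(ltW (uinv_gt0 _ _)) //.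
by rewrite -(uinv_eq x e0) mulrDl lerDl mulr_ge0 ?(ltW (uinv_gt0 _ _)) // ltW.
Qed.

Lemma bddc_coord_uinv e i : 0 < e -> bddc (fun x => x ord0 i * uinv e x).
Proof.
move=> e0; split; first by apply: cont_mul; [exact: (@Ck_coord R n 0)|exact: (Ck_uinv 0)].
have [_ [K hK]] := bddc_uinv e0; have [_ [L hL]] := bddc_sqnorm_uinv e0.
exists (K + L) => x; rewrite normrM (ger0_norm (ltW (uinv_gt0 _ e0))).
have h1 : `|x ord0 i| <= 1 + sqnorm x.
  have := sqr_coord_le_sqnorm x i; rewrite -real_normK ?num_real //.
  have := sqr_ge0 (`|x ord0 i| - 1); set X := `|_|; nra.
apply: le_trans (ler_wpM2r (ltW (uinv_gt0 _ e0)) h1) _; rewrite mulrDl mul1r lerD //.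
  exact: le_trans (ler_norm _) (hK x).
exact: le_trans (ler_norm _) (hL x).
Qed.

End Coefficients.

Section Core.
Context (R : realType) (n : nat).
Local Notation V := 'rV[R]_n.
Local Notation mu := (lebN R n).
Variables (a lam eps : R).
Hypothesis eps0 : 0 < eps.
Local Notation N := (n%:R : R).
Local Notation t := (@sqnorm R n).
Local Notation u := (uinv eps).
Local Notation w := (uinv (eps / 4)).

Definition f_zeta (x : V) := c_zeta (t x) (u x) (w x).
Definition f_zeta1 (x : V) := c_zeta1 (t x) (u x) (w x).
Definition f_om (x : V) := c_om (t x) (u x) (w x).
Definition f_om1 (x : V) := c_om1 (t x) (u x) (w x).
Definition f_c (x : V) := c_c N (t x) (u x) (w x).
Definition f_c1 (x : V) := c_c1 N (t x) (u x) (w x).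
Definition f_rb (x : V) := c_rb a lam eps (t x) (u x).
Definition f_rb1 (x : V) := c_rb1 a lam eps (t x) (u x).

Let e4 : 0 < eps / 4. Proof. by rewrite divr_gt0. Qed.
Let ru := @radial_uinv R n _ eps0.
Let rw := @radial_uinv R n _ e4.
Let rt := @radial_sqnorm R n.
Let bu := @bddc_uinv R n _ eps0.
Let bw := @bddc_uinv R n _ e4.
Let btu := @bddc_sqnorm_uinv R n _ eps0.
Let btw := @bddc_sqnorm_uinv R n _ e4.

Lemma radial_zeta : radial f_zeta f_zeta1.
Proof.
apply: radial_eq (radialM (radialM rt ru) rw) _ _ => // x.
by rewrite /f_zeta1 /c_zeta1 /=; ring.
Qed.

Lemma radial_om : radial f_om f_om1.
Proof.
apply: radial_eq (radialM rt radial_zeta) _ _ => // x.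
  by rewrite /f_zeta /f_om /c_zeta /c_om; ring.
by rewrite /f_zeta1 /f_om1 /f_zeta /c_zeta /c_zeta1 /c_om1 /=; ring.
Qed.

Lemma radial_c : radial f_c f_c1.
Proof.
have h := radialM radial_zeta (radialD (@radial_cst R n (8 - 2 * N))
  (radialM (@radial_cst R n (-2)) (radialM rt (radialD ru rw)))).
apply: (radial_eq h) => x.
  by rewrite /f_zeta /f_c /c_zeta /c_c /=; ring.
by rewrite /f_zeta1 /f_c1 /f_zeta /c_zeta /c_zeta1 /c_c1 /=; ring.
Qed.

Lemma radial_rb : radial f_rb f_rb1.
Proof.
have h := radialM ru (radialD (radialD (@radial_cst R n a) (radialM (@radial_cst R n (- 3 * eps)) ru))
  (radialM (@radial_cst R n (- lam)) rt)).
apply: (radial_eq h) => x.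
  by rewrite /f_rb /c_rb /c_b /=; ring.
by rewrite /f_rb1 /c_rb1 /c_b /=; ring.
Qed.

End Core.

Ltac bdd_tac := lazymatch goal with
  | |- bddc (fun x => @GRing.add _ _ _) => apply: bddcD; bdd_tac
  | |- bddc (fun x => @GRing.mul _ _ _) => apply: bddcM; bdd_tac
  | |- bddc (fun x => @GRing.opp _ _) => apply: bddcN; bdd_tac
  | |- bddc (fun _ => ?c) => first [assumption | exact: (bddc_cst _ c)]
  | |- _ => assumption
  end.

Ltac ck_tac := lazymatch goal with
  | |- Ck _ (fun x => @GRing.add _ _ _) => apply: CkD; ck_tac
  | |- Ck _ (fun x => @GRing.mul _ _ _) => apply: CkM; ck_tac
  | |- Ck _ (fun x => @GRing.opp _ _) => apply: CkN; ck_tac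
  | |- Ck _ (fun x => @GRing.exp _ _ _) => apply: CkX; ck_tac
  | |- Ck _ (fun x => sqnorm x) => exact: Ck_sqnorm
  | |- Ck _ (fun x => uinv _ x) => exact: Ck_uinv
  | |- Ck _ (fun _ => ?c) => exact: (@Ck_cst _ _ _ c)
  | |- _ => first [exact: Ck_sqnorm | exact: Ck_uinv]
  end.

Section CoreInequality.
Context (R : realType) (n : nat).
Local Notation V := 'rV[R]_n.
Local Notation mu := (lebN R n).

Lemma bddc_mul_int (m f : V -> R) : bddc m -> mu.-integrable setT (EFin \o f) ->
  mu.-integrable setT (EFin \o (fun x => m x * f x)).
Proof.
move=> [cm [K hK]] i; have mf : measurable_fun setT f by exact/measurable_EFinP/measurable_int/i.
have := integrableZl measurableT K i; apply: le_integrable => //.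
  by apply/measurable_EFinP; apply: measurable_funM => //; exact: continuous_measurable_mx.
move=> x _ /=; rewrite lee_fin !normrM ler_wpM2r //.
exact: le_trans (hK x) (ler_norm _).
Qed.

Lemma vdot_sqr (a b : R) (x y : 'I_n -> R) :
  vdot (fun i => a * x i + b * y i) (fun i => a * x i + b * y i) =
  a ^+ 2 * vdot x x + 2 * a * b * vdot x y + b ^+ 2 * vdot y y.
Proof.
rewrite vdot_lin [vdot x _]vdotC [vdot y _]vdotC !vdot_lin [vdot y x]vdotC; ring.
Qed.

Section CoefBounds.
Variables (a lam eps : R).
Hypothesis eps0 : 0 < eps.
Local Notation N := (n%:R : R).
Local Notation t := (@sqnorm R n).
Local Notation u := (uinv eps).
Local Notation w := (uinv (eps / 4)).

Let e4 : 0 < eps / 4. Proof. by rewrite divr_gt0. Qed.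
Let bu := bddc_uinv n eps0.
Let bw := bddc_uinv n e4.
Let btu := bddc_sqnorm_uinv n eps0.
Let btw := bddc_sqnorm_uinv n e4.

Lemma bddc_zeta : bddc (f_zeta eps : V -> R).
Proof. exact: (bddcM btu bw). Qed.

Lemma bddc_om : bddc (f_om eps : V -> R).
Proof.
(* The weights are polynomials in t u, t w, u and w, which are bounded although t is not. With these
   four made abstract, boundedness follows from the syntax; the other coefficients are treated
   alike. *)
have h (p q U W : V -> R) : bddc p -> bddc q -> bddc U -> bddc W ->
    bddc (fun x : V => p x * q x) by move=> *; bdd_tac.
apply: (bddc_eq (h _ _ _ _ btu btw bu bw)) => x.
by rewrite /f_om /c_om; ring.
Qed.

Lemma bddc_c : bddc (f_c eps : V -> R).
Proof.
have h (p q U W : V -> R) : bddc p -> bddc q -> bddc U -> bddc W ->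
    bddc (fun x : V => p x * W x * (8 - 2 * N - 2 * (p x + q x))) by move=> *; bdd_tac.
apply: (bddc_eq (h _ _ _ _ btu btw bu bw)) => x.
by rewrite /f_c /c_c; ring.
Qed.

Lemma bddc_rb : bddc (f_rb a lam eps : V -> R).
Proof.
have h (p q U W : V -> R) : bddc p -> bddc q -> bddc U -> bddc W ->
    bddc (fun x : V => U x * (a - 3 * eps * U x) - lam * p x) by move=> *; bdd_tac.
apply: (bddc_eq (h _ _ _ _ btu btw bu bw)) => x.
by rewrite /f_rb /c_rb /c_b; ring.
Qed.

Lemma bddc_e1 : bddc (fun x : V => c_e1 N (t x) (u x) (w x)).
Proof.
have h (p q U W : V -> R) : bddc p -> bddc q -> bddc U -> bddc W ->
    bddc (fun x : V => (2 * N * (p x * W x) + 2 * (2 * (p x * W x) * (1 - (p x + q x))) - 2 * (p x * W x) * (2 - (p x + q x)) -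
  p x * W x * (8 - 2 * N - 2 * (p x + q x))) * (N - 2)^-1) by move=> *; bdd_tac.
apply: (bddc_eq (h _ _ _ _ btu btw bu bw)) => x.
by rewrite /c_e1 /c_zeta /c_zeta1 /c_om1 /c_c; congr (_ * _); ring.
Qed.

(** The factor u is kept apart because this coefficient multiplies x . G, which is of size |x|^2
    |B|, and |x|^2 u <= 1. *)
Lemma bddc_e2 : exists m : V -> R, bddc m /\ forall x, c_e2 N (t x) (u x) (w x) = u x * m x.
Proof.
have h (p q U W : V -> R) : bddc p -> bddc q -> bddc U -> bddc W ->
    bddc (fun x : V => (2 * (N - 2) * W x - 4 * W x * (1 - (p x + q x))) * (N - 2)^-1) by move=> *; bdd_tac.
exists (fun x => (2 * (N - 2) * w x - 4 * w x * (1 - (t x * u x + t x * w x))) * (N - 2)^-1); split.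
  exact: (h _ _ _ _ btu btw bu bw).
by move=> x; rewrite /c_e2 /c_zeta1 [RHS]mulrA; congr (_ * _); ring.
Qed.

Lemma bddc_e3 : bddc (fun x : V => c_e3 N (t x) (u x) (w x)).
Proof.
have h (p q U W : V -> R) : bddc p -> bddc q -> bddc U -> bddc W ->
    bddc (fun x : V => ((N - 2) * (U x * W x) - (2 * (U x * W x) * (1 - (p x + q x)) * (8 - 2 * N - 2 * (p x + q x)) -
   4 * (p x * W x) * (U x + W x - (p x * U x + q x * W x)))) * (N - 2)^-1) by move=> *; bdd_tac.
apply: (bddc_eq (h _ _ _ _ btu btw bu bw)) => x.
by rewrite /c_e3 /c_c1; congr (_ * _); ring.
Qed.

End CoefBounds.

Section Main.
Variables (a lam eps : R).
Hypothesis eps0 : 0 < eps.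
Local Notation N := (n%:R : R).
Local Notation t := (@sqnorm R n).
Variables (v : 'I_n -> V -> R) (B : 'I_n -> 'I_n -> V -> R) (D : 'I_n -> 'I_n -> 'I_n -> V -> R).
Local Notation vx x := (v ^~ x).
Local Notation Bx x := (fun l i => B l i x).
Hypothesis hv : forall l i, has_pd i (v l) (B l i).
Hypothesis hB : forall l i k, has_pd k (B l i) (D l i k).
Hypothesis Dsym : forall l i k x, D l i k x = D l k i x.
Hypothesis cv : forall l, Ck 1 (v l).
Hypothesis cB : forall l i, Ck 1 (B l i).
Hypothesis lv : forall l, L2c (v l).
Hypothesis lB : forall l i, L2c (B l i).
Hypothesis lx : forall k l, L2c (fun x => x ord0 k * v l x).

(** The factor 1 / (N - 2) undoes that of [matrix_ineq]. The last summand, of weight u b, supplies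
    the cross term v . G of the completed square. *)
Definition core_field k (x : V) :=
  (N - 2)^-1 * (-1 * (f_om eps x * Y1 v B k x) + 2 * (f_zeta eps x * Y4 v B k x)
    + -1 * (f_zeta eps x * Y3 v k x) + f_c eps x * Y2 v k x)
  + f_rb a lam eps x * Y3 v k x.

Let e4 : 0 < eps / 4. Proof. by rewrite divr_gt0. Qed.

Let cx i : Ck 1 (fun x : V => xc x i).
Proof. exact: Ck_coord. Qed.

Let ctau : Ck 1 (tau B).
Proof. by apply: Ck_sum => i _; exact: cB. Qed.

Let cq : Ck 1 (qx v).
Proof. exact: (Ck_vdot cx cv). Qed.

Let cV2 : Ck 1 (V2x v).
Proof. exact: (Ck_vdot cv cv). Qed.

Lemma Ck_core_field k : Ck 1 (core_field k).
Proof.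
have c1 : Ck 1 (Y1 v B k) := CkB (Ck_vdot cv (cB k)) (CkM (cv k) ctau).
have c2 : Ck 1 (Y2 v k) := CkM (cv k) cq.
have c3 : Ck 1 (Y3 v k) := CkM (cx k) cV2.
have c4 : Ck 1 (Y4 v B k) := CkM cq (CkB (Ck_vdot (cB k) cx) (CkM (cx k) ctau)).
have o1 : Ck 1 (f_om eps : V -> R) by rewrite /f_om /c_om; ck_tac.
have o2 : Ck 1 (f_zeta eps : V -> R) by rewrite /f_zeta /c_zeta; ck_tac.
have o3 : Ck 1 (f_c eps : V -> R) by rewrite /f_c /c_c; ck_tac.
have o4 : Ck 1 (f_rb a lam eps : V -> R) by rewrite /f_rb /c_rb /c_b; ck_tac.
by apply: CkD; [apply: CkMl; apply: CkD; [apply: CkD; [apply: CkD|]|]|]; try apply: CkMl; apply: CkM.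
Qed.

Let ltau : L2c (tau B).
Proof. exact: L2c_sum. Qed.

Lemma L2c_qx : L2c (qx v).
Proof. by apply: L2c_sum => l; exact: lx. Qed.

Lemma int_core_field k : mu.-integrable setT (EFin \o core_field k).
Proof.
have i1 : mu.-integrable setT (EFin \o Y1 v B k).
  by apply: intB; [apply: int_sum => i; exact: L2c_mul|exact: L2c_mul].
have i2 : mu.-integrable setT (EFin \o Y2 v k) by apply: L2c_mul => //; exact: L2c_qx.
have i3 : mu.-integrable setT (EFin \o Y3 v k).
  have : mu.-integrable setT (EFin \o (fun x : V => \sum_l (x ord0 k * v l x) * v l x)).
    by apply: int_sum => l; exact: L2c_mul.
  apply: eq_integrable => // x _ /=; congr EFin; rewrite /Y3 /V2x /vdot mulr_sumr.
  by apply: eq_bigr => l _; rewrite mulrA.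
have i4 : mu.-integrable setT (EFin \o (fun x => f_zeta eps x * Y4 v B k x)).
  (* [Y4] contains a factor x beyond the square integrable x . v. The weight [f_zeta] splits as u
     times |x|^2 w: u absorbs this x, and |x|^2 w is bounded. *)
  pose L (x : V) := \sum_i (x ord0 i * uinv eps x) * B k i x + (- 1) * ((x ord0 k * uinv eps x) * tau B x).
  have lL : L2c L.
    apply: L2cD; first by apply: L2c_sum => i; apply: L2c_mulr => //; exact: bddc_coord_uinv.
    apply: L2c_mulr; first exact: bddc_cst.
    by apply: L2c_mulr => //; exact: bddc_coord_uinv.
  have := bddc_mul_int (bddc_sqnorm_uinv n e4) (L2c_mul L2c_qx lL).
  apply: eq_integrable => // x _ /=; congr EFin.
  have -> : L x = uinv eps x * (Gx B x k - xc x k * tau B x).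
    rewrite mulrBr /L; congr (_ + _); last by rewrite /xc; ring.
    by rewrite /Gx /mulv mulr_sumr; apply: eq_bigr => i _; rewrite /xc; ring.
  by rewrite /f_zeta /c_zeta /Y4; ring.
apply: intD; last by apply: bddc_mul_int => //; exact: bddc_rb.
apply: intZ; apply: intD; last by apply: bddc_mul_int => //; exact: bddc_c.
apply: intD; last by apply: intZ; apply: bddc_mul_int => //; exact: bddc_zeta.
apply: intD; last exact: intZ.
by apply: intZ; apply: bddc_mul_int => //; exact: bddc_om.
Qed.

Lemma div_core_field x : \sum_k pd k (core_field k) x =
  (N - 2)^-1 * (- (f_om1 eps x * (vdot (vx x) (Hx B x) - qx v x * tau B x)
      + f_om eps x * (mdot (Bx x) (trm (Bx x)) - tau B x ^+ 2))
    + 2 * (f_zeta1 eps x * (qx v x * (vdot (xc x) (Gx B x) - t x * tau B x))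
      + f_zeta eps x * (vdot (Hx B x) (Gx B x) + vdot (vx x) (Gx B x)
         - tau B x * (vdot (xc x) (Gx B x) + qx v x) + qx v x * (1 - N) * tau B x))
    - (f_zeta1 eps x * (t x * V2x v x) + f_zeta eps x * (N * V2x v x + 2 * vdot (vx x) (Gx B x)))
    + (f_c1 eps x * qx v x ^+ 2 + f_c eps x * (tau B x * qx v x + vdot (vx x) (Hx B x) + V2x v x)))
  + (f_rb1 a lam eps x * (t x * V2x v x) + f_rb a lam eps x * (N * V2x v x + 2 * vdot (vx x) (Gx B x))).
Proof.
have [dY1 [h1 s1]] := div_Y1 hv hB Dsym; have [dY2 [h2 s2]] := div_Y2 hv.
have [dY3 [h3 s3]] := div_Y3 hv; have [dY4 [h4 s4]] := div_Y4 hv hB Dsym.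
have [d1 [p1 q1]] := div_radial (@radial_om R n _ eps0) h1.
have [d2 [p2 q2]] := div_radial (@radial_c R n _ eps0) h2.
have [d3 [p3 q3]] := div_radial (@radial_zeta R n _ eps0) h3.
have [d4 [p4 q4]] := div_radial (@radial_zeta R n _ eps0) h4.
have [d5 [p5 q5]] := div_radial (@radial_rb R n a lam _ eps0) h3.
have hd k : has_pd k (core_field k) (fun x => (N - 2)^-1 * (-1 * d1 k x + 2 * d4 k x + -1 * d3 k x + d2 k x) + d5 k x).
  have hc c (f df : V -> R) : has_pd k f df -> has_pd k (fun x => c * f x) (fun x => c * df x).
    move=> hf; apply: has_pd_eq (has_pdM (has_pd_cst k c) hf) _ _ => // y /=.
    by rewrite mulr0 addr0.
  exact: (has_pdD (hc _ _ _ (has_pdD (has_pdD (has_pdD (hc _ _ _ (p1 k)) (hc _ _ _ (p4 k)))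
    (hc _ _ _ (p3 k))) (p2 k))) (p5 k)).
under eq_bigr do rewrite (has_pdE (hd _)).
rewrite big_split /= -mulr_sumr !big_split /= -!mulr_sumr q1 q2 q3 q4 q5 s1 s2 s3 s4.
by rewrite xc_Y1 xc_Y2 xc_Y3 xc_Y4; ring.
Qed.

Definition B2x x := mdot (Bx x) (Bx x).

Lemma int_V2x : mu.-integrable setT (EFin \o V2x v).
Proof. by apply: int_sum => l; exact: L2c_mul. Qed.

Lemma int_B2x : mu.-integrable setT (EFin \o B2x).
Proof. by apply: int_sum => l; apply: int_sum => i; exact: L2c_mul. Qed.

Lemma int_tV2x : mu.-integrable setT (EFin \o (fun x => t x * V2x v x)).
Proof.
have : mu.-integrable setT (EFin \o (fun x : V => \sum_k \sum_l (x ord0 k * v l x) * (x ord0 k * v l x))).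
  by apply: int_sum => k; apply: int_sum => l; exact: L2c_mul.
apply: eq_integrable => // x _ /=; congr EFin; rewrite -vdot_xc /V2x {1}/vdot mulr_suml.
apply: eq_bigr => k _; rewrite mulr_sumr; apply: eq_bigr => l _; rewrite /xc; ring.
Qed.

Lemma int_qx2 : mu.-integrable setT (EFin \o (fun x => qx v x ^+ 2)).
Proof. exact: L2c_qx.2. Qed.

(** Young's inequality on the error terms: those with tau and with x . G cost delta / 2 of |B|^2
    each, by (tr B)^2 <= N |B|^2 and (x . G)^2 <= |x|^4 |B|^2, and the rest goes into (x . v)^2. *)
Lemma core_field_le delta K1 K2 K3 (m2 : V -> R) x : (3 <= n)%N -> 0 <= a -> a * (a + N - 2) = 2 ->
  1 <= 4 * a + 3 * N - 12 -> 0 < lam -> 0 < delta ->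
  eps * (lam ^+ 2 * (N + 2 * a + 4) ^+ 2 / 2) <= delta ->
  `|c_e1 N (t x) (uinv eps x) (uinv (eps / 4) x)| <= K1 ->
  c_e2 N (t x) (uinv eps x) (uinv (eps / 4) x) = uinv eps x * m2 x -> `|m2 x| <= K2 ->
  `|c_e3 N (t x) (uinv eps x) (uinv (eps / 4) x)| <= K3 ->
  \sum_k pd k (core_field k) x <= (1 + delta) * B2x x + lam ^+ 2 * (t x * V2x v x)
   - (lam * (N + 2 * a) - delta) * V2x v x + (N * K1 ^+ 2 / (2 * delta) + K2 ^+ 2 / (2 * delta) + K3) * qx v x ^+ 2.
Proof.
move=> n3 a0 ha h4 lam0 d0 he hK1 he2 hK2 hK3.
have N3 : 3 <= N by rewrite ler_nat.
set U := uinv eps x in hK1 he2 hK2 hK3; set W := uinv (eps / 4) x in hK1 he2 hK2 hK3.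
have U0 : 0 < U := uinv_gt0 x eps0.
have V0 : 0 <= V2x v x := vdot_ge0 _.
have B0 : 0 <= B2x x := mdot_ge0 _.
have t0 := sqnorm_ge0 x.
have hU : (t x + eps) * U = 1 := uinv_eq x eps0.
have hW : (t x + eps / 4) * W = 1 := uinv_eq x e4.
have hyps : core_hyps N a lam eps (t x) U W by [].
have tr (y : 'I_n -> R) : vdot y y * sqnorm x = vdot y y * vdot (xc x) (xc x) by rewrite vdot_xc.
have G2 : vdot (Gx B x) (Gx B x) <= t x * B2x x.
  rewrite mulrC /B2x mdotE mulr_suml; apply: ler_sum => l _; rewrite -expr2 -vdot_xc.
  exact: vdot_cauchy.
have k2 : vdot (xc x) (Gx B x) ^+ 2 <= t x ^+ 2 * B2x x.
  apply: le_trans (vdot_cauchy _ _) _; rewrite vdot_xc expr2 -mulrA.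
  by rewrite ler_wpM2l.
have tau2 : tau B x ^+ 2 <= N * B2x x.
  have := vdot_cauchy (fun=> 1) (fun i => B i i x).
  have -> : vdot (fun=> 1) (fun i => B i i x) = tau B x by apply: eq_bigr => i _; rewrite mul1r.
  have -> : vdot (fun _ : 'I_n => 1) (fun=> 1) = N :> R.
    by rewrite /vdot (eq_bigr (fun=> 1)) => [|i _]; rewrite ?sumr_const ?card_ord // mulr1.
  move/le_trans; apply; rewrite ler_wpM2l //; apply: ler_sum => i _.
  rewrite (bigD1 i) //= lerDl; apply: sumr_ge0 => j _; rewrite -expr2; exact: sqr_ge0.
have i1 := matrix_ineq (xc x) (Bx x) n3.
have i2 : (vdot (xc x) (Gx B x) + qx v x) ^+ 2 <= t x * (vdot (Hx B x) (Hx B x) + 2 * vdot (vx x) (Hx B x) + V2x v x).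
  have := vdot_cauchy (xc x) (fun i => 1 * Hx B x i + 1 * v i x).
  have -> : vdot (xc x) (fun i => 1 * Hx B x i + 1 * v i x) = vdot (xc x) (Gx B x) + qx v x.
    by rewrite vdotC vdot_lin !mul1r vdot_mulv; congr (_ + _); rewrite vdotC.
  move=> /le_trans; apply; rewrite vdot_xc ler_wpM2l // vdot_sqr [vdot (Hx B x) (vx x)]vdotC /V2x.
  by lra.
have i4 : 0 <= vdot (Gx B x) (Gx B x) - 2 * c_b a lam eps (t x) U * vdot (vx x) (Gx B x) + c_b a lam eps (t x) U ^+ 2 * V2x v x.
  have := vdot_ge0 (fun i => 1 * Gx B x i + (- c_b a lam eps (t x) U) * v i x).
  rewrite vdot_sqr [vdot (Gx B x) (vx x)]vdotC /V2x => h.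
  by apply: le_trans h _; lra.
rewrite div_core_field.
apply: le_trans (scalar_core (T2 := mdot (Bx x) (trm (Bx x))) (HG := vdot (Hx B x) (Gx B x)) (H2 := vdot (Hx B x) (Hx B x))
  hyps _ i2 G2 B0 V0 i4) _.
  by move: i1; rewrite vdot_xc.
rewrite -/U -/W he2.
set Q := qx v x; set T := tau B x; set k := vdot (xc x) (Gx B x) in k2 *.
set e1 := c_e1 _ _ _ _ in hK1 *; set e3 := c_e3 _ _ _ _ in hK3 *; set m := m2 x in hK2 *.
have N0 : 0 < N by lra.
have sK (e K : R) : `|e| <= K -> e ^+ 2 <= K ^+ 2.
  by move=> h; rewrite -real_normK ?num_real // lerXn2r // nnegrE (le_trans _ h).
have b1 : - (e1 * (Q * T)) <= delta / 2 * B2x x + N * K1 ^+ 2 / (2 * delta) * Q ^+ 2.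
  have h : 0 <= (2 * N * delta)^-1 * (delta * T + N * e1 * Q) ^+ 2 by rewrite mulr_ge0 ?sqr_ge0 ?invr_ge0 ?mulr_ge0 // ltW.
  have hh : (2 * N * delta)^-1 * (delta * T + N * e1 * Q) ^+ 2 = delta / (2 * N) * T ^+ 2 + e1 * (Q * T) + N / (2 * delta) * (e1 ^+ 2 * Q ^+ 2).
    by field; rewrite !gt_eqF.
  have h1 : delta / (2 * N) * T ^+ 2 <= delta / 2 * B2x x.
    have -> : delta / 2 * B2x x = delta / (2 * N) * (N * B2x x) by field; rewrite gt_eqF.
    by rewrite ler_wpM2l // divr_ge0 ?mulr_ge0 // ltW.
  have h2 : N / (2 * delta) * (e1 ^+ 2 * Q ^+ 2) <= N * K1 ^+ 2 / (2 * delta) * Q ^+ 2.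
    have -> : N * K1 ^+ 2 / (2 * delta) * Q ^+ 2 = N / (2 * delta) * (K1 ^+ 2 * Q ^+ 2) by ring.
    by rewrite ler_wpM2l ?divr_ge0 ?mulr_ge0 ?(ltW d0) // ler_wpM2r ?sqr_ge0 // sK.
  by rewrite hh in h; lra.
have b2 : - (U * m * (Q * k)) <= delta / 2 * B2x x + K2 ^+ 2 / (2 * delta) * Q ^+ 2.
  have h : 0 <= (2 * delta)^-1 * (delta * (U * k) + m * Q) ^+ 2 by rewrite mulr_ge0 ?sqr_ge0 ?invr_ge0 ?mulr_ge0 // ltW.
  have hh : (2 * delta)^-1 * (delta * (U * k) + m * Q) ^+ 2 = delta / 2 * (U ^+ 2 * k ^+ 2) + U * m * (Q * k) + (2 * delta)^-1 * (m ^+ 2 * Q ^+ 2).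
    by field; rewrite gt_eqF.
  have h1 : delta / 2 * (U ^+ 2 * k ^+ 2) <= delta / 2 * B2x x.
    rewrite ler_wpM2l ?divr_ge0 ?(ltW d0) //; apply: le_trans (ler_wpM2l (sqr_ge0 U) k2) _.
    rewrite mulrA -exprMn mulrC ler_piMr // exprn_ile1 // mulrC ?mulr_ge0 ?(ltW U0) //.
    by rewrite -hU mulrDl lerDl mulr_ge0 // ltW.
  have h2 : (2 * delta)^-1 * (m ^+ 2 * Q ^+ 2) <= K2 ^+ 2 / (2 * delta) * Q ^+ 2.
    have -> : K2 ^+ 2 / (2 * delta) * Q ^+ 2 = (2 * delta)^-1 * (K2 ^+ 2 * Q ^+ 2) by ring.
    by rewrite ler_wpM2l ?invr_ge0 ?mulr_ge0 ?(ltW d0) // ler_wpM2r ?sqr_ge0 // sK.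
  by rewrite hh in h; lra.
have b3 : - (e3 * Q ^+ 2) <= K3 * Q ^+ 2.
  rewrite -mulNr ler_wpM2r ?sqr_ge0 //; apply: le_trans hK3.
  by rewrite -normrN ler_norm.
have b4 := ler_wpM2r V0 he.
clear i1 i2 i4 G2 k2 tau2 hyps hU hW he2 sK.
move: b1 b2 b3 b4; set Z1 := N * K1 ^+ 2 / _; set Z2 := K2 ^+ 2 / _ => b1 b2 b3 b4.
by lra.
Qed.

End Main.

(** [K] is fixed before the field; this uniformity permits a limit along fields whose x . v tends to
    0 in L^2. *)
Lemma core_inequality (a lam delta : R) : (3 <= n)%N -> 0 <= a -> a * (a + n%:R - 2) = 2 ->
  1 <= 4 * a + 3 * n%:R - 12 -> 0 < lam -> 0 < delta ->
  exists K, forall (v : 'I_n -> V -> R) (B : 'I_n -> 'I_n -> V -> R) (D : 'I_n -> 'I_n -> 'I_n -> V -> R),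
  (forall l i, has_pd i (v l) (B l i)) -> (forall l i k, has_pd k (B l i) (D l i k)) ->
  (forall l i k x, D l i k x = D l k i x) -> (forall l, Ck 1 (v l)) -> (forall l i, Ck 1 (B l i)) ->
  (forall l, L2c (v l)) -> (forall l i, L2c (B l i)) -> (forall k l, L2c (fun x => x ord0 k * v l x)) ->
  (lam * (n%:R + 2 * a) - delta) * \int[mu]_x V2x v x <=
  (1 + delta) * \int[mu]_x B2x B x + lam ^+ 2 * \int[mu]_x (sqnorm x * V2x v x) + K * \int[mu]_x qx v x ^+ 2.
Proof.
move=> n3 a0 ha h4 lam0 d0.
(* The constant in the loss of [radial_coef_ge]; with eps = delta / M the regularization costs
   delta. *)
pose M := lam ^+ 2 * (n%:R + 2 * a + 4) ^+ 2 / 2.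
have M0 : 0 < M by rewrite divr_gt0 // mulr_gt0 // exprn_gt0 // ltr_wpDl // addr_ge0 ?mulr_ge0.
pose eps := delta / M; have eps0 : 0 < eps by rewrite divr_gt0.
have he : eps * M <= delta by rewrite /eps divfK ?gt_eqF.
have [_ [K1 hK1]] := @bddc_e1 eps eps0.
have [m2 [[_ [K2 hK2]] he2]] := @bddc_e2 eps eps0.
have [_ [K3 hK3]] := @bddc_e3 eps eps0.
exists (n%:R * K1 ^+ 2 / (2 * delta) + K2 ^+ 2 / (2 * delta) + K3).
move=> v B D hv hB Ds cv cB lv lB lx.
have iV := int_V2x lv; have iB := int_B2x lB; have itV := int_tV2x lx; have iq := int_qx2 lx.
set K := _ + K3.
have i1 := intZ (1 + delta) iB; have i2 := intZ (lam ^+ 2) itV.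
have i3 := intZ (lam * (n%:R + 2 * a) - delta) iV; have i4 := intZ K iq.
have iD := intD (intB (intD i1 i2) i3) i4.
have := @integral_div_le R n (core_field a lam eps v B) _ (Ck_core_field a lam eps0 cv cB) _ iD _.
rewrite (RintegralD measurableT (intB (intD i1 i2) i3) i4) (RintegralB measurableT (intD i1 i2) i3).
rewrite (RintegralD measurableT i1 i2) (RintegralZl _ measurableT iV) (RintegralZl _ measurableT iB).
rewrite (RintegralZl _ measurableT itV) (RintegralZl _ measurableT iq) => h.
rewrite -subr_ge0; apply: le_trans (h _ _) _.
- move=> k; apply: int_jap; first exact: Ck_continuous (Ck_core_field a lam eps0 cv cB k).
  exact: int_core_field.
- by move=> x; exact: core_field_le.
- by rewrite le_eqVlt; apply/orP; left; apply/eqP; ring.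
Qed.

End CoreInequality.

(** * Transfer of the inequality to test fields *)

Section HartleyCore.
Context (R : realType) (n : nat).
Local Notation V := 'rV[R]_n.
Local Notation mu := (lebN R n).

Lemma Rint_sum (I : Type) (r : seq I) (f : I -> V -> R) :
  (forall i, mu.-integrable setT (EFin \o f i)) ->
  \int[mu]_x (\sum_(i <- r) f i x) = \sum_(i <- r) \int[mu]_x f i x.
Proof.
move=> h; elim: r => [|i r IHr].
  rewrite big_nil; under eq_Rintegral do rewrite big_nil.
  by rewrite Rintegral_cst // mul0r.
rewrite big_cons -IHr; under eq_Rintegral do rewrite big_cons.
by rewrite (RintegralD measurableT (h i) (int_sum r h)).
Qed.

Definition nrm2 (I : finType) (f : I -> V -> R) : R := \sum_i \int[mu]_x f i x ^+ 2.

Lemma hartley_sum s (I : Type) (r : seq I) (f : I -> V -> R) xi : s ^+ 2 = 1 ->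
  (forall i, Cc 0 (f i)) -> hartley s (fun x => \sum_(i <- r) f i x) xi = \sum_(i <- r) hartley s (f i) xi.
Proof.
move=> s2 cf; rewrite /hartley -Rint_sum => [|i]; last exact: hartley_integrable.
by apply: eq_Rintegral => x _; rewrite mulr_suml.
Qed.

(** Moments and gradients change places under the transform, hence the position of lam^2. By
    Plancherel every norm acquires the factor (2 pi)^n, which cancels. *)
Lemma hartley_core_inequality (a lam delta : R) : (3 <= n)%N -> 0 <= a -> a * (a + n%:R - 2) = 2 ->
  1 <= 4 * a + 3 * n%:R - 12 -> 0 < lam -> 0 < delta ->
  exists K, forall phi : 'I_n -> V -> R, (forall l, Cc 1 (phi l)) ->
  (lam * (n%:R + 2 * a) - delta) * nrm2 phi <=
  (1 + delta) * nrm2 (fun p : 'I_n * 'I_n => fun x => x ord0 p.2 * phi p.1 x)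
  + lam ^+ 2 * nrm2 (fun p : 'I_n * 'I_n => pd p.2 (phi p.1))
  + K * \int[mu]_x (\sum_l pd l (phi l) x) ^+ 2.
Proof.
move=> n3 a0 ha h4 lam0 d0; have [K hK] := core_inequality n3 a0 ha h4 lam0 d0.
exists K => phi cphi; have one : (1 : R) ^+ 2 = 1 by rewrite expr1n.
have mone : (-1 : R) ^+ 2 = 1 by rewrite sqrrN expr1n.
have c0 l : Cc 0 (phi l) := Cc0 (cphi l).
have cX l i : Cc 0 (fun x => x ord0 i * phi l x) := Cc_coordM i (c0 l).
have cXX l i k : Cc 0 (fun x => x ord0 k * (x ord0 i * phi l x)) := Cc_coordM k (cX l i).
have cd l k : Cc 0 (pd k (phi l)) := CcS_pd k (cphi l).
(* Each derivative flips the sign of the kernel. Second derivatives are transforms of x_k x_i phi,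
   which makes their symmetry evident. *)
pose v l := hartley 1 (phi l); pose B l i := hartley (-1) (fun x => x ord0 i * phi l x).
pose D l i k xi := - hartley 1 (fun x => x ord0 k * (x ord0 i * phi l x)) xi.
have xv k l (xi : V) : xi ord0 k * v l xi = hartley (-1) (pd k (phi l)) xi.
  by rewrite (hartley_pd _ _ mone (cphi l)) opprK mulN1r mulNr opprK.
have L2H (s : R) (f : V -> R) : s ^+ 2 = 1 -> Cc 0 f -> L2c (hartley s f).
  by move=> s2 cf; split; [exact: continuous_hartley|exact: (plancherel s2 cf).1].
have hv l i : has_pd i (v l) (B l i).
  by apply: has_pd_eq (has_pd_hartley i one (c0 l)) _ _ => // xi; rewrite mul1r.
have hB l i k : has_pd k (B l i) (D l i k).
  apply: has_pd_eq (has_pd_hartley k mone (cX l i)) _ _ => // xi.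
  by rewrite opprK mulN1r.
have lx k l : L2c (fun xi : V => xi ord0 k * v l xi).
  by under eq_fun do rewrite xv; exact: L2H.
have := hK v B D hv hB _ (fun l => Ck_hartley 1 one (c0 l)) (fun l i => Ck_hartley 1 mone (cX l i))
  (fun l => L2H _ _ one (c0 l)) (fun l i => L2H _ _ mone (cX l i)) lx.
have -> : \int[mu]_x V2x v x = (2 * pi) ^+ n * nrm2 phi.
  rewrite /V2x /vdot Rint_sum => [|l]; last exact: L2c_mul (L2H _ _ one (c0 l)) (L2H _ _ one (c0 l)).
  rewrite /nrm2 mulr_sumr; apply: eq_bigr => l _.
  by rewrite -(plancherel one (c0 l)).2; apply: eq_Rintegral => x _; rewrite expr2.
have -> : \int[mu]_x B2x B x = (2 * pi) ^+ n * nrm2 (fun p : 'I_n * 'I_n => fun x => x ord0 p.2 * phi p.1 x).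
  rewrite /B2x /mdot Rint_sum => [|l]; last first.
    by apply: int_sum => i; exact: L2c_mul (L2H _ _ mone (cX l i)) (L2H _ _ mone (cX l i)).
  transitivity (\sum_l \sum_i \int[mu]_x (B l i x * B l i x)).
    by apply: eq_bigr => l _; rewrite Rint_sum // => i; exact: L2c_mul (L2H _ _ mone (cX l i)) (L2H _ _ mone (cX l i)).
  rewrite pair_bigA /nrm2 mulr_sumr; apply: eq_bigr => p _ /=.
  by rewrite -(plancherel mone (cX p.1 p.2)).2; apply: eq_Rintegral => x _; rewrite expr2.
have -> : \int[mu]_x (sqnorm x * V2x v x) = (2 * pi) ^+ n * nrm2 (fun p : 'I_n * 'I_n => pd p.2 (phi p.1)).
  have i1 l k : mu.-integrable setT (EFin \o (fun x : V => (x ord0 k * v l x) ^+ 2)) := (lx k l).2.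
  transitivity (\int[mu]_x (\sum_l \sum_k (x ord0 k * v l x) ^+ 2)).
    apply: eq_Rintegral => x _; rewrite mulrC /V2x {1}/vdot mulr_suml; apply: eq_bigr => l _.
    by rewrite /sqnorm mulr_sumr; apply: eq_bigr => k _; ring.
  rewrite Rint_sum => [|l]; last by apply: int_sum => k.
  transitivity (\sum_l \sum_k \int[mu]_x (x ord0 k * v l x) ^+ 2).
    by apply: eq_bigr => l _; rewrite Rint_sum.
  rewrite pair_bigA /nrm2 mulr_sumr; apply: eq_bigr => p _ /=.
  by rewrite -(plancherel mone (cd p.1 p.2)).2; apply: eq_Rintegral => x _; rewrite xv.
have -> : \int[mu]_x qx v x ^+ 2 = (2 * pi) ^+ n * \int[mu]_x (\sum_l pd l (phi l) x) ^+ 2.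
  have cs : Cc 0 (fun x => \sum_l pd l (phi l) x) by apply: Cc_sum => l.
  rewrite -(plancherel mone cs).2; apply: eq_Rintegral => x _; congr (_ ^+ 2).
  by rewrite hartley_sum // /qx /vdot; apply: eq_bigr => l _; rewrite /xc xv.
have p0 : 0 < (2 * pi : R) ^+ n by rewrite exprn_gt0 // mulr_gt0 // pi_gt0.
rewrite !(mulrCA _ ((2 * pi) ^+ n)) -!mulrDr ler_pM2l //; apply.
by move=> l i k x; rewrite /D; congr (- hartley 1 _ _); apply/funext => y; ring.
Qed.

End HartleyCore.

(** Replaces the passages to the limit of the approximation argument, where the bounds are kept
    affine in the small parameter. *)
Lemma le_eps_linear (R : realFieldType) (A B C c : R) : 0 < c ->
  (forall e, 0 < e -> e <= c -> A <= B + C * e) -> A <= B.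
Proof.
move=> c0 h; rewrite leNgt; apply/negP => BA.
have C1 : 0 < `|C| + 1 by rewrite ltr_wpDl.
pose e := Num.min c ((A - B) / (2 * (`|C| + 1))).
have e0 : 0 < e by rewrite lt_min c0 /= divr_gt0 ?subr_gt0 // mulr_gt0.
have ec : e <= c by rewrite ge_min lexx.
have := h e e0 ec; apply/negP; rewrite -ltNge.
have h1 : C * e <= (A - B) / 2.
  apply: (@le_trans _ _ ((`|C| + 1) * e)).
    by rewrite ler_wpM2r ?(ltW e0) // (le_trans (ler_norm _)) // lerDl.
  rewrite mulrC -ler_pdivlMr // -mulrA -invfM ge_min; apply/orP; right.
  by rewrite lexx.
have : (A - B) / 2 < A - B by rewrite ltr_pdivrMr // ltr_pMr ?subr_gt0 // ltr1n.
by move=> h2; rewrite -ltrBrDl; apply: le_lt_trans h1 h2.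
Qed.

Lemma discriminant_le (R : realFieldType) (m M E L : R) : 0 < L -> 0 <= m -> 0 <= M -> 0 <= E ->
  (forall lam, 0 < lam -> lam * L * m <= M + lam ^+ 2 * E) -> L ^+ 2 / 4 * m ^+ 2 <= E * M.
Proof.
move=> L0; rewrite le_eqVlt => /predU1P[<- M0 E0 _|m0 M0].
  by rewrite expr0n mulr0 mulr_ge0.
rewrite le_eqVlt => /predU1P[<-|E0] h.
  (* For E = 0 this lam would give M + 1 <= M. *)
  have := h ((M + 1) / (L * m)); rewrite mulr0 addr0 divr_gt0 ?mulr_gt0 //; last by rewrite ltr_wpDl.
  by rewrite -mulrA divfK ?gt_eqF ?mulr_gt0 // => /(_ isT); rewrite gerDl ler10.
(* The minimum of lam^2 E - lam L m + M. *)
have := h (L * m / (2 * E)); rewrite divr_gt0 ?mulr_gt0 // => /(_ isT).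
have -> : L * m / (2 * E) * L * m = 2 * ((L ^+ 2 / 4 * m ^+ 2) / E) by field; rewrite gt_eqF.
have -> : (L * m / (2 * E)) ^+ 2 * E = (L ^+ 2 / 4 * m ^+ 2) / E by field; rewrite gt_eqF.
by rewrite mulr_natl mulr2n lerD2r ler_pdivrMr // [M * E]mulrC.
Qed.

(** * Approximation by test fields *)

Section L2Measurable.
Context (R : realType) (n : nat).
Local Notation V := 'rV[R]_n.
Local Notation mu := (lebN R n).
Implicit Types f g : V -> R.

Definition L2m f := measurable_fun setT f /\ mu.-integrable setT (EFin \o (fun x => f x ^+ 2)).

Lemma L2m_mul f g : L2m f -> L2m g -> mu.-integrable setT (EFin \o (fun x => f x * g x)).
Proof.
move=> [mf sf] [mg sg].
have := intD sf sg; apply: le_integrable => //.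
  by apply/measurable_EFinP; exact: measurable_funM.
move=> x _ /=; rewrite lee_fin [leRHS]ger0_norm ?addr_ge0 ?sqr_ge0 //.
rewrite normrM -(real_normK (num_real (f x))) -(real_normK (num_real (g x))).
have := sqr_ge0 (`|f x| - `|g x|); have := normr_ge0 (f x); have := normr_ge0 (g x).
by set F := `|f x|; set G := `|g x|; nra.
Qed.

Lemma L2mD f g : L2m f -> L2m g -> L2m (fun x => f x + g x).
Proof.
move=> lf lg; split; first exact: measurable_funD lf.1 lg.1.
have := intD (intD lf.2 lg.2) (intZ 2 (L2m_mul lf lg)).
by apply: eq_integrable => // x _ /=; congr EFin; ring.
Qed.

Lemma L2mZ c f : L2m f -> L2m (fun x => c * f x).
Proof.
move=> [mf sf]; split; first exact: measurable_funM.
have := intZ (c ^+ 2) sf.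
by apply: eq_integrable => // x _ /=; congr EFin; ring.
Qed.

Lemma L2mB f g : L2m f -> L2m g -> L2m (fun x => f x - g x).
Proof.
move=> lf /(L2mZ (-1)) lg; have := L2mD lf lg.
by under eq_fun do rewrite mulN1r.
Qed.

Lemma Cc_L2m m f : Cc m f -> L2m f.
Proof.
move=> cf; split; first exact: continuous_measurable_mx (Ck_continuous cf.1).
have := Cc_int (Cc_mulr (Cc0 cf) (Cc0 cf).1).
by apply: eq_integrable => // x _ /=; rewrite expr2.
Qed.

Lemma nrm2_ge0 (I : finType) (f : I -> V -> R) : 0 <= nrm2 f.
Proof. by apply: sumr_ge0 => i _; apply: Rintegral_ge0 => x _; exact: sqr_ge0. Qed.

(** A triangle inequality for squared norms whose leading factor is as close to 1 as desired; it
    keeps the estimates free of square roots. *)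
Lemma nrm2_le (I : finType) (f g : I -> V -> R) (k : R) : 0 < k -> (forall i, L2m (f i)) ->
  (forall i, L2m (g i)) ->
  nrm2 f <= (1 + k) * nrm2 g + (1 + k^-1) * nrm2 (fun i x => f i x - g i x).
Proof.
move=> k0 lf lg; rewrite /nrm2 !mulr_sumr -big_split; apply: ler_sum => i _ /=.
have lfg := L2mB (lf i) (lg i).
rewrite -(RintegralZl _ measurableT (lg i).2) -(RintegralZl _ measurableT lfg.2).
have i1 := intZ (1 + k) (lg i).2; have i2 := intZ (1 + k^-1) lfg.2.
rewrite -(RintegralD measurableT i1 i2).
apply: le_Rintegral => //; first exact: (lf i).2; first exact: intD.
move=> x _; set F := f i x; set G := g i x.
have -> : (1 + k) * G ^+ 2 + (1 + k^-1) * (F - G) ^+ 2 = F ^+ 2 + k^-1 * (k * G - (F - G)) ^+ 2.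
  by field; rewrite gt_eqF.
by rewrite lerDl mulr_ge0 ?sqr_ge0 // invr_ge0 ltW.
Qed.

Lemma dot_int_le (I : finType) (f g : I -> V -> R) (k : R) : 0 < k -> (forall i, L2m (f i)) ->
  (forall i, L2m (g i)) ->
  2 * \int[mu]_x (\sum_i f i x * g i x) <= k^-1 * nrm2 f + k * nrm2 g.
Proof.
move=> k0 lf lg; rewrite (Rint_sum _ (fun i => L2m_mul (lf i) (lg i))).
rewrite /nrm2 !mulr_sumr -big_split; apply: ler_sum => i _ /=.
rewrite -(RintegralZl _ measurableT (lg i).2) -(RintegralZl _ measurableT (lf i).2).
rewrite -(RintegralZl _ measurableT (L2m_mul (lf i) (lg i))).
have i1 := intZ k (lg i).2; have i2 := intZ k^-1 (lf i).2.
rewrite -(RintegralD measurableT i2 i1).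
apply: le_Rintegral => //; [exact: intZ (L2m_mul (lf i) (lg i))|exact: intD|].
move=> x _; set F := f i x; set G := g i x.
have -> : k^-1 * F ^+ 2 + k * G ^+ 2 = 2 * (F * G) + k^-1 * (F - k * G) ^+ 2.
  by field; rewrite gt_eqF.
by rewrite lerDl mulr_ge0 ?sqr_ge0 // invr_ge0 ltW.
Qed.

End L2Measurable.

Section WeakSolenoidal.
Context (R : realType) (n : nat).
Local Notation V := 'rV[R]_n.
Local Notation mu := (lebN R n).
Variables (u : 'I_n -> V -> R) (G : 'I_n -> 'I_n -> V -> R).

Definition near_field (e : R) (phi : 'I_n -> V -> R) :=
  [/\ forall m l, Cc m (phi l),
      nrm2 (fun l x => phi l x - u l x) <= e,
      nrm2 (fun p : 'I_n * 'I_n => fun x => x ord0 p.2 * phi p.1 x - x ord0 p.2 * u p.1 x) <= e &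
      nrm2 (fun p : 'I_n * 'I_n => fun x => pd p.2 (phi p.1) x - G p.1 p.2 x) <= e].

Hypothesis lu : forall l, L2m (u l).
Hypothesis lxu : forall l k, L2m (fun x => x ord0 k * u l x).
Hypothesis lG : forall l k, L2m (G l k).
Hypothesis approx : forall e, 0 < e -> exists phi, near_field e phi.
Hypothesis sol : forall psi, (forall m, Cc m psi) -> \int[mu]_x (\sum_l u l x * pd l psi x) = 0.

Definition divf (phi : 'I_n -> V -> R) (x : V) := \sum_l pd l (phi l) x.

Lemma Cc_divf phi m : (forall m l, Cc m (phi l)) -> Cc m (divf phi).
Proof. by move=> cf; apply: Cc_sum => l; exact: CcS_pd. Qed.

Lemma nrm2_pairB (f g : 'I_n -> 'I_n -> V -> R) :
  nrm2 (fun p : 'I_n * 'I_n => fun x => f p.1 p.2 x - g p.1 p.2 x) =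
  \sum_l \sum_k \int[mu]_x (f l k x - g l k x) ^+ 2.
Proof. by rewrite pair_bigA. Qed.

(* Weak solenoidality gives int (div phi) (div phi') = - int (phi' - u) . grad div phi,
   which tends to 0 as phi' tends to u. *)
Lemma div_le_dist phi e : (forall m l, Cc m (phi l)) ->
  nrm2 (fun p : 'I_n * 'I_n => fun x => pd p.2 (phi p.1) x - G p.1 p.2 x) <= e ->
  \int[mu]_x (divf phi x) ^+ 2 <= 2 * n%:R * e.
Proof.
move=> cphi he; pose D := divf phi; have cD m : Cc m D by exact: Cc_divf.
have lD : L2m D := Cc_L2m (cD 0).
have lpd (psi : 'I_n -> V -> R) (l k : 'I_n) : (forall m l, Cc m (psi l)) -> L2m (pd k (psi l)).
  by move=> cpsi; apply: (Cc_L2m (m := 0)); exact: CcS_pd.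
have ldD l : L2m (pd l D) by apply: (Cc_L2m (m := 0)); exact: CcS_pd.
apply: (@le_eps_linear _ _ _ (1 + nrm2 (fun l => pd l D) + 2 * n%:R) 1) => // tau tau0 tau1.
(* The accuracy tau^2 lets Young's inequality with parameter tau leave an error of order tau in
   [s3]. *)
have [phi' [cphi' h1 _ h3]] := approx (exprn_gt0 2 tau0).
pose D' := divf phi'; have lD' : L2m D' := Cc_L2m (Cc_divf 0 cphi').
have lDD := L2mB lD lD'.
have s1 : \int[mu]_x D x ^+ 2 <= \int[mu]_x (D x - D' x) ^+ 2 + 2 * \int[mu]_x (D x * D' x).
  have i2 := intZ 2 (L2m_mul lD lD').
  rewrite -(RintegralZl _ measurableT (L2m_mul lD lD')) -(RintegralD measurableT lDD.2 i2).
  apply: le_Rintegral => //; [exact: lD.2|exact: intD lDD.2 i2|move=> x _].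
  by rewrite -subr_ge0 (_ : _ - _ = D' x ^+ 2) ?sqr_ge0 //; ring.
(* Both divergences are compared with the trace of [G], which cancels in D - D'. *)
have s2 : \int[mu]_x (D x - D' x) ^+ 2 <= 2 * n%:R * (e + tau ^+ 2).
  pose f l x := pd l (phi l) x - G l l x; pose g l x := pd l (phi' l) x - G l l x.
  have lf l : L2m (f l) by apply: L2mB => //; exact: lpd.
  have lg l : L2m (g l) by apply: L2mB => //; exact: lpd.
  have if2 : mu.-integrable setT (EFin \o (fun x => \sum_l f l x ^+ 2)) by apply: int_sum => l; exact: (lf l).2.
  have ig2 : mu.-integrable setT (EFin \o (fun x => \sum_l g l x ^+ 2)) by apply: int_sum => l; exact: (lg l).2.
  apply: (@le_trans _ _ (\int[mu]_x (2 * n%:R * (\sum_l f l x ^+ 2 + \sum_l g l x ^+ 2)))).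
    apply: le_Rintegral => //; [exact: lDD.2|exact: intZ (intD if2 ig2)|move=> x _].
    have -> : D x - D' x = vdot (fun=> 1) (fun l => f l x - g l x).
      by rewrite /D /D' /divf -sumrB; apply: eq_bigr => l _; rewrite mul1r /f /g opprB addrA subrK.
    apply: le_trans (vdot_cauchy _ _) _.
    have -> : vdot (fun _ : 'I_n => 1) (fun=> 1) = n%:R :> R.
      by rewrite /vdot (eq_bigr (fun=> 1)) => [|i _]; rewrite ?sumr_const ?card_ord // mulr1.
    rewrite [2 * _]mulrC -mulrA ler_wpM2l // mulrDr !mulr_sumr -big_split /=; apply: ler_sum => l _.
    by rewrite -subr_ge0 (_ : _ - _ = (f l x + g l x) ^+ 2) ?sqr_ge0 //; ring.
  rewrite (RintegralZl _ measurableT (intD if2 ig2)) (RintegralD measurableT if2 ig2).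
  rewrite (Rint_sum _ (fun l => (lf l).2)) (Rint_sum _ (fun l => (lg l).2)).
  rewrite ler_wpM2l ?mulr_ge0 // lerD //.
    apply: le_trans he; rewrite (nrm2_pairB (fun l k => pd k (phi l)) G); apply: ler_sum => l _.
    rewrite [leRHS](bigD1 l) //= lerDl; apply: sumr_ge0 => k _; apply: Rintegral_ge0 => x _; exact: sqr_ge0.
  apply: le_trans h3; rewrite (nrm2_pairB (fun l k => pd k (phi' l)) G); apply: ler_sum => l _.
  rewrite [leRHS](bigD1 l) //= lerDl; apply: sumr_ge0 => k _; apply: Rintegral_ge0 => x _; exact: sqr_ge0.
have s3 : 2 * \int[mu]_x (D x * D' x) <= tau * (1 + nrm2 (fun l => pd l D)).
  have e1 : \int[mu]_x (D x * D' x) = \int[mu]_x (\sum_l (- 1 * (phi' l x - u l x)) * pd l D x).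
    have i1 l : mu.-integrable setT (EFin \o (fun x => phi' l x * pd l D x)) := L2m_mul (Cc_L2m (cphi' 0 l)) (ldD l).
    have i2 l : mu.-integrable setT (EFin \o (fun x => D x * pd l (phi' l) x)) := L2m_mul lD (lpd _ l l cphi').
    have i3 l : mu.-integrable setT (EFin \o (fun x => u l x * pd l D x)) := L2m_mul (lu l) (ldD l).
    have i1s := int_sum (index_enum 'I_n) i1; have i3s := int_sum (index_enum 'I_n) i3.
    have -> : \int[mu]_x (\sum_l -1 * (phi' l x - u l x) * pd l D x) =
        \int[mu]_x (- 1 * (\sum_l phi' l x * pd l D x) + \sum_l u l x * pd l D x).
      apply: eq_Rintegral => x _; rewrite mulr_sumr -big_split; apply: eq_bigr => l _ /=; ring.
    rewrite (RintegralD measurableT (intZ (-1) i1s) i3s) sol // addr0 (RintegralZl _ measurableT i1s).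
    rewrite (Rint_sum _ i1) mulr_sumr.
    have -> : \int[mu]_x (D x * D' x) = \int[mu]_x (\sum_l D x * pd l (phi' l) x).
      by apply: eq_Rintegral => x _; rewrite mulr_sumr.
    rewrite (Rint_sum _ i2); apply: eq_bigr => l _.
    have h := integral_pd_compact l (CkM (cphi' 1 l).1 (cD 1).1) (Cc_mulr (cphi' 0 l) (cD 0).1).2.
    have : \int[mu]_x (phi' l x * pd l D x + D x * pd l (phi' l) x) = 0.
      rewrite -[RHS](_ : fine (0%E : \bar R) = 0) // -h /Rintegral; congr fine; apply: eq_integral => x _.
      by rewrite (has_pdE (has_pdM (CkS_has_pd l (cphi' 1 l).1) (CkS_has_pd l (cD 1).1))).
    rewrite (RintegralD measurableT (i1 l) (i2 l)) => /eqP; rewrite addrC addr_eq0 => /eqP ->.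
    by rewrite mulN1r.
  rewrite e1.
  have l1 l : L2m (fun x => -1 * (phi' l x - u l x)) by apply: L2mZ; apply: L2mB => //; exact: Cc_L2m (cphi' 0 l).
  apply: le_trans (dot_int_le tau0 l1 ldD) _.
  rewrite mulrDr mulr1 lerD2r -ler_pdivlMl ?invr_gt0 // invrK -expr2; apply: le_trans h1.
  rewrite le_eqVlt; apply/orP; left; apply/eqP; apply: eq_bigr => l _; apply: eq_Rintegral => x _; ring.
apply: le_trans s1 _; apply: le_trans (lerD s2 s3) _.
have : n%:R * tau ^+ 2 <= n%:R * tau by rewrite ler_wpM2l // expr2 ler_piMr // ltW.
by set P := nrm2 _; clear; move: (n%:R : R) => N; lra.
Qed.

(** The constant [K] depends on d, so the approximation error e tends to 0 first, with d fixed, and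
    d afterwards. *)
Lemma uncertainty_real (a : R) : (3 <= n)%N -> 0 <= a -> a * (a + n%:R - 2) = 2 ->
  1 <= 4 * a + 3 * n%:R - 12 ->
  (n%:R + 2 * a) ^+ 2 / 4 * nrm2 u ^+ 2 <= nrm2 (fun p : 'I_n * 'I_n => G p.1 p.2) *
    nrm2 (fun p : 'I_n * 'I_n => fun x => x ord0 p.2 * u p.1 x).
Proof.
move=> n3 a0 ha h4; set m := nrm2 u; set E := nrm2 _; set M := nrm2 _.
have m0 : 0 <= m := nrm2_ge0 _; have E0 : 0 <= E := nrm2_ge0 _; have M0 : 0 <= M := nrm2_ge0 _.
set L := n%:R + 2 * a.
have L0 : 0 < L by rewrite ltr_pwDl ?mulr_ge0 // ltr0n (leq_trans _ n3).
apply: discriminant_le => // lam lam0.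
have lL : 0 < lam * L by rewrite mulr_gt0.
(* d <= lam L keeps the factor lam L - d nonnegative, and d <= 1 gives (1 + d)^3 <= 1 + 7 d, the
   source of the 7. *)
apply: (@le_eps_linear _ _ _ (m + 7 * (M + lam ^+ 2 * E)) (Num.min 1 (lam * L))) => [|d d0].
  by rewrite lt_min ltr01.
rewrite le_min => /andP[d1 dL].
have [K hK] := hartley_core_inequality n3 a0 ha h4 lam0 d0.
have lLd : 0 <= lam * L - d by rewrite subr_ge0.
(* One factor 1 + d comes from [hK], one from replacing u by phi on the left, one from replacing phi
   by u on the right. *)
suff h : (lam * L - d) * m <= (1 + d) ^+ 3 * (M + lam ^+ 2 * E).
  have h7 : (1 + d) ^+ 3 <= 1 + 7 * d.
    by rewrite -subr_ge0 (_ : _ - _ = d * (1 - d) * (4 + d)) ?mulr_ge0 ?subr_ge0 ?addr_ge0 ?(ltW d0) //; ring.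
  have Q0 : 0 <= M + lam ^+ 2 * E by rewrite addr_ge0 // mulr_ge0 ?sqr_ge0.
  have := ler_wpM2r Q0 h7; set Q := M + lam ^+ 2 * E in h *; set c3 := (1 + d) ^+ 3 in h *; lra.
pose k2 := 1 + d^-1.
apply: (@le_eps_linear _ _ _ ((1 + d) * ((1 + d) * k2 + lam ^+ 2 * k2 + 2 * n%:R * `|K|) + (lam * L - d) * k2) 1) => // e e0 _.
have [phi [cphi h1 h2 h3]] := approx e0.
have lphi l : L2m (phi l) := Cc_L2m (cphi 0 l).
have lxphi (p : 'I_n * 'I_n) : L2m (fun x => x ord0 p.2 * phi p.1 x).
  exact: Cc_L2m (Cc_coordM p.2 (cphi 0 p.1)).
have lpd (p : 'I_n * 'I_n) : L2m (pd p.2 (phi p.1)) := Cc_L2m (CcS_pd p.2 (cphi 1 p.1)).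
have hd := div_le_dist cphi h3.
have := hK phi (cphi 1); rewrite -/L.
have k20 : 0 <= k2 by rewrite addr_ge0 // invr_ge0 ltW.
have g1 : m <= (1 + d) * nrm2 phi + k2 * e.
  apply: le_trans (nrm2_le d0 lu lphi) _; rewrite lerD2l ler_wpM2l //; apply: le_trans h1.
  rewrite le_eqVlt; apply/orP; left; apply/eqP; apply: eq_bigr => l _; apply: eq_Rintegral => x _; ring.
have g2 : nrm2 (fun p : 'I_n * 'I_n => fun x => x ord0 p.2 * phi p.1 x) <= (1 + d) * M + k2 * e.
  apply: le_trans (nrm2_le d0 lxphi (fun p => lxu p.1 p.2)) _.
  by rewrite lerD2l ler_wpM2l.
have g3 : nrm2 (fun p : 'I_n * 'I_n => pd p.2 (phi p.1)) <= (1 + d) * E + k2 * e.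
  apply: le_trans (nrm2_le d0 lpd (fun p => lG p.1 p.2)) _.
  by rewrite lerD2l ler_wpM2l.
set mp := nrm2 phi in g1 *; set Mp := nrm2 _ in g2 *; set Ep := nrm2 _ in g3 *.
set Dp := \int[mu]_x _ => hp.
have hD : K * Dp <= 2 * n%:R * `|K| * e.
  rewrite mulrAC; apply: (@le_trans _ _ (`|K| * Dp)).
    by rewrite ler_wpM2r ?ler_norm //; apply: Rintegral_ge0 => x _; exact: sqr_ge0.
  by rewrite mulrC ler_wpM2r.
have d1' : 0 <= 1 + d by rewrite addr_ge0 // ltW.
apply: (le_trans (ler_wpM2l lLd g1)); rewrite mulrDr mulrCA.
have e1 := ler_wpM2l d1' hp.
have e2 := ler_wpM2l d1' (ler_wpM2l d1' g2).
have e3 := ler_wpM2l d1' (ler_wpM2l (sqr_ge0 lam) g3).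
have e4 := ler_wpM2l d1' hD.
have e5 : 0 <= (1 + d) * ((1 + d) * (1 + d)) * (lam ^+ 2 * E) - (1 + d) * (lam ^+ 2 * ((1 + d) * E)).
  rewrite (_ : _ - _ = d * (1 + d) ^+ 2 * (lam ^+ 2 * E)); last by ring.
  by apply: mulr_ge0; [apply: mulr_ge0; [exact: ltW|exact: exprn_ge0]|rewrite mulr_ge0 ?sqr_ge0].
set A := (lam * L - d) * mp in e1 *; set A2 := lam * L - d.
rewrite (_ : (1 + d) ^+ 3 = (1 + d) * ((1 + d) * (1 + d))); last by ring.
move: e1 e2 e3 e4 e5; clear -A2 A; lra.
Qed.

End WeakSolenoidal.

(** * Coordinates, squares and the definitions of the statement *)

Section Smooth.
Context (R : realType) (n : nat).
Local Notation V := 'rV[R]_n.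

Lemma smooth_Ck_coord (p : nat) (f : V -> 'rV[R]_p) m l : smooth f -> Ck m (fun x => f x ord0 l).
Proof.
move=> sf; suff h ks : Ck m (fun x => iter_partial ks f x ord0 l) by exact: (h [::]).
have cc js : continuous (fun x => iter_partial js f x ord0 l).
  move=> x; apply: (@continuous_comp _ _ _ (iter_partial js f) (fun y => y ord0 l)).
    exact: (sf js).1.
  exact: coord_continuous.
elim: m ks => [|m IHm] ks; first exact: cc.
apply: (@CkSI _ _ m _ (fun k x => iter_partial (k :: ks) f x ord0 l)) => // k x.
have d := (sf ks).2 x k.
apply: DeriveDef; first exact: (derivable_mxP _ _ _).1 d ord0 l.
by rewrite /= derive_mx // mxE.
Qed.

Lemma coord_Ck_smooth (p : nat) (f : V -> 'rV[R]_p) : (forall m l, Ck m (fun x => f x ord0 l)) -> smooth f.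
Proof.
move=> cf; suff h ks : forall m l, Ck m (fun x => iter_partial ks f x ord0 l).
  move=> ks; split.
    apply: continuous_mx => i j; rewrite ord1; exact: h ks 0%N j.
  by move=> x k; apply/derivable_mxP => i j; rewrite ord1; exact: (@CkS_derivable _ _ 0 _ k x (h ks 1%N j)).
elim: ks => [|k ks IH] m l; first exact: cf.
have -> : (fun x => iter_partial (k :: ks) f x ord0 l) = pd k (fun x => iter_partial ks f x ord0 l).
  apply/funext => x; rewrite /= derive_mx ?mxE //.
  by apply/derivable_mxP => i j; rewrite ord1; exact: (@CkS_derivable _ _ 0 _ k x (IH 1%N j)).
exact: CkS_pd.
Qed.

Lemma Ck_smooth (f : V -> R) : (forall m, Ck m f) -> smooth (f : V -> R^o).
Proof.
move=> cf; suff h ks : forall m, Ck m (iter_partial ks (f : V -> R^o)).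
  by move=> ks; split; [exact: h ks 0%N|move=> x k; exact: (@CkS_derivable _ _ 0 _ k x (h ks 1%N))].
elim: ks => [|k ks IH] m; first exact: cf.
exact: (CkS_pd k (IH m.+1)).
Qed.

Lemma Cc_infty_coord (p : nat) (f : V -> 'rV[R]_p) m l : Cc_infty f -> Cc m (fun x => f x ord0 l).
Proof.
move=> [sf [r hr]]; split; first exact: smooth_Ck_coord.
by exists r => x rx; rewrite hr // mxE.
Qed.

Lemma jacobianE (f : V -> V) x j k : Cc_infty f -> Defs.jacobian f x j k = pd k (fun y => f y ord0 j) x.
Proof. by move=> [sf _]; rewrite mxE derive_mx ?mxE //; exact: (sf [::]).2. Qed.

Lemma borel_fun_coord p q (f : V -> 'M[R]_(p, q)) i j : borel_fun f ->
  measurable_fun setT (fun x => f x i j).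
Proof.
move=> bf; apply: (@measurableT_comp _ _ _ _ _ _ (fun M : 'M[R]_(p, q) => M i j)).
  by apply: continuous_measurable_mx; exact: coord_continuous.
by apply: measurable_fun_openP => A oA; rewrite -borelNE; exact: bf.
Qed.

End Smooth.

Section IintSquares.
Context (R : realType) (n : nat).
Local Notation V := 'rV[R]_n.
Local Notation mu := (lebN R n).

Lemma iint_sumsq (I : finType) (f : I -> V -> R) : (forall i, measurable_fun setT (f i)) ->
  iint (fun x => (\sum_i f i x ^+ 2)%:E) = (\sum_i \int[mu]_x (f i x ^+ 2)%:E)%E.
Proof.
move=> mf; have mf2 i : measurable_fun setT (fun x => (f i x ^+ 2)%:E).
  by apply/measurable_EFinP; exact: measurable_funX.
rewrite ge0_iintE; last by move=> x; rewrite lee_fin sumr_ge0 // => i _; exact: sqr_ge0.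
  under eq_integral do rewrite -sumEFin.
  by rewrite ge0_integral_sum // => i x _; rewrite lee_fin sqr_ge0.
apply/measurable_EFinP; apply: measurable_sum => i; exact: measurable_funX.
Qed.

Lemma iint_sumsq_L2m (I : finType) (f : I -> V -> R) : (forall i, L2m (f i)) ->
  iint (fun x => (\sum_i f i x ^+ 2)%:E) = (nrm2 f)%:E.
Proof.
move=> lf; rewrite iint_sumsq => [|i]; last exact: (lf i).1.
rewrite /nrm2 -sumEFin; apply: eq_bigr => i _; rewrite fineK //.
exact: integrable_fin_num (lf i).2.
Qed.

Lemma iint_sumsq_lty (I : finType) (f : I -> V -> R) : (forall i, measurable_fun setT (f i)) ->
  (iint (fun x => (\sum_i f i x ^+ 2)%:E) < +oo)%E -> forall i, L2m (f i).
Proof.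
move=> mf; rewrite iint_sumsq // => h i; split => //; apply/integrableP; split.
  by apply/measurable_EFinP; exact: measurable_funX.
apply: le_lt_trans h; rewrite (bigD1 i) //= -[leLHS]adde0; apply: leeD; last first.
  by apply: sume_ge0 => j _; apply: integral_ge0 => x _; rewrite lee_fin sqr_ge0.
by under eq_integral do rewrite /= ger0_norm ?sqr_ge0 //.
Qed.

Lemma sqnorm_mulE (v w : V) : sqnorm v * sqnorm w = \sum_(p : 'I_n * 'I_n) (w ord0 p.2 * v ord0 p.1) ^+ 2.
Proof.
rewrite -(pair_bigA _ (fun i j => (w ord0 j * v ord0 i) ^+ 2)) /= /sqnorm mulr_suml; apply: eq_bigr => i _.
by rewrite mulr_sumr; apply: eq_bigr => j _; rewrite exprMn mulrC.
Qed.

Lemma sqnormME (A : 'M[R]_n) : sqnormM A = \sum_(p : 'I_n * 'I_n) (A p.1 p.2) ^+ 2.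
Proof. by rewrite -(pair_bigA _ (fun i j => A i j ^+ 2)). Qed.

End IintSquares.

(** * The inequality on the completed space *)

Section Inequality.
Context (R : realType) (n : nat).
Local Notation V := 'rV[R]_n.
Local Notation mu := (lebN R n).

Definition cf (u : V -> V) l (x : V) := u x ord0 l.
Definition xcf (u : V -> V) (p : 'I_n * 'I_n) (x : V) := x ord0 p.2 * u x ord0 p.1.
Definition mcf (G : V -> 'M[R]_n) (p : 'I_n * 'I_n) (x : V) := G x p.1 p.2.

Lemma Ddist2E (phi u : V -> V) G :
  Ddist2 phi u G = (iint (fun x => (\sum_l (cf phi l x - cf u l x) ^+ 2)%:E) +
    iint (fun x => (\sum_p (xcf phi p x - xcf u p x) ^+ 2)%:E) +
    iint (fun x => (\sum_p (mcf (Defs.jacobian phi) p x - mcf G p x) ^+ 2)%:E))%E.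
Proof.
rewrite /Ddist2; congr (_ + _ + _)%E; congr iint; apply/funext => x; congr EFin.
- by apply: eq_bigr => l _; rewrite subrowE.
- by rewrite sqnorm_mulE; apply: eq_bigr => p _; rewrite subrowE /xcf mulrBr.
- rewrite sqnormME; apply: eq_bigr => p _; rewrite /mcf; congr (_ ^+ 2).
  by rewrite mxE [X in _ + X]mxE.
Qed.

Lemma mom2E (u : V -> V) : mom2 u = iint (fun x => (\sum_p xcf u p x ^+ 2)%:E).
Proof. by congr iint; apply/funext => x; rewrite sqnorm_mulE. Qed.

Lemma grad2E (G : V -> 'M[R]_n) : grad2 G = iint (fun x => (\sum_p mcf G p x ^+ 2)%:E).
Proof. by congr iint; apply/funext => x; rewrite sqnormME. Qed.

(** Convergence to 0 makes some distance finite, and one such index already puts u = phi - (phi - u)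
    in L^2, likewise x u and [G]. After that all distances in use are real numbers. *)
Lemma inD_approx (u : V -> V) G : inD u G ->
  [/\ forall l, L2m (cf u l), forall p, L2m (xcf u p), forall p, L2m (mcf G p) &
   forall e, 0 < e -> exists phi, near_field (cf u) (fun l k x => G x l k) e phi].
Proof.
move=> [bu [bG [phi [cphi]]]] /fine_cvgP[fD cD].
have mu_ l : measurable_fun setT (cf u l) by exact: borel_fun_coord.
have mx l : measurable_fun setT (fun x : V => x ord0 l).
  by apply: continuous_measurable_mx; exact: coord_continuous.
have mxu p : measurable_fun setT (xcf u p) := measurable_funM (mx p.2) (mu_ p.1).
have mG p : measurable_fun setT (mcf G p) by exact: borel_fun_coord.
have lphi m l : L2m (cf (phi m) l) by exact: Cc_L2m (Cc_infty_coord 0 l (cphi m)).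
have lxphi m p : L2m (xcf (phi m) p).
  exact: Cc_L2m (Cc_coordM p.2 (Cc_infty_coord 0 p.1 (cphi m))).
have ljphi m p : L2m (mcf (Defs.jacobian (phi m)) p).
  rewrite (_ : mcf _ p = pd p.2 (cf (phi m) p.1)).
    exact: Cc_L2m (CcS_pd p.2 (Cc_infty_coord 1%N p.1 (cphi m))).
  by apply/funext => x; exact: jacobianE.
have iiD (I : finType) (f : I -> V -> R) : (0 <= iint (fun x => (\sum_i f i x ^+ 2)%:E))%E.
  by apply: iint_ge0 => x; rewrite lee_fin sumr_ge0 // => i _; exact: sqr_ge0.
have key m : Ddist2 (phi m) u G \is a fin_num ->
  [/\ forall l, L2m (fun x => cf (phi m) l x - cf u l x),
      forall p, L2m (fun x => xcf (phi m) p x - xcf u p x) &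
      forall p, L2m (fun x => mcf (Defs.jacobian (phi m)) p x - mcf G p x)].
  rewrite Ddist2E fin_numElt => /andP[_ h]; split => [l|p|p].
  - apply: (@iint_sumsq_lty _ _ _ (fun l x => cf (phi m) l x - cf u l x)).
      by move=> i; apply: measurable_funB => //; exact: (lphi m i).1.
    apply: le_lt_trans h; rewrite -addeA leeDl // adde_ge0 //; exact: iiD.
  - apply: (@iint_sumsq_lty _ _ _ (fun l x => xcf (phi m) l x - xcf u l x)).
      by move=> i; apply: measurable_funB => //; exact: (lxphi m i).1.
    by apply: le_lt_trans h; rewrite addeAC leeDr // adde_ge0 //; exact: iiD.
  - apply: (@iint_sumsq_lty _ _ _ (fun l x => mcf (Defs.jacobian (phi m)) l x - mcf G l x)).
      by move=> i; apply: measurable_funB => //; exact: (ljphi m i).1.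
    by apply: le_lt_trans h; rewrite leeDr // adde_ge0 //; exact: iiD.
have [m0 fm0] : exists m, Ddist2 (phi m) u G \is a fin_num.
  by have [k _ hk] := fD; exists k; exact: hk (leqnn k).
have [k1 k2 k3] := key m0 fm0.
split.
- move=> l; have := L2mB (lphi m0 l) (k1 l).
  by under eq_fun do rewrite opprB addrC subrK.
- move=> p; have := L2mB (lxphi m0 p) (k2 p).
  by under eq_fun do rewrite opprB addrC subrK.
- move=> p; have := L2mB (ljphi m0 p) (k3 p).
  by under eq_fun do rewrite opprB addrC subrK.
move=> e e0; have /cvgrPdist_lt/(_ _ e0) cDe := cD.
have [k _ hk] := filterI fD cDe; have [fk] := hk k (leqnn k).
clear k1 k2 k3; have [k1 k2 k3] := key k fk.
rewrite sub0r normrN /= Ddist2E (iint_sumsq_L2m k1) (iint_sumsq_L2m k2) (iint_sumsq_L2m k3) /=.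
have n1 := nrm2_ge0 (fun l x => cf (phi k) l x - cf u l x).
have n2 := nrm2_ge0 (fun p x => xcf (phi k) p x - xcf u p x).
have n3 := nrm2_ge0 (fun p x => mcf (Defs.jacobian (phi k)) p x - mcf G p x).
rewrite ger0_norm ?addr_ge0 // => /ltW he.
exists (cf (phi k)); split.
- by move=> m l; exact: Cc_infty_coord.
- by apply: le_trans he; rewrite -addrA lerDl addr_ge0.
- by apply: le_trans he; rewrite addrAC lerDr addr_ge0.
- have -> : (fun (p : 'I_n * 'I_n) x => pd p.2 (cf (phi k) p.1) x - G x p.1 p.2) =
    (fun p x => mcf (Defs.jacobian (phi k)) p x - mcf G p x).
    by apply/funext => p; apply/funext => x; rewrite /mcf jacobianE.
  by apply: le_trans he; rewrite lerDr addr_ge0.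
Qed.

(** [a] is the positive root of a^2 + (N - 2) a - 2, and N + 2 a is the square root plus 2. *)
Lemma sharp_exponent : (3 <= n)%N -> let a := (Num.sqrt ((n%:R - 2) ^+ 2 + 8) - (n%:R - 2)) / 2 : R in
  [/\ 0 < a, a * (a + n%:R - 2) = 2, 1 <= 4 * a + 3 * n%:R - 12 & CN R n = (n%:R + 2 * a) ^+ 2 / 4].
Proof.
move=> n3 a; have N3 : 3 <= n%:R :> R by rewrite ler_nat.
set s := Num.sqrt _ in a *; set N := n%:R in a N3 *.
have s2 : s ^+ 2 = (N - 2) ^+ 2 + 8 by rewrite sqr_sqrtr // addr_ge0 ?sqr_ge0.
have s0 : 0 <= s by exact: sqrtr_ge0.
have sN : N - 2 < s.
  rewrite ltNge; apply/negP => h.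
  by have : s ^+ 2 <= (N - 2) ^+ 2; [rewrite lerXn2r // nnegrE; lra|rewrite s2; lra].
split.
- by rewrite /a divr_gt0 // subr_gt0.
- transitivity ((s ^+ 2 - (N - 2) ^+ 2) / 4); first by rewrite /a; field.
  by rewrite s2; field.
(* The claim amounts to 2 s >= 9 - N, an equality at N = 3, where s = 3. *)
- rewrite /a; have : N + 6 <= 2 * s + N * 2 - 3 by nra.
  lra.
- by rewrite /CN -/N -/s /a; field.
Qed.

Lemma uncertainty_inequality (u : V -> V) G : (3 <= n)%N -> inD u G -> solenoidal u ->
  ((CN R n)%:E * (mass2 u * mass2 u) <= grad2 G * mom2 u)%E.
Proof.
move=> n3 /inD_approx[lu lxu lG ap] su.
have [/ltW a0 ha h4 ->] := sharp_exponent n3.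
rewrite mom2E grad2E (iint_sumsq_L2m lxu) (iint_sumsq_L2m lG).
have -> : mass2 u = (nrm2 (cf u))%:E by rewrite -iint_sumsq_L2m.
rewrite -!EFinM lee_fin -expr2.
apply: (uncertainty_real (u := cf u) (G := fun l k x => G x l k) lu _ _ ap) => //.
- by move=> l k; exact: (lxu (l, k)).
- by move=> l k; exact: (lG (l, k)).
move=> psi cpsi; have lpd l : L2m (pd l psi) := Cc_L2m (CcS_pd l (cpsi 1%N)).
have i : mu.-integrable setT (EFin \o (fun x => \sum_l cf u l x * pd l psi x)).
  by apply: int_sum => l; exact: L2m_mul.
have := su psi; rewrite integrable_iintE // /Rintegral => -> //.
by split; [apply: Ck_smooth => m; exact: (cpsi m).1|exact: (cpsi 0).2].
Qed.

End Inequality.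

(** * Kummer functions *)

Section EntireSeries.
Context (R : realType).
Implicit Types (c d : nat -> R) (x : R).

(** A bound that makes the power series entire, by comparison with the exponential, and is stable
    under termwise derivation, which multiplies by k + 1 and shifts the factorial. *)
Definition ebdd c := exists C, forall k, `|c k| <= C / k`!%:R.

Definition psum c x := limn (pseries c x).

Lemma ebdd_cvg c x : ebdd c -> cvgn (pseries c x).
Proof.
move=> [C hC]; apply: normed_cvg.
apply: (@series_le_cvg _ _ (fun k => C * exp_coeff `|x| k)).
- by move=> k; exact: normr_ge0.
- move=> k; rewrite mulr_ge0 // ?exp_coeff_ge0 //.
  by have := le_trans (normr_ge0 _) (hC 0%N); rewrite fact0 divr1.
- by move=> k; rewrite /= normrM normrX /exp_coeff /= mulrA mulrAC ler_wpM2r // exprn_ge0.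
rewrite (_ : series _ = fun n => C * series (exp_coeff `|x|) n).
  by apply: is_cvgMr; exact: is_cvg_series_exp_coeff.
by apply/funext => n; rewrite /series /= mulr_sumr.
Qed.

Lemma ebdd_diffs c : ebdd c -> ebdd (pseries_diffs c).
Proof.
move=> [C hC]; exists C => k; rewrite /pseries_diffs normrM ger0_norm //.
have k1 : (k.+1%:R : R) != 0 by rewrite pnatr_eq0.
apply: le_trans (ler_wpM2l _ (hC k.+1)) _ => //.
by rewrite factS natrM invfM mulrCA mulVKf.
Qed.

Lemma ebdd_lin a b c d : ebdd c -> ebdd d -> ebdd (fun k => a * c k + b * d k).
Proof.
move=> [C hC] [D hD]; exists (`|a| * C + `|b| * D) => k; rewrite mulrDl.
by rewrite (le_trans (ler_normD _ _)) // !normrM -!mulrA lerD // ler_wpM2l.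
Qed.

Lemma is_derive_psum c x : ebdd c -> is_derive x 1 (psum c) (psum (pseries_diffs c) x).
Proof.
move=> hc; apply: (@pseries_snd_diffs _ _ (`|x| + 1)); try exact: ebdd_cvg.
- exact/ebdd_cvg/ebdd_diffs.
- exact/ebdd_cvg/ebdd_diffs/ebdd_diffs.
- by rewrite [X in _ < X]ger0_norm ?addr_ge0 // ltrDl.
Qed.

Lemma psum_lin a b c d x : cvgn (pseries c x) -> cvgn (pseries d x) ->
  psum (fun k => a * c k + b * d k) x = a * psum c x + b * psum d x.
Proof.
move=> hc hd; apply/cvg_lim => //.
rewrite (_ : pseries _ x = fun n => a * pseries c x n + b * pseries d x n).
  by apply: cvgD; apply: cvgM => //; exact: cvg_cst.
apply/funext => n; rewrite /pseries /series /= !mulr_sumr -big_split; apply: eq_bigr => k _ /=.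
by rewrite mulrDl !mulrA.
Qed.

(** The coefficients of x times the series. *)
Definition shift1 c k := if k is k'.+1 then c k' else 0.

Lemma cvg_shift1 c x : cvgn (pseries c x) -> pseries (shift1 c) x @ \oo --> x * psum c x.
Proof.
move=> hc; rewrite -(cvg_shiftS _ _).
rewrite (_ : (fun n => pseries _ x n.+1) = fun n => x * pseries c x n).
  by apply: cvgM => //; exact: cvg_cst.
apply/funext => n; rewrite /pseries /series /= big_nat_recl //= mul0r add0r mulr_sumr.
by apply: eq_bigr => k _; rewrite exprS mulrCA.
Qed.

Lemma psum_shift c x : cvgn (pseries c x) -> psum (shift1 c) x = x * psum c x.
Proof. by move=> hc; apply/cvg_lim => //; exact: cvg_shift1. Qed.

Lemma psum_ge0 c x : ebdd c -> (forall k, 0 <= c k) -> 0 <= x -> 0 <= psum c x.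
Proof.
move=> hc c0 x0; apply: limr_ge; first exact: ebdd_cvg.
by apply: nearW => n; apply: sumr_ge0 => k _; rewrite mulr_ge0 ?exprn_ge0.
Qed.

Lemma psum_at0 c : psum c 0 = c 0%N.
Proof.
apply/cvg_lim => //; rewrite -(cvg_shiftS _ _).
rewrite (_ : (fun n => pseries _ 0 n.+1) = cst (c 0%N)); first exact: cvg_cst.
apply/funext => n; rewrite /pseries /series /= big_nat_recl //= expr0 mulr1 big1 ?addr0 // => k _.
by rewrite exprS mul0r mulr0.
Qed.

End EntireSeries.

Lemma is_derive_le0 (R : realType) (W dW : R -> R) : (forall t : R, is_derive t 1 W (dW t)) ->
  (forall t, 0 <= t -> dW t <= 0) -> forall t, 0 <= t -> W t <= W 0.
Proof.
move=> hW h t t0; have cW : continuous W.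
  by move=> s; apply/differentiable_continuous/derivable1_diffP; case: (hW s).
have [c c0t e] := @MVT_segment R W dW 0 t t0 (fun s _ => hW s) (continuous_subspaceT cW).
rewrite -subr_le0 e subr0 mulr_le0_ge0 // h //.
by move: c0t; rewrite in_itv => /andP[].
Qed.

Section Kummer.
Context (R : realType).
Variable A : R.
Hypotheses (A0 : 0 < A) (A1 : A <= 1).

(** The coefficients (A)_k / ((B)_k k!) of Kummer's function 1F1(A; B; t). *)
Definition kcoef (B : R) (k : nat) : R := \prod_(i < k) ((A + i%:R) / (B + i%:R)) / k`!%:R.

Lemma kcoef0 B : kcoef B 0 = 1.
Proof. by rewrite /kcoef big_ord0 fact0 divr1. Qed.

Lemma kcoefS B k : kcoef B k.+1 = kcoef B k * ((A + k%:R) / (B + k%:R) / k.+1%:R).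
Proof. by rewrite /kcoef big_ord_recr factS natrM invfM /=; ring. Qed.

Lemma kcoef_shift B k : 0 < B -> kcoef (B + 1) k = B / (B + k%:R) * kcoef B k.
Proof.
move=> B0; elim: k => [|k IHk]; first by rewrite !kcoef0 addr0 mulr1 divff // gt_eqF.
rewrite !kcoefS IHk -[k.+1]addn1 natrD; field.
have k0 : 0 <= k%:R :> R by []; by apply/and3P; split; rewrite gt_eqF //; lra.
Qed.

Lemma kcoef_ge0 B k : 0 < B -> 0 <= kcoef B k.
Proof.
move=> B0; elim: k => [|k IHk]; first by rewrite kcoef0.
by rewrite kcoefS mulr_ge0 // !divr_ge0 // addr_ge0 // ltW.
Qed.

Lemma ebdd_kcoef B : A < B -> ebdd (kcoef B).
Proof.
move=> AB; have B0 : 0 < B := lt_trans A0 AB; exists 1 => k; rewrite ger0_norm ?kcoef_ge0 //.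
elim: k => [|k IHk]; first by rewrite kcoef0 fact0 divr1.
have q1 : (A + k%:R) / (B + k%:R) <= 1.
  by rewrite ler_pdivrMr ?mul1r ?lerD2r ?(ltW AB) // ltr_wpDr.
rewrite kcoefS factS natrM; set q := (A + k%:R) / _ in q1 *.
rewrite (_ : _ * (q / _) = kcoef B k * q / k.+1%:R); last by ring.
rewrite (_ : 1 / _ = 1 / k`!%:R / k.+1%:R); last by rewrite invfM; ring.
rewrite ler_wpM2r ?invr_ge0 //; apply: le_trans IHk.
by rewrite ler_piMr // kcoef_ge0.
Qed.

Lemma kcoef_diffs B k : 0 < B ->
  pseries_diffs (kcoef B) k = kcoef B k + - ((B - A) / B) * kcoef (B + 1) k.
Proof.
move=> B0; rewrite /pseries_diffs kcoefS kcoef_shift // -[k.+1]addn1 natrD; field.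
have k0 : 0 <= k%:R :> R by []; by apply/and3P; split; rewrite gt_eqF //; lra.
Qed.

(** By Kummer's transformation this is 1F1(B - A; B; -t). The form chosen has nonnegative
    coefficients, hence a sign for t >= 0, and its derivative is a multiple of the same function at
    B + 1. *)
Definition kummer (B t : R) := expR (- t) * psum (kcoef B) t.

Lemma kummer_ge0 B t : A < B -> 0 <= t -> 0 <= kummer B t.
Proof.
move=> AB t0; rewrite mulr_ge0 ?expR_ge0 // psum_ge0 //; first exact: ebdd_kcoef.
by move=> k; rewrite kcoef_ge0 // (lt_trans A0).
Qed.

Lemma kummer0 B : kummer B 0 = 1.
Proof. by rewrite /kummer oppr0 expR0 mul1r psum_at0 kcoef0. Qed.

Lemma is_derive_kummer B (t : R) : A < B -> is_derive t 1 (kummer B) (- ((B - A) / B) * kummer (B + 1) t).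
Proof.
move=> AB; have B0 : 0 < B := lt_trans A0 AB.
have AB1 : A < B + 1 by rewrite (lt_trans AB) // ltrDl.
have d1 := is_derive_psum t (ebdd_kcoef AB).
have d2 : is_derive t 1 (fun s : R => expR (- s)) (- expR (- t)).
  have := is_derive1_comp (is_derive_expR (- t)) (is_deriveN (is_derive_id t 1)).
  by move=> h; apply: (is_derive_eq h); rewrite mulrN1.
have h := is_deriveM d2 d1; apply: (is_derive_eq h); rewrite /GRing.scale /= /kummer.
have -> : psum (pseries_diffs (kcoef B)) t = 1 * psum (kcoef B) t + - ((B - A) / B) * psum (kcoef (B + 1)) t.
  rewrite -psum_lin; [|exact/ebdd_cvg/ebdd_kcoef|exact/ebdd_cvg/ebdd_kcoef].
  by congr (psum _ t); apply/funext => k; rewrite kcoef_diffs // mul1r.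
by ring.
Qed.

(** Kummer's equation t f'' + (B + t) f' + (B - A) f = 0, with the derivatives written as contiguous
    functions; it becomes a relation between the coefficients. *)
Lemma kummer_ode B t : A < B ->
  t * ((B - A) / B * ((B + 1 - A) / (B + 1)) * kummer (B + 1 + 1) t)
  - (B + t) * ((B - A) / B * kummer (B + 1) t) + (B - A) * kummer B t = 0.
Proof.
move=> AB; have B0 : 0 < B := lt_trans A0 AB.
have AB1 : A < B + 1 by rewrite (lt_trans AB) // ltrDl.
have AB2 : A < B + 1 + 1 by rewrite (lt_trans AB1) // ltrDl.
have e0 := ebdd_kcoef AB; have e1 := ebdd_kcoef AB1; have e2 := ebdd_kcoef AB2.
pose d k := (B + 1 - A) / (B * (B + 1)) * kcoef (B + 1 + 1) k + - B^-1 * kcoef (B + 1) k.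
have ed : ebdd d := ebdd_lin _ _ e2 e1.
have cd : cvgn (pseries d t) := ebdd_cvg ed.
have csh : cvgn (pseries (shift1 d) t) by apply/cvg_ex; eexists; exact: cvg_shift1.
have c01 : cvgn (pseries (fun k => 1 * kcoef B k + (-1) * kcoef (B + 1) k) t).
  by apply: ebdd_cvg; exact: ebdd_lin.
have h : 1 * psum (fun k => 1 * kcoef B k + (-1) * kcoef (B + 1) k) t + 1 * psum (shift1 d) t = 0.
  rewrite -psum_lin //.
  rewrite (_ : (fun k => _) = cst 0).
    apply/cvg_lim => //; rewrite (_ : pseries _ t = cst 0); first exact: cvg_cst.
    by apply/funext => k; rewrite /pseries /series /= big1 // => i _; rewrite mul0r.
  apply/funext => -[|k] /=; first by rewrite !kcoef0; ring.
  have B10 : 0 < B + 1 by rewrite ltr_wpDr.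
  rewrite /d (@kcoef_shift (B + 1) k B10) !kcoefS !(@kcoef_shift B k B0) -[k.+1]addn1 natrD; field.
  by have k0 : 0 <= k%:R :> R by []; repeat (apply/andP; split); rewrite gt_eqF //; lra.
move: h; rewrite psum_lin; [|exact: ebdd_cvg|exact: ebdd_cvg].
rewrite psum_shift // psum_lin; [|exact: ebdd_cvg|exact: ebdd_cvg]; rewrite /kummer => h.
rewrite (_ : _ + _ = (B - A) * expR (- t) * (1 * (1 * psum (kcoef B) t + -1 * psum (kcoef (B + 1)) t) +
  1 * (t * ((B + 1 - A) / (B * (B + 1)) * psum (kcoef (B + 1 + 1)) t + - B^-1 * psum (kcoef (B + 1)) t)))).
  by rewrite h mulr0.
by field; rewrite !gt_eqF // ltr_wpDr.
Qed.

Lemma kummer_decay B (j : nat) : A < B -> (0 < j)%N -> j%:R <= B - A ->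
  exists C, forall t : R, 0 <= t -> (1 + 2 * t) ^+ j * kummer B t <= C.
Proof.
move=> AB j0 jB; have AB1 : A < B + 1 by rewrite (lt_trans AB) // ltrDl.
have B0 : 0 < B := lt_trans A0 AB.
pose al := B - A; have al0 : 0 < al by rewrite subr_gt0.
pose F := kummer B; pose F1 (t : R) := - (al / B) * kummer (B + 1) t.
have dF (t : R) : is_derive t 1 F (F1 t) by exact: is_derive_kummer.
have dF1 (t : R) : is_derive t 1 F1 (- (al / B) * (- ((B + 1 - A) / (B + 1)) * kummer (B + 1 + 1) t)).
  have h := is_deriveM (is_derive_cst (- (al / B)) t 1) (is_derive_kummer t AB1).
  by apply: (is_derive_eq h); rewrite /GRing.scale /= mulr0 addr0.
have F0 t : 0 <= t -> 0 <= F t by exact: kummer_ge0.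
have F1le t : 0 <= t -> F1 t <= 0.
  by move=> t0; rewrite /F1 mulNr oppr_le0 mulr_ge0 ?kummer_ge0 // divr_ge0 // ltW.
(* [Z] annihilates t^(A - B), the expected decay. By Kummer's equation exp(t) Z has derivative (1 -
   A) exp(t) F', which is nonpositive; hence the exponential bound [Zle]. *)
pose Z t := t * F1 t + al * F t.
have Zle t : 0 <= t -> Z t <= al * expR (- t).
  pose W t := expR t * Z t.
  have dW (s : R) : is_derive s 1 W (expR s * ((1 - A) * F1 s)).
    move: s => {}t; have h1 := is_deriveD (is_deriveM (is_derive_id t 1) (dF1 t)) (is_deriveM (is_derive_cst al t 1) (dF t)).
    have h := is_deriveM (is_derive_expR t) h1; apply: (is_derive_eq h); rewrite /GRing.scale /=.
    rewrite -[(id * F1 + _) t]/(Z t).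
    have := kummer_ode t AB; rewrite -/al -/F /Z /F1 => ode.
    rewrite [LHS](_ : _ = expR t * ((1 - A) * (- (al / B) * kummer (B + 1) t)) + expR t * (
      t * (al / B * ((B + 1 - A) / (B + 1)) * kummer (B + 1 + 1) t)
      - (B + t) * (al / B * kummer (B + 1) t) + al * F t)).
      by rewrite ode mulr0 addr0.
    by rewrite /al; ring.
  move=> t0; have W0 : W 0 = al by rewrite /W /Z /F kummer0 expR0; ring.
  have := is_derive_le0 dW _ t0; rewrite W0 /W => h.
  rewrite expRN ler_pdivlMr ?expR_gt0 // mulrC; apply: h => s s0.
  rewrite mulr_ge0_le0 ?expR_ge0 // mulr_ge0_le0 ?F1le // subr_ge0.
  exact: A1.
case: j j0 jB => // j _ jB.
(* Read at s / 2, this bounds (1 + 2 s)^j exp(-s / 2). The exponent of the claim is now written j +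
   1. *)
have [C0 [C00 hC0]] := horner_expR_bounded ((1 + 4%:P * 'X) ^+ j : {poly R}).
(* The derivative of the first summand is (1 + 2 t)^j times 2 Z + F' - 2 (al - j - 1) F. Only Z can
   be positive, and the exponential summand compensates its bound, so [g] is nonincreasing. *)
pose g t := (1 + 2 * t) ^+ j.+1 * F t + 4 * al * C0 * expR (- (t / 2)).
have de (t : R) : is_derive t 1 (fun s : R => expR (- (s / 2))) (- (expR (- (t / 2)) / 2)).
  have d1 : is_derive t 1 (fun s : R => - (s / 2)) (- 2^-1).
    have h := is_deriveN (is_deriveM (is_derive_id t 1) (is_derive_cst (2^-1 : R) t 1)).
    by apply: (is_derive_eq h); rewrite /GRing.scale /= mulr0 add0r mulr1.
  by have h := is_derive1_comp (is_derive_expR _) d1; apply: (is_derive_eq h); rewrite mulrN.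
have dg (t : R) : is_derive t 1 g (((1 + 2 * t) ^+ j.+1 * F1 t + F t * (j.+1%:R * (1 + 2 * t) ^+ j * 2))
    + 4 * al * C0 * (- (expR (- (t / 2)) / 2))).
  have d1 : is_derive t 1 (fun s : R => 1 + 2 * s) 2.
    have h := is_deriveD (is_derive_cst (1 : R) t 1) (is_deriveM (is_derive_cst (2 : R) t 1) (is_derive_id t 1)).
    by apply: (is_derive_eq h); rewrite /GRing.scale /= mulr0 addr0 add0r mulr1.
  have d2 : is_derive t 1 (fun s : R => (1 + 2 * s) ^+ j.+1) (j.+1%:R * (1 + 2 * t) ^+ j * 2).
    rewrite (_ : (fun s : R => _) = (fun s : R => 1 + 2 * s) ^+ j.+1); first exact: is_deriveX.
    by apply/funext => s; rewrite exprfctE.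
  have h := is_deriveD (is_deriveM d2 (dF t)) (is_deriveM (is_derive_cst (4 * al * C0) t 1) (de t)).
  by apply: (is_derive_eq h); rewrite /GRing.scale /=; ring.
exists (1 + 4 * al * C0) => t t0.
have g0 : g 0 = 1 + 4 * al * C0.
  by rewrite /g mulr0 addr0 expr1n mul1r mul0r oppr0 expR0 mulr1 /F kummer0.
have := is_derive_le0 dg _ t0; rewrite g0 => h; apply: le_trans (h _) => [|s s0]; last first.
  have s21 : 0 <= 1 + 2 * s by rewrite addr_ge0 // mulr_ge0.
  have hs := hC0 (s / 2) (divr_ge0 s0 (ler0n _ 2)).
  rewrite hornerE !hornerE /= in hs.
  have h1 : (1 + 2 * s) ^+ j * expR (- s) <= C0 * expR (- (s / 2)).
    have -> : - s = - (s / 2) + - (s / 2) by field.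
    rewrite expRD mulrA ler_wpM2r ?expR_ge0 //; apply: le_trans hs.
    rewrite ler_wpM2r ?expR_ge0 // (_ : 4 * s / 2 = 2 * s); last by field.
    exact: ler_norm.
  have h2 : (1 + 2 * s) ^+ j * (2 * Z s) <= (1 + 2 * s) ^+ j * (2 * (al * expR (- s))).
    by rewrite ler_wpM2l ?exprn_ge0 // ler_wpM2l // Zle.
  have h3 : (1 + 2 * s) ^+ j * (F1 s - 2 * (al - j.+1%:R) * F s) <= 0.
    rewrite mulr_ge0_le0 ?exprn_ge0 // subr_le0 (le_trans (F1le s s0)) //.
    by apply: mulr_ge0; [rewrite mulr_ge0 // subr_ge0|exact: F0].
  have h4 := ler_wpM2l (ltW al0) h1.
  rewrite exprS; rewrite /Z in h2.
  set P := (1 + 2 * s) ^+ j in h1 h2 h3 h4 *; set e1 := expR (- s) in h1 h2 h4.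
  set e2 := expR (- (s / 2)) in h1 h4 *; set f := F s in h2 h3 *; set f1 := F1 s in h2 h3 *.
  move: h2 h3 h4; clear; lra.
by rewrite lerDl !mulr_ge0 ?expR_ge0 // ltW.
Qed.

(** The k-th derivative of [kummer B] in closed form, so that equation and decay are inherited from
    [kummer] at B + k; each derivative decays faster by one power of t. *)
Definition kseq (B : R) (k : nat) (t : R) : R :=
  (-1) ^+ k * \prod_(i < k) ((B - A + i%:R) / (B + i%:R)) * kummer (B + k%:R) t.

Lemma ltr_wk B k : A < B -> A < B + k%:R.
Proof. by move=> AB; rewrite ltr_wpDr. Qed.

Lemma is_derive_kseq B k (t : R) : A < B -> is_derive t 1 (kseq B k) (kseq B k.+1 t).
Proof.
move=> AB; have h := is_deriveM (is_derive_cst ((-1) ^+ k * \prod_(i < k) ((B - A + i%:R) / (B + i%:R))) t 1)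
  (is_derive_kummer t (ltr_wk k AB)).
apply: (is_derive_eq h); rewrite /GRing.scale /= mulr0 addr0 /kseq big_ord_recr exprS /=.
rewrite (_ : B + k.+1%:R = B + k%:R + 1); last by rewrite -[k.+1]addn1 natrD addrA.
by rewrite (_ : B - A + k%:R = B + k%:R - A); ring.
Qed.

Lemma kseq_ode B k t : A < B ->
  t * kseq B k.+2 t + (B + k%:R + t) * kseq B k.+1 t + (B - A + k%:R) * kseq B k t = 0.
Proof.
move=> AB; have := kummer_ode t (ltr_wk k AB); rewrite /kseq !big_ord_recr !exprS /=.
set c := (-1) ^+ k; set P := \prod_(i < k) _.
rewrite -[k.+2]addn2 -[k.+1]addn1 !natrD => h.
have e2 : B + (k%:R + 2) = B + k%:R + 1 + 1 by ring.
have e1 : B + (k%:R + 1) = B + k%:R + 1 by ring.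
have e3 : B - A + k%:R = B + k%:R - A by ring.
have e4 : B - A + (k%:R + 1) = B + k%:R + 1 - A by ring.
rewrite e1 e2 e3 e4 -[RHS](mulr0 (c * P)) -h; ring.
Qed.

Lemma kseq_decay B k (j : nat) : A < B -> (0 < j)%N -> j%:R <= B - A ->
  exists C, forall t : R, 0 <= t -> (1 + 2 * t) ^+ (j + k) * `|kseq B k t| <= C.
Proof.
move=> AB j0 jB; have jk : (j + k)%:R <= B + k%:R - A by rewrite natrD addrAC lerD2r.
have [C hC] := kummer_decay (ltr_wk k AB) (ltn_addr k j0) jk.
exists (`|(-1) ^+ k * \prod_(i < k) ((B - A + i%:R) / (B + i%:R))| * C) => t t0.
rewrite /kseq normrM mulrCA ler_wpM2l // [`|kummer _ _|]ger0_norm ?hC //.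
by rewrite kummer_ge0 ?ltr_wk.
Qed.

Lemma kseq1_0 B : kseq B 1 0 = - ((B - A) / B).
Proof. by rewrite /kseq big_ord1 expr1 kummer0 !addr0 mulr1 mulN1r. Qed.

End Kummer.

(** * The extremal field *)

Section Decay.
Context (R : realType) (n : nat).
Local Notation V := 'rV[R]_n.
Local Notation mu := (lebN R n).

Lemma norm_le_jap (x : V) : `|x| <= jap x.
Proof.
rewrite -(@ler_pXn2r _ 2) ?nnegrE ?normr_ge0 ?(ltW (jap_gt0 x)) //.
by rewrite jap_sqr (le_trans (norm_sqr_le_sqnorm x)) // lerDr.
Qed.

(* Dyadic balls: [jap x ^- q <= 2 ^ q * 2 ^- (m * q)] off the ball of radius [2 ^ m.-1]. *)
Lemma integrable_jap q : (n < q)%N -> mu.-integrable setT (EFin \o (fun x => (jap x ^+ q)^-1)).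
Proof.
move=> nq; have cj : continuous (fun x : V => (jap x ^+ q)^-1).
  apply: cont_inv; first by move=> x; rewrite expf_neq0 // gt_eqF // jap_gt0.
  exact: (@CkX _ _ 0 _ q (@continuous_jap R n)).
have j0 (x : V) : 0 <= (jap x ^+ q)^-1 by rewrite invr_ge0 exprn_ge0 // ltW // jap_gt0.
apply/integrableP; split; first by apply/measurable_EFinP; exact: continuous_measurable_mx.
pose c m : R := 2 ^+ q / (2 ^+ m) ^+ q.
have c0 m : 0 <= c m by rewrite divr_ge0 // !exprn_ge0.
pose g m (x : V) := ((c m)%:E * (\1_(ball (0 : V) (2 ^+ m)) x)%:E)%E.
have g0 m x : (0 <= g m x)%E by rewrite mule_ge0 ?lee_fin.
have mb m : measurable (ball (0 : V) (2 ^+ m)) by apply: open_measurable_mx; exact: ball_open.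
have mi m : measurable_fun setT (fun x : V => (\1_(ball (0 : V) (2 ^+ m)) x)%:E : \bar R).
  by apply/measurable_EFinP; exact: measurable_indic.
have mg m : measurable_fun setT (g m) by apply: emeasurable_funM.
have le x : ((jap x ^+ q)^-1%:E <= \sum_(0 <= m <oo) g m x)%E.
  have hb m : ball (0 : V) (2 ^+ m) x = (`|x| < 2 ^+ m) :> Prop by rewrite -ball_normE /= sub0r normrN.
  have ex : exists m, `|x| < 2 ^+ m.
    have [m _ hm] : \forall m \near \oo, `|x| < m%:R by exact: nbhs_infty_gtr.
    exists m; apply: lt_trans (hm m (leqnn m)) _.
    by rewrite -natrX ltr_nat ltn_expl.
  have [m hm min] := ex_minnP ex.
  have gm : g m x = (c m)%:E.
    by rewrite /g indicE mem_set ?mule1 // hb.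
  rewrite (@nneseriesD1 _ _ m predT) // gm; apply: le_trans (leeDl _ _); last first.
    by apply: nneseries_ge0.
  rewrite lee_fin /c ler_pdivlMr ?exprn_gt0 // mulrC ler_pdivrMr ?exprn_gt0 ?jap_gt0 // -exprMn.
  have jx := jap_ge1 x; rewrite lerXn2r // ?nnegrE ?exprn_ge0 //; first by lra.
  case: m hm min {gm} => [|k] _ min; first by rewrite expr0; lra.
  rewrite exprS ler_wpM2l //; apply: le_trans (norm_le_jap x).
  by rewrite leNgt; apply/negP => /min; rewrite ltnn.
have gi m : (\int[mu]_x g m x <= (2 ^+ (q + n).+1 / (2 ^ (m + 1))%:R)%:E)%E.
  rewrite /g ge0_integralZl ?lee_fin //.
  have -> : (\int[mu]_x (\1_(ball (0 : V) (2 ^+ m)) x)%:E = ((2 ^+ m *+ 2) ^+ n)%:E)%E.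
    by rewrite integral_indic // setIT; apply: lebN_ball; exact: exprn_gt0.
  rewrite -EFinM lee_fin /c.
  set X : R := 2 ^+ m; have X1 : 1 <= X by rewrite exprn_ege1 // ler1n.
  have X0 : 0 < X := lt_le_trans ltr01 X1.
  have -> : 2 ^+ (q + n).+1 / (2 ^ (m + 1))%:R = 2 ^+ q * 2 ^+ n * X^-1.
    by rewrite natrX addn1 !exprS -/X exprD; field; rewrite gt_eqF.
  rewrite -[X *+ 2]mulr_natr exprMn.
  have -> : 2 ^+ q / X ^+ q * (X ^+ n * 2 ^+ n) = 2 ^+ q * 2 ^+ n * (X ^+ n / X ^+ q) by ring.
  rewrite ler_wpM2l ?mulr_ge0 ?exprn_ge0 // ler_pdivrMr ?exprn_gt0 //.
  rewrite -(subnKC nq) exprD exprS !mulrA mulVf ?gt_eqF // mul1r ler_peMr ?exprn_ge0 ?(ltW X0) //.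
  exact: exprn_ege1.
rewrite (eq_integral (fun x => ((jap x ^+ q)^-1)%:E)); last by move=> x _ /=; rewrite ger0_norm.
apply: (@le_lt_trans _ _ (\int[mu]_x (\sum_(0 <= m <oo) g m x))%E).
  apply: ge0_le_integral => //.
  - by move=> x _; rewrite lee_fin.
  - by apply/measurable_EFinP; exact: continuous_measurable_mx.
  - by apply: ge0_emeasurable_sum => // m x _ _; exact: g0.
rewrite integral_nneseries //; apply: le_lt_trans (lee_nneseries _ (fun m _ => gi m)) _.
  by move=> m _ _; apply: integral_ge0.
have := @cvg_geometric_eseries_half R (2 ^+ (q + n).+1) 0.
by move/(cvg_lim (@ereal_hausdorff R)) => ->; rewrite ltry.
Qed.

Definition dec q (g : V -> R) := continuous g /\ exists C, forall x, `|g x| * jap x ^+ q <= C.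

Lemma dec_weaken q q' g : (q <= q')%N -> dec q' g -> dec q g.
Proof.
move=> qq [cg [C hC]]; split => //; exists C => x; apply: le_trans (hC x).
by rewrite ler_wpM2l // ler_weXn2l // jap_ge1.
Qed.

Lemma decD q f g : dec q f -> dec q g -> dec q (fun x => f x + g x).
Proof.
move=> [cf [C hC]] [cg [D hD]]; split; first exact: cont_add.
exists (C + D) => x; apply: le_trans (lerD (hC x) (hD x)).
by rewrite -mulrDl ler_wpM2r ?ler_normD // exprn_ge0 // ltW // jap_gt0.
Qed.

Lemma decM q q' f g : dec q f -> dec q' g -> dec (q + q') (fun x => f x * g x).
Proof.
move=> [cf [C hC]] [cg [D hD]]; split; first exact: cont_mul.
exists (C * D) => x; rewrite normrM exprD mulrACA.
by rewrite ler_pM // mulr_ge0 // exprn_ge0 // ltW // jap_gt0.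
Qed.

Lemma dec_cst c : dec 0 (cst c).
Proof. by split; [exact: (@Ck_cst R n 0)|exists `|c| => x; rewrite expr0 mulr1]. Qed.

Lemma decZ q c f : dec q f -> dec q (fun x => c * f x).
Proof. exact: (decM (dec_cst c)). Qed.

Lemma decN q f : dec q f -> dec q (fun x => - f x).
Proof. by move=> df; have := decZ (-1) df; under eq_fun do rewrite mulN1r. Qed.

Lemma dec_coord q k f : dec q.+1 f -> dec q (fun x => x ord0 k * f x).
Proof.
move=> [cf [C hC]]; split; first by apply: cont_mul => //; exact: (@Ck_coord R n 0).
exists C => x; apply: le_trans (hC x); rewrite normrM exprS [`|x _ _| * _]mulrC -mulrA.
by rewrite ler_wpM2l // ler_wpM2r ?abs_coord_le_jap // exprn_ge0 // ltW // jap_gt0.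
Qed.

Lemma dec_sum q (I : Type) (r : seq I) (f : I -> V -> R) :
  (forall i, dec q (f i)) -> dec q (fun x => \sum_(i <- r) f i x).
Proof.
move=> h; elim: r => [|i r IHr]; last by under eq_fun do rewrite big_cons; exact: decD.
under eq_fun do rewrite big_nil; split; first exact: (@Ck_cst R n 0).
by exists 0 => x; rewrite normr0 mul0r.
Qed.

Lemma dec_sqnorm q f : dec q.+2 f -> dec q (fun x => sqnorm x * f x).
Proof.
move=> df; have : dec q (fun x => \sum_k x ord0 k * (x ord0 k * f x)).
  by apply: dec_sum => k; do 2 apply: dec_coord.
congr (dec q _); apply/funext => x; rewrite mulr_suml; apply: eq_bigr => k _.
by rewrite mulrA.
Qed.

Lemma dec_int q f : (n < q)%N -> dec q f -> mu.-integrable setT (EFin \o f).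
Proof.
move=> nq [cf [C hC]]; have := intZ C (integrable_jap nq); apply: le_integrable => //.
  by apply/measurable_EFinP; exact: continuous_measurable_mx.
move=> x _ /=; rewrite lee_fin; apply: le_trans (ler_norm _).
by rewrite ler_pdivlMr ?exprn_gt0 ?jap_gt0.
Qed.

Lemma dec_L2c q f : (n < q + q)%N -> dec q f -> L2c f.
Proof.
move=> nq df; split; first exact: df.1.
have := dec_int nq (decM df df).
by apply: eq_integrable => // x _ /=; rewrite expr2.
Qed.

End Decay.

Section SmoothInD.
Context (R : realType) (n : nat).
Local Notation V := 'rV[R]_n.
Local Notation mu := (lebN R n).

Lemma continuous_borel_fun p q (f : V -> 'M[R]_(p, q)) : continuous f -> borel_fun f.
Proof. by move=> /continuousP cf B oB; apply: sub_sigma_algebra; exact: cf. Qed.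

Lemma L2c_L2m (f : V -> R) : L2c f -> L2m f.
Proof. by move=> [cf sf]; split => //; exact: continuous_measurable_mx. Qed.

Lemma cvg_nrm2_0 (I : finType) (f : nat -> I -> V -> R) (g : I -> V -> R) :
  (forall m i, measurable_fun setT (f m i)) -> (forall i, mu.-integrable setT (EFin \o g i)) ->
  (forall i x, f m i x @[m --> \oo] --> 0) -> (forall m i x, f m i x ^+ 2 <= g i x) ->
  nrm2 (f m) @[m --> \oo] --> 0.
Proof.
move=> mf ig cf fg; rewrite -[X in _ --> X](_ : \sum_(i : I) 0 = 0 :> R); last by rewrite big1.
apply: cvg_sumr => i.
have [|||| _] := @Rdominated_cvg _ _ R mu (fun m x => f m i x ^+ 2) (cst 0) (g i) _ _ _ (ig i).
- by move=> m; exact: measurable_funX.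
- exact: measurable_cst.
- move=> x /=; rewrite -[X in _ --> X](mulr0 (0 : R)).
  under eq_fun do rewrite expr2.
  by apply: cvgM; exact: cf.
- by move=> m x; rewrite ger0_norm ?sqr_ge0.
- by rewrite Rintegral_cst // mul0r.
Qed.

Lemma smooth_jacobianE (f : V -> V) x j k : smooth f -> Defs.jacobian f x j k = pd k (cf f j) x.
Proof. by move=> sf; rewrite mxE derive_mx ?mxE //; exact: (sf [::]).2. Qed.

(** The test fields are cut-offs of u. In their gradients the extra term u grad cutoff is dominated
    by C |u| and tends to 0 pointwise. *)
Lemma smooth_inD (u : V -> V) : (forall m l, Ck m (cf u l)) -> (forall l, L2c (cf u l)) ->
  (forall p, L2c (xcf u p)) -> (forall l k, L2c (pd k (cf u l))) -> inD u (Defs.jacobian u).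
Proof.
move=> cu lu lxu lpu; have su : smooth u := coord_Ck_smooth cu.
split; first by apply: continuous_borel_fun; exact: (su [::]).1.
split.
  apply: continuous_borel_fun; apply: continuous_mx => i j.
  rewrite (_ : (fun x => _) = pd j (cf u i)); first exact: (lpu i j).1.
  by apply/funext => x; exact: smooth_jacobianE.
pose phi m x := cutoff m x *: u x.
have phiE m l x : phi m x ord0 l = cutoff m x * cf u l x by rewrite mxE.
have sphi m : smooth (phi m).
  apply: coord_Ck_smooth => j l; under eq_fun do rewrite phiE.
  by apply: CkM; [exact: Ck_cutoff|exact: cu].
have pphi m l k x : pd k (cf (phi m) l) x = cutoff m x * pd k (cf u l) x + cf u l x * pd k (cutoff m) x.
  rewrite (_ : cf (phi m) l = (fun x => cutoff m x * cf u l x)); last by apply/funext => y; exact: phiE.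
  by rewrite (has_pdE (has_pdM (CkS_has_pd k (@Ck_cutoff R n 1 m)) (CkS_has_pd k (cu 1%N l)))).
have [C [C0 hC]] := @pd_cutoff_bound R n.
pose d1 m l (x : V) := cf (phi m) l x - cf u l x.
pose d2 m p (x : V) := xcf (phi m) p x - xcf u p x.
pose d3 m p (x : V) := mcf (Defs.jacobian (phi m)) p x - mcf (Defs.jacobian u) p x.
have d1E m l x : d1 m l x = (cutoff m x - 1) * cf u l x by rewrite /d1 /cf phiE mulrBl mul1r.
have d2E m p x : d2 m p x = (cutoff m x - 1) * xcf u p x.
  by rewrite /d2 /xcf phiE /cf; ring.
have d3E m p x : d3 m p x = (cutoff m x - 1) * pd p.2 (cf u p.1) x + cf u p.1 x * pd p.2 (cutoff m) x.
  by rewrite /d3 /mcf (smooth_jacobianE x p.1 p.2 (sphi m)) (smooth_jacobianE x p.1 p.2 su) pphi; ring.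
have cc m : continuous (fun x : V => cutoff m x - 1).
  by apply: (@CkB _ _ 0); [exact: (@Ck_cutoff R n 0)|exact: (@Ck_cst R n 0)].
have cut1 m (x : V) : (cutoff m x - 1) ^+ 2 <= 1.
  by have /andP[] := cutoff_01 m x; nra.
have b12 m (x : V) (y : R) : ((cutoff m x - 1) * y) ^+ 2 <= y ^+ 2 by rewrite exprMn ler_piMl ?sqr_ge0.
have c0 (x : V) : cutoff m x - 1 @[m --> \oo] --> (0 : R).
  by rewrite -[X in _ --> X](subrr 1); apply: cvgB; [exact: cvg_cutoff|exact: cvg_cst].
have c0M (x : V) (y : R) : (cutoff m x - 1) * y @[m --> \oo] --> (0 : R).
  by rewrite -[X in _ --> X](mul0r y); apply: cvgM => //; exact: cvg_cst.
have cpc m k : continuous (pd k (@cutoff R n m)) by exact: (CkS_pd k (@Ck_cutoff R n 1 m)).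
have L1 m l : measurable_fun setT (d1 m l).
  rewrite (_ : d1 m l = (fun x => (cutoff m x - 1) * cf u l x)); last by apply/funext => x; exact: d1E.
  by apply: continuous_measurable_mx; apply: cont_mul => //; exact: (lu l).1.
have L2 m p : measurable_fun setT (d2 m p).
  rewrite (_ : d2 m p = (fun x => (cutoff m x - 1) * xcf u p x)); last by apply/funext => x; exact: d2E.
  by apply: continuous_measurable_mx; apply: cont_mul => //; exact: (lxu p).1.
have L3 m p : measurable_fun setT (d3 m p).
  rewrite (_ : d3 m p = (fun x => (cutoff m x - 1) * pd p.2 (cf u p.1) x + cf u p.1 x * pd p.2 (cutoff m) x)); last by apply/funext => x; exact: d3E.
  apply: continuous_measurable_mx; apply: cont_add; apply: cont_mul => //; first exact: (lpu _ _).1.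
  exact: (lu _).1.
pose G3 (p : 'I_n * 'I_n) x := 2 * pd p.2 (cf u p.1) x ^+ 2 + 2 * C ^+ 2 * cf u p.1 x ^+ 2.
have iG3 p : mu.-integrable setT (EFin \o G3 p).
  by apply: intD; apply: intZ; [exact: (lpu _ _).2|exact: (lu _).2].
have b1 m l x : d1 m l x ^+ 2 <= cf u l x ^+ 2 by rewrite d1E.
have b2 m p x : d2 m p x ^+ 2 <= xcf u p x ^+ 2 by rewrite d2E.
have b3 m p x : d3 m p x ^+ 2 <= G3 p x.
  rewrite d3E /G3; have h1 := b12 m x (pd p.2 (cf u p.1) x).
  have h2 : (pd p.2 (cutoff m) x) ^+ 2 <= C ^+ 2.
    rewrite -real_normK ?num_real // lerXn2r // ?nnegrE //; have [h _] := hC m p.2 x.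
    by apply: le_trans h _; rewrite ler_pdivrMr ?jap_gt0 // ler_peMr // jap_ge1.
  have := ler_wpM2r (sqr_ge0 (cf u p.1 x)) h2; rewrite -exprMn.
  set a := (cutoff m x - 1) * _ in h1 *; set b : R := cf u p.1 x; set c := pd p.2 (cutoff m) x => h3.
  rewrite (_ : (a + b * c) ^+ 2 = 2 * a ^+ 2 + 2 * (c * b) ^+ 2 - (a - b * c) ^+ 2); last by ring.
  by have := sqr_ge0 (a - b * c); move: h1 h3; lra.
have t1 := cvg_nrm2_0 L1 (fun l => (lu l).2) _ b1.
have t2 := cvg_nrm2_0 L2 (fun p => (lxu p).2) _ b2.
have t3 := cvg_nrm2_0 L3 iG3 _ b3.
have sq (I : finType) (f : I -> V -> R) (g : I -> V -> R) : (forall i, measurable_fun setT (f i)) ->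
    (forall i, mu.-integrable setT (EFin \o g i)) -> (forall i x, f i x ^+ 2 <= g i x) -> forall i, L2m (f i).
  move=> mf ig fg i; split => //; apply: le_integrable (ig i) => //.
    by apply/measurable_EFinP; exact: measurable_funX.
  by move=> x _ /=; rewrite lee_fin ger0_norm ?sqr_ge0 // (le_trans (fg i x)) // ler_norm.
exists phi; split.
  move=> m; split; [exact: sphi|exists m.+1%:R => x rx].
  by rewrite /phi cutoff_support // scale0r.
rewrite (_ : (fun m => _) = (fun m => (nrm2 (d1 m) + nrm2 (d2 m) + nrm2 (d3 m))%:E)); last first.
  apply/funext => m; rewrite Ddist2E (iint_sumsq_L2m (sq _ _ _ (L1 m) (fun l => (lu l).2) (b1 m))).
  by rewrite (iint_sumsq_L2m (sq _ _ _ (L2 m) (fun l => (lxu l).2) (b2 m))) (iint_sumsq_L2m (sq _ _ _ (L3 m) iG3 (b3 m))).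
apply: cvg_EFin; first exact: nearW.
rewrite -[X in _ --> X](addr0 (0 : R)) -[X in _ --> X + _](addr0 (0 : R)).
apply: cvgD; first apply: cvgD.
- by apply: t1 => l x; under eq_fun do rewrite d1E; exact: c0M.
- by apply: t2 => l x; under eq_fun do rewrite d2E; exact: c0M.
apply: t3 => p x; rewrite (_ : (fun m => d3 m p x) = (fun m => (cutoff m x - 1) * pd p.2 (cf u p.1) x
  + cf u p.1 x * pd p.2 (cutoff m) x)); last by apply/funext => m; exact: d3E.
rewrite -[X in _ --> X](addr0 (0 : R)); apply: cvgD; first exact: c0M.
rewrite -[X in _ --> X](mulr0 (cf u p.1 x)); apply: cvgM; first exact: cvg_cst.
exact: cvg_pd_cutoff.
Qed.

End SmoothInD.

(** * Euler-Lagrange equation and energy of the extremal field *)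

Section Extremizer.
Context (R : realType) (n : nat).
Local Notation V := 'rV[R]_n.
Local Notation mu := (lebN R n).
Local Notation N := (n%:R : R).
Local Notation t := (@sqnorm R n).
Variables (a : R) (i0 : 'I_n) (j : nat).
Local Notation A := (1 - a / 2).
Local Notation B := (N / 2).
Hypothesis A0 : 0 < A.
Hypothesis A1 : A <= 1.
Hypothesis AB : A < B.
Hypothesis ha : a * (a + N - 2) = 2.
(** The integer j measures decay: [rk k] is of order |x|^-(2j + 2k), so x u is of order |x|^-(2j +
    1), which is square integrable when 4 j + 2 > n. *)
Hypothesis j0 : (0 < j)%N.
Hypothesis jB : j%:R <= B - A.
Hypothesis nj : (n < 4 * j + 2)%N.

(** The half in the argument makes [rk k.+1] x the gradient of [rk k]. *)
Definition rk k (x : V) : R := kseq A B k (sqnorm x / 2).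

Lemma Ck_rk m k : Ck m (rk k).
Proof.
apply: (@Ck_comp R n (kseq A B) k m (fun x => sqnorm x / 2)) => [i s|]; first exact: is_derive_kseq.
by apply: CkM; [exact: Ck_sqnorm|exact: (@Ck_cst R n m 2^-1)].
Qed.

Lemma radial_rk k : radial (rk k) (rk k.+1).
Proof.
move=> l.
have d : has_pd l (fun x : V => sqnorm x / 2) (fun x => x ord0 l).
  apply: has_pd_eq (has_pdM (has_pd_sqnorm l) (has_pd_cst l 2^-1)) _ _ => // x /=.
  by rewrite mulr0 add0r; field.
exact: (@has_pd_comp R n l (kseq A B k) (kseq A B k.+1) _ _ (fun s => is_derive_kseq A0 k s AB) d).
Qed.

Lemma rk_ode k x : t x * rk k.+2 x + (N + 2 * k%:R + t x) * rk k.+1 x + (a + N - 2 + 2 * k%:R) * rk k x = 0.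
Proof.
have h := kseq_ode A0 k (sqnorm x / 2) AB; rewrite -[RHS](mulr0 2) -h /rk.
by field.
Qed.

Lemma dec_rk k : dec (2 * (j + k)) (rk k).
Proof.
split; first exact: (Ck_rk 0).
have [C hC] := kseq_decay A0 A1 k AB j0 jB; exists C => x.
have s0 : 0 <= sqnorm x / 2 by rewrite divr_ge0 // sqnorm_ge0.
apply: le_trans (hC _ s0); rewrite exprM jap_sqr mulrC.
by rewrite (_ : 2 * (sqnorm x / 2) = sqnorm x) //; field.
Qed.

Lemma dec_rkW q k : (q <= 2 * (j + k))%N -> dec q (rk k).
Proof. by move=> h; apply: dec_weaken h (dec_rk k). Qed.

(** With h = [rk 0], the field [eu] below is the derivative of grad h along e_{i0} minus (Laplace h)
    e_{i0}, whence its zero divergence; [ep] is [rk 1] - Laplace h. [ep1] and [ep2] are its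
    successive radial derivatives over r, and [epi] is the radial factor of the pressure. *)
Definition ep x := - ((N - 1) * rk 1 x + t x * rk 2 x).
Definition ep1 x := - ((N + 1) * rk 2 x + t x * rk 3 x).
Definition ep2 x := - ((N + 3) * rk 3 x + t x * rk 4 x).
Definition epi x := t x * rk 1 x + t x * rk 2 x - 2 * rk 0 x + (N + a - (N + 2 * a)) * rk 1 x.
Definition epi1 x := t x * rk 2 x + t x * rk 3 x + (4 + (N + a - 2) - (N + 2 * a)) * rk 2 x.

Lemma radial_lin c f f1 g g1 : radial f f1 -> radial g g1 ->
  radial (fun x : V => - (c * f x + t x * g x)) (fun x => - (c * f1 x + (2 * g x + t x * g1 x))).
Proof.
move=> hf hg.
have h := radialM (@radial_cst R n (-1)) (radialD (radialM (@radial_cst R n c) hf) (radialM (@radial_sqnorm R n) hg)).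
by apply: (radial_eq h) => x /=; ring.
Qed.

Lemma radial_ep : radial ep ep1.
Proof. by apply: (radial_eq (radial_lin (N - 1) (radial_rk 1) (radial_rk 2))) => x //; rewrite /ep1; ring. Qed.

Lemma radial_ep1 : radial ep1 ep2.
Proof. by apply: (radial_eq (radial_lin (N + 1) (radial_rk 2) (radial_rk 3))) => x //; rewrite /ep2; ring. Qed.

Lemma radial_epi : radial epi epi1.
Proof.
have rt := @radial_sqnorm R n.
have h := radialD (radialD (radialD (radialM rt (radial_rk 1)) (radialM rt (radial_rk 2)))
  (radialM (@radial_cst R n (-2)) (radial_rk 0))) (radialM (@radial_cst R n (N + a - (N + 2 * a))) (radial_rk 1)).
by apply: (radial_eq h) => x /=; rewrite /epi /epi1; ring.
Qed.

Local Notation dl i k := ((i == k)%:R : R).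

(* [eu] is the extremal field e_{i0} p + x_{i0} x w, with w = rk 2 and p = ep; [eB]
   and [eC] are its first and pure second partial derivatives, [eP] its pressure. *)
Definition eu i (x : V) := dl i i0 * ep x + x ord0 i0 * x ord0 i * rk 2 x.
Definition eB i k (x : V) := dl i i0 * (ep1 x * x ord0 k) + (dl i0 k * x ord0 i + x ord0 i0 * dl i k) * rk 2 x
  + x ord0 i0 * x ord0 i * (rk 3 x * x ord0 k).
Definition eC i k (x : V) := dl i i0 * (ep2 x * x ord0 k ^+ 2 + ep1 x)
  + 2 * ((dl i0 k * x ord0 i + x ord0 i0 * dl i k) * (rk 3 x * x ord0 k)) + 2 * (dl i0 k * dl i k) * rk 2 x
  + x ord0 i0 * x ord0 i * (rk 3 x + rk 4 x * x ord0 k ^+ 2).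
Definition eP (x : V) := x ord0 i0 * epi x.
Definition edP k (x : V) := dl i0 k * epi x + x ord0 i0 * (epi1 x * x ord0 k).

Lemma has_pd_eu i k : has_pd k (eu i) (eB i k).
Proof.
have h := has_pdD (has_pdM (has_pd_cst k (dl i i0)) (radial_ep k))
  (has_pdM (has_pdM (has_pd_coord k i0) (has_pd_coord k i)) (radial_rk 2 k)).
by apply: (has_pd_eq h) => x //=; rewrite /eB; ring.
Qed.

Lemma has_pd_eB i k : has_pd k (eB i k) (eC i k).
Proof.
have h := has_pdD (has_pdD (has_pdM (has_pd_cst k (dl i i0)) (has_pdM (radial_ep1 k) (has_pd_coord k k)))
  (has_pdM (has_pdD (has_pdM (has_pd_cst k (dl i0 k)) (has_pd_coord k i)) (has_pdM (has_pd_coord k i0) (has_pd_cst k (dl i k))))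
     (radial_rk 2 k)))
  (has_pdM (has_pdM (has_pd_coord k i0) (has_pd_coord k i)) (has_pdM (radial_rk 3 k) (has_pd_coord k k))).
by apply: (has_pd_eq h) => x //=; rewrite /eC eqxx -[(true%:R : R)]/(1 : R); ring.
Qed.

Lemma has_pd_eP k : has_pd k eP (edP k).
Proof.
have h := has_pdM (has_pd_coord k i0) (radial_epi k).
by apply: (has_pd_eq h) => x //=; rewrite /edP; ring.
Qed.

Lemma sum_dl (F : 'I_n -> R) i : \sum_k dl i k * F k = F i.
Proof.
rewrite (bigD1 i) //= eqxx mul1r big1 ?addr0 // => k; rewrite eq_sym => /negbTE ->.
by rewrite mul0r.
Qed.

Lemma div_eu x : \sum_k eB k k x = 0.
Proof.
rewrite /eB !big_split /=.
have -> : \sum_(i < n) dl i i0 * (ep1 x * x ord0 i) = ep1 x * x ord0 i0.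
  by under eq_bigr do rewrite eq_sym; exact: sum_dl.
have -> : \sum_(i < n) (dl i0 i * x ord0 i + x ord0 i0 * dl i i) * rk 2 x = (N + 1) * x ord0 i0 * rk 2 x.
  rewrite -mulr_suml; congr (_ * _); rewrite big_split /= sum_dl.
  rewrite (eq_bigr (fun=> x ord0 i0)) => [|i _]; last by rewrite eqxx mulr1.
  by rewrite sumr_const card_ord -mulr_natl; ring.
have -> : \sum_(i < n) x ord0 i0 * x ord0 i * (rk 3 x * x ord0 i) = x ord0 i0 * rk 3 x * t x.
  by rewrite /sqnorm mulr_sumr; apply: eq_bigr => i _; ring.
by rewrite /ep1; ring.
Qed.

Lemma euler_lagrange i x : \sum_k eC i k x = t x * eu i x - (N + 2 * a) * eu i x - edP i x.
Proof.
have -> : \sum_k eC i k x = dl i i0 * (t x * ep2 x + N * ep1 x + 2 * rk 2 x)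
   + x ord0 i0 * x ord0 i * ((N + 4) * rk 3 x + t x * rk 4 x).
  rewrite /eC !big_split /=.
  have -> : \sum_k dl i i0 * (ep2 x * x ord0 k ^+ 2 + ep1 x) = dl i i0 * (t x * ep2 x + N * ep1 x).
    rewrite -mulr_sumr big_split /= -mulr_sumr -/(sqnorm x) sumr_const card_ord -mulr_natl.
    by ring.
  have -> : \sum_k 2 * ((dl i0 k * x ord0 i + x ord0 i0 * dl i k) * (rk 3 x * x ord0 k)) =
      4 * (x ord0 i0 * x ord0 i * rk 3 x).
    rewrite -mulr_sumr (eq_bigr (fun k => dl i0 k * (x ord0 i * (rk 3 x * x ord0 k)) + dl i k * (x ord0 i0 * (rk 3 x * x ord0 k)))).
      by rewrite big_split /= !sum_dl; ring.
    by move=> k _; ring.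
  have -> : \sum_k 2 * (dl i0 k * dl i k) * rk 2 x = 2 * dl i i0 * rk 2 x.
    rewrite (eq_bigr (fun k => dl i0 k * (2 * dl i k * rk 2 x))) => [|k _]; last by ring.
    by rewrite sum_dl.
  have -> : \sum_(k < n) x ord0 i0 * x ord0 i * (rk 3 x + rk 4 x * x ord0 k ^+ 2) =
      x ord0 i0 * x ord0 i * (N * rk 3 x + rk 4 x * t x).
    rewrite (eq_bigr (fun k => x ord0 i0 * x ord0 i * rk 3 x + x ord0 i0 * x ord0 i * rk 4 x * x ord0 k ^+ 2)).
      by rewrite big_split /= sumr_const card_ord -mulr_sumr -/(sqnorm x) -mulr_natl; ring.
    by move=> k _; ring.
  by ring.
have E0 := rk_ode 0 x; have E1 := rk_ode 1 x; have E2 := rk_ode 2 x.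
(* The equation splits into a component along x_{i0} x, which is [rk_ode] for k = 2, and one along
   e_{i0}. *)
have xx : (N + 4) * rk 3 x + t x * rk 4 x = t x * rk 2 x - (N + 2 * a) * rk 2 x - epi1 x.
  by rewrite /epi1; move: E2; set r2 := rk 2 x; set r3 := rk 3 x; set r4 := rk 4 x; lra.
(* A combination of the equations for k = 2, 1, 0 with multipliers - t, 1 - N + t and - a. What is
   left is a multiple of [rk 0] with factor a (a + N - 2) - 2: the choice of a enters here. *)
have dd : t x * ep2 x + N * ep1 x + 2 * rk 2 x = t x * ep x - (N + 2 * a) * ep x - epi x.
  apply/eqP; rewrite -subr_eq0.
  rewrite (_ : _ - _ = - t x * (t x * rk 4 x + (N + 2 * 2 + t x) * rk 3 x + (a + N - 2 + 2 * 2) * rk 2 x)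
    + (1 - N + t x) * (t x * rk 3 x + (N + 2 * 1 + t x) * rk 2 x + (a + N - 2 + 2 * 1) * rk 1 x)
    - a * (t x * rk 2 x + (N + 2 * 0 + t x) * rk 1 x + (a + N - 2 + 2 * 0) * rk 0 x)
    + (a * (a + N - 2) - 2) * rk 0 x); last by rewrite /ep2 /ep1 /ep /epi; ring.
  by rewrite E2 E1 E0 ha; apply/eqP; ring.
rewrite xx dd /eu /edP [i0 == i]eq_sym; ring.
Qed.

Lemma Ck_eu m i : Ck m (eu i).
Proof.
have h := Ck_rk m; have hc k := @Ck_coord R n m k.
apply: CkD; last by apply: CkM => //; exact: CkM.
by apply: CkMl; apply: CkN; apply: CkD; [exact: CkMl|apply: CkM => //; exact: Ck_sqnorm].
Qed.

Lemma Ck_eP m : Ck m eP.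
Proof.
have h := Ck_rk m; have hs := @Ck_sqnorm R n m.
apply: CkM; first exact: Ck_coord.
by apply: CkD; [apply: CkB; [apply: CkD; exact: CkM|exact: CkMl]|exact: CkMl].
Qed.

Lemma pd_eu i k : pd k (eu i) = eB i k.
Proof. exact: has_pdE (has_pd_eu i k). Qed.

Lemma Ck_eB m i k : Ck m (eB i k).
Proof. by rewrite -pd_eu; apply: CkS_pd; exact: Ck_eu. Qed.

Lemma dec_eu i : dec (2 * j + 2) (eu i).
Proof.
apply: decD.
  apply: decZ; apply: decN; apply: decD; first by apply: decZ; apply: dec_rkW; lia.
  by apply: dec_sqnorm; apply: dec_rkW; lia.
under eq_fun do rewrite -mulrA.
by do 2 apply: dec_coord; apply: dec_rkW; lia.
Qed.

Lemma dec_eB i k : dec (2 * j + 2) (eB i k).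
Proof.
have d1 : dec (2 * j + 3) ep1.
  apply: decN; apply: decD; first by apply: decZ; apply: dec_rkW; lia.
  by apply: dec_sqnorm; apply: dec_rkW; lia.
have d2 l : dec (2 * j + 2) (fun x : V => x ord0 l * rk 2 x).
  by apply: dec_coord; apply: dec_rkW; lia.
have e : eB i k = (fun x => dl i i0 * (x ord0 k * ep1 x) + (dl i0 k * (x ord0 i * rk 2 x) + dl i k * (x ord0 i0 * rk 2 x))
    + x ord0 i0 * (x ord0 i * (x ord0 k * rk 3 x))).
  by apply/funext => x; rewrite /eB; ring.
rewrite e; apply: decD.
  apply: decD; first by apply: decZ; apply: dec_coord; apply: dec_weaken d1; lia.
  by apply: decD; apply: decZ; exact: d2.
by do 3 apply: dec_coord; apply: dec_rkW; lia.
Qed.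

Lemma dec_eP : dec (2 * j - 1) eP.
Proof.
apply: dec_coord; apply: decD; last by apply: decZ; apply: dec_rkW; lia.
apply: decD.
  by apply: decD; apply: dec_sqnorm; apply: dec_rkW; lia.
rewrite (_ : (fun x => _) = (fun x => (-2) * rk 0 x)); last by apply/funext => x; ring.
by apply: decZ; apply: dec_rkW; lia.
Qed.

Lemma L2c_eu i : L2c (eu i).
Proof. by apply: dec_L2c (dec_eu i); lia. Qed.

Lemma L2c_eB i k : L2c (eB i k).
Proof. by apply: dec_L2c (dec_eB i k); lia. Qed.

Lemma L2c_xeu i k : L2c (fun x : V => x ord0 k * eu i x).
Proof.
have d : dec (2 * j + 1) (fun x : V => x ord0 k * eu i x).
  by apply: dec_coord; apply: dec_weaken (dec_eu i); lia.
by apply: dec_L2c d; lia.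
Qed.

Lemma energy_identity :
  nrm2 (fun p : 'I_n * 'I_n => eB p.1 p.2) + nrm2 (fun p : 'I_n * 'I_n => fun x => x ord0 p.2 * eu p.1 x) =
  (N + 2 * a) * nrm2 eu.
Proof.
(* As div u = 0, the divergence is |grad u|^2 + u . (Laplace u + grad P). The pressure decays
   slowest: F is of order |x|^-(4j + 1), and the weight 1 / jap of [integral_div0] provides the
   missing power for 4 j + 2 > n. *)
pose F k x := \sum_i eu i x * eB i k x + eu k x * eP x.
have cF k : Ck 1 (F k).
  apply: CkD; last by apply: CkM; [exact: Ck_eu|exact: Ck_eP].
  by apply: Ck_sum => i _; apply: CkM; [exact: Ck_eu|exact: Ck_eB].
have dF k : dec (4 * j + 1) (F k).
  apply: decD.
    by apply: dec_sum => i; apply: dec_weaken (decM (dec_eu i) (dec_eB i k)); lia.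
  by apply: dec_weaken (decM (dec_eu k) dec_eP); lia.
have dj : dec 1 (fun x : V => (jap x)^-1).
  split; first by apply: cont_inv; [move=> x; rewrite gt_eqF // jap_gt0|exact: continuous_jap].
  exists 1 => x; by rewrite normfV ger0_norm ?(ltW (jap_gt0 x)) // expr1 mulVf // gt_eqF // jap_gt0.
have iF k : mu.-integrable setT (EFin \o (fun x => F k x / jap x)).
  by apply: dec_int (decM (dF k) dj); lia.
have iB p : mu.-integrable setT (EFin \o (fun x => eB p.1 p.2 x ^+ 2)) by exact: (L2c_eB p.1 p.2).2.
have ix (p : 'I_n * 'I_n) : mu.-integrable setT (EFin \o (fun x : V => (x ord0 p.2 * eu p.1 x) ^+ 2)) := (L2c_xeu p.1 p.2).2.
have iu i : mu.-integrable setT (EFin \o (fun x => eu i x ^+ 2)) := (L2c_eu i).2.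
have pF k : has_pd k (F k) (fun x => \sum_i (eu i x * eC i k x + eB i k x * eB i k x) + (eu k x * edP k x + eP x * eB k k x)).
  apply: has_pdD; last by apply: has_pdM; [exact: has_pd_eu|exact: has_pd_eP].
  exact: (@has_pd_sum _ _ k _ (index_enum 'I_n) predT _ _ (fun i _ => has_pdM (has_pd_eu i k) (has_pd_eB i k))).
have divF x : \sum_k pd k (F k) x = \sum_p eB p.1 p.2 x ^+ 2 + \sum_(p : 'I_n * 'I_n) (x ord0 p.2 * eu p.1 x) ^+ 2
    - (N + 2 * a) * \sum_i eu i x ^+ 2.
  under eq_bigr do rewrite (has_pdE (pF _)).
  rewrite !big_split /= -mulr_sumr div_eu mulr0 addr0 exchange_big /=.
  under eq_bigr do rewrite big_split /= -mulr_sumr euler_lagrange.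
  rewrite big_split /= -(pair_bigA _ (fun i k => eB i k x ^+ 2)) -(pair_bigA _ (fun i k => (x ord0 k * eu i x) ^+ 2)) /=.
  have -> : \sum_i \sum_(k < n) (x ord0 k * eu i x) ^+ 2 = \sum_i t x * eu i x ^+ 2.
    by apply: eq_bigr => i _; rewrite mulr_suml; apply: eq_bigr => k _; rewrite exprMn.
  have -> : \sum_i \sum_k eB i k x * eB i k x = \sum_i \sum_k eB i k x ^+ 2.
    by apply: eq_bigr => i _; apply: eq_bigr => k _; rewrite expr2.
  have -> : \sum_i eu i x * (t x * eu i x - (N + 2 * a) * eu i x - edP i x) =
     \sum_i t x * eu i x ^+ 2 - (N + 2 * a) * \sum_i eu i x ^+ 2 - \sum_i eu i x * edP i x.
    by rewrite mulr_sumr -!sumrB; apply: eq_bigr => i _; ring.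
  by ring.
have i1 := int_sum (index_enum ('I_n * 'I_n)%type) iB.
have i2 := int_sum (index_enum ('I_n * 'I_n)%type) ix.
have i3 := intZ (N + 2 * a) (int_sum (index_enum 'I_n) iu).
have iD : mu.-integrable setT (EFin \o (fun x => \sum_k pd k (F k) x)).
  apply: eq_integrable (intB (intD i1 i2) i3) => // x _ /=.
  by rewrite divF.
have := integral_div0 cF iF iD; under eq_Rintegral do rewrite divF.
rewrite (RintegralB measurableT (intD i1 i2) i3) (RintegralD measurableT i1 i2).
rewrite (RintegralZl _ measurableT (int_sum (index_enum 'I_n) iu)).
rewrite (Rint_sum _ iB) (Rint_sum _ ix) (Rint_sum _ iu) => /eqP.
by rewrite subr_eq0 => /eqP.
Qed.

(** A nonzero value, which makes the mass of the field positive. *)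
Lemma eu_at0 : eu i0 0 = (N - 1) * ((B - A) / B).
Proof.
rewrite /eu eqxx mxE mul0r mul0r addr0 mul1r /ep.
have -> : t 0 = 0 by rewrite /sqnorm big1 // => i _; rewrite mxE expr0n.
have -> : rk 1 0 = - ((B - A) / B).
  by rewrite /rk (_ : sqnorm 0 / 2 = 0) ?kseq1_0 // /sqnorm big1 ?mul0r // => i _; rewrite mxE expr0n.
by ring.
Qed.

End Extremizer.

(** * Attainment of the constant *)

Section Attained.
Context (R : realType) (n : nat).
Local Notation V := 'rV[R]_n.
Local Notation mu := (lebN R n).

Lemma continuous_int_gt0 (f : V -> R) x : continuous f -> (forall y, 0 <= f y) -> 0 < f x ->
  (0 < \int[mu]_y (f y)%:E)%E.
Proof.
move=> cf f0 fx; have fx2 : 0 < f x / 2 by rewrite divr_gt0.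
have /cvgrPdist_lt/(_ _ fx2)/nbhs_ballP[d /= d0 hd] := cf x.
pose g y := ((f x / 2)%:E * (\1_(ball x d) y)%:E)%E.
have mb : measurable (ball x d : set V) by apply: open_measurable_mx; exact: ball_open.
have mi : measurable_fun setT (fun y : V => (\1_(ball x d) y)%:E : \bar R).
  by apply/measurable_EFinP; exact: measurable_indic.
apply: (@lt_le_trans _ _ (\int[mu]_y g y)%E).
  rewrite /g ge0_integralZl ?lee_fin ?(ltW fx2) //.
  have -> : (\int[mu]_y (\1_(ball x d) y)%:E = ((d *+ 2) ^+ n)%:E)%E.
    by rewrite integral_indic // setIT; exact: lebN_ball.
  by rewrite -EFinM lte_fin mulr_gt0 // exprn_gt0 // pmulrn_lgt0.
apply: ge0_le_integral => //.
- by move=> y _; rewrite /g mule_ge0 ?lee_fin // ltW.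
- exact: emeasurable_funM.
- by apply/measurable_EFinP; exact: continuous_measurable_mx.
move=> y _; rewrite /g indicE; have [yb|yb] := boolP (y \in (ball x d : set V)).
  rewrite mule1 lee_fin; have := hd y (set_mem yb); rewrite ltr_norml => /andP[_ h].
  lra.
by rewrite mule0 lee_fin.
Qed.

Lemma smooth_scalar_Ck (f : V -> R) m : smooth (f : V -> R^o) -> Ck m f.
Proof.
move=> sf; suff h ks : Ck m (iter_partial ks (f : V -> R^o)) by exact: (h [::]).
elim: m ks => [|m IHm] ks; first exact: (sf ks).1.
split; first exact: (sf ks).1.
by move=> k; split; [move=> x; exact: (sf ks).2|exact: (IHm (k :: ks))].
Qed.

Lemma div0_solenoidal (u : V -> V) : (forall l, Ck 1 (cf u l)) -> (forall x, \sum_l pd l (cf u l) x = 0) ->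
  solenoidal u.
Proof.
move=> cu du psi [spsi kpsi]; have cpsi m : Cc m psi by split; [exact: smooth_scalar_Ck|].
have i1 l : mu.-integrable setT (EFin \o (fun x => cf u l x * pd l psi x)).
  by apply: (@Cc_int _ _ 0); apply: Cc_mull; [exact: CcS_pd|exact: Ck_continuous (cu l)].
have i2 l : mu.-integrable setT (EFin \o (fun x => psi x * pd l (cf u l) x)).
  by apply: (@Cc_int _ _ 0); apply: Cc_mulr; [exact: cpsi|exact: (CkS_pd l (cu l))].
have i1s := int_sum (index_enum 'I_n) i1; have i2s := int_sum (index_enum 'I_n) i2.
have -> : iint (fun x => (\sum_(j < n) u x ord0 j * derive psi x (evec R j))%:E) =
    (\int[mu]_x (\sum_l cf u l x * pd l psi x)%:E)%E by exact: integrable_iintE i1s.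
rewrite -[LHS]fineK; last exact: integrable_fin_num i1s.
congr EFin; rewrite -/(Rintegral _ _ _).
have -> : \int[mu]_x (\sum_l cf u l x * pd l psi x) =
    \int[mu]_x (\sum_l cf u l x * pd l psi x) + \int[mu]_x (\sum_l psi x * pd l (cf u l) x).
  rewrite [X in _ + X](_ : _ = 0) ?addr0 //.
  under eq_Rintegral do rewrite -mulr_sumr du mulr0.
  by rewrite Rintegral_cst // mul0r.
rewrite -(RintegralD measurableT i1s i2s).
have i12 l : mu.-integrable setT (EFin \o (fun x => cf u l x * pd l psi x + psi x * pd l (cf u l) x)) := intD (i1 l) (i2 l).
under eq_Rintegral do rewrite -big_split /=.
rewrite (Rint_sum _ i12) big1 // => l _.
have h := integral_pd_compact l (CkM (cu l) (cpsi 1%N).1) (Cc_mull (cpsi 0%N) (Ck_continuous (cu l))).2.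
rewrite -[RHS](_ : fine (0%E : \bar R) = 0) // -h /Rintegral; congr fine; apply: eq_integral => x _.
by rewrite (has_pdE (has_pdM (CkS_has_pd l (cu l)) (CkS_has_pd l (cpsi 1%N).1))).
Qed.

Lemma uncertainty_attained : (3 <= n)%N -> exists (u : V -> V) (G : V -> 'M[R]_n),
  [/\ inD u G, solenoidal u, (0 < mass2 u)%E &
   (grad2 G * mom2 u = (CN R n)%:E * (mass2 u * mass2 u))%E].
Proof.
move=> n3; have [a0 ha h4 hCN] := @sharp_exponent R n n3.
move: a0 ha h4 hCN; set a := _ / 2 => a0 ha h4 hCN.
have N3 : 3 <= n%:R :> R by rewrite ler_nat.
have a1 : a <= 1.
  rewrite leNgt; apply/negP => a1.
  have : 1 * (1 + n%:R - 2) < a * (a + n%:R - 2) by apply: ltr_pM; lra.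
  by rewrite ha; lra.
have A0 : 0 < 1 - a / 2 by lra.
have A1 : 1 - a / 2 <= 1 by lra.
have AB : 1 - a / 2 < n%:R / 2 by lra.
(* j has to be at least 1, larger than (n - 2) / 4 and at most (n - 2 + a) / 2. For n = 3 only j = 1
   is possible, and it is admissible because [h4] then gives a >= 1. *)
pose j := maxn 1 n./2.-1.
have j0 : (0 < j)%N by rewrite leq_max.
have nj : (n < 4 * j + 2)%N by rewrite /j; lia.
have jB : j%:R <= n%:R / 2 - (1 - a / 2).
  have [n4|n4] := leqP 4 n.
    have : (2 * j <= n - 2)%N by rewrite /j; lia.
    rewrite -(ler_nat R) natrM natrB ?(ltnW n3) // => h; lra.
  have n3' : n = 3%N by lia.
  have -> : j = 1%N by rewrite /j n3'.
  move: h4; rewrite n3' => h4; lra.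
have i0 : 'I_n := Ordinal (ltnW (ltnW n3)).
pose e := eu a i0; pose u x := \row_l e l x.
have ue l : cf u l = e l by apply/funext => x; rewrite /cf mxE.
have cu m l : Ck m (cf u l) by rewrite ue; exact: Ck_eu.
have pu l k : pd k (cf u l) = eB a i0 l k by rewrite ue; exact: pd_eu.
have lu l : L2c (cf u l) by rewrite ue; exact: (L2c_eu i0 A0 A1 AB j0 jB nj).
have lxu p : L2c (xcf u p).
  have -> : xcf u p = (fun x : V => x ord0 p.2 * e p.1 x) by apply/funext => x; rewrite /xcf mxE.
  exact: (L2c_xeu i0 A0 A1 AB j0 jB nj).
have lpu l k : L2c (pd k (cf u l)) by rewrite pu; exact: (L2c_eB i0 A0 A1 AB j0 jB nj).
have uD := smooth_inD cu lu lxu lpu.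
have us : solenoidal u.
  apply: div0_solenoidal; first exact: cu.
  by move=> x; under eq_bigr do rewrite pu; exact: div_eu.
exists u, (Defs.jacobian u); split => //.
  have -> : mass2 u = (\sum_l \int[mu]_x (cf u l x ^+ 2)%:E)%E.
    by rewrite -iint_sumsq // => l; exact: continuous_measurable_mx (lu l).1.
  rewrite (bigD1 i0) //= -[X in (X < _)%E]adde0; apply: lte_leD => //; last first.
    by apply: sume_ge0 => l _; apply: integral_ge0 => x _; rewrite lee_fin sqr_ge0.
  apply: (@continuous_int_gt0 _ 0).
  - by apply: (@CkX _ _ 0 _ 2); exact: (lu i0).1.
  - by move=> y; exact: sqr_ge0.
  - rewrite ue /e exprn_even_gt0 //= eu_at0 // gt_eqF // mulr_gt0 ?divr_gt0 //; lra.
have lG p : L2c (mcf (Defs.jacobian u) p).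
  have -> : mcf (Defs.jacobian u) p = pd p.2 (cf u p.1).
    by apply/funext => x; apply: smooth_jacobianE; exact: coord_Ck_smooth.
  exact: lpu.
have := uncertainty_inequality n3 uD us.
have -> : mass2 u = (nrm2 (cf u))%:E by rewrite -iint_sumsq_L2m // => l; exact: L2c_L2m.
rewrite mom2E grad2E (iint_sumsq_L2m (fun p => L2c_L2m (lxu p))) (iint_sumsq_L2m (fun p => L2c_L2m (lG p))).
rewrite -!EFinM lee_fin => le; congr EFin; apply/eqP; rewrite eq_le le andbT {le}.
have := energy_identity i0 A0 A1 AB ha j0 jB nj.
have -> : nrm2 (fun p : 'I_n * 'I_n => eB a i0 p.1 p.2) = nrm2 (mcf (Defs.jacobian u)).
  apply: eq_bigr => p _; apply: eq_Rintegral => x _; congr (_ ^+ 2).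
  by rewrite /mcf (smooth_jacobianE x p.1 p.2 (coord_Ck_smooth cu)) pu.
have -> : nrm2 (fun (p : 'I_n * 'I_n) (x : V) => x ord0 p.2 * eu a i0 p.1 x) = nrm2 (xcf u).
  by apply: eq_bigr => p _; apply: eq_Rintegral => x _; rewrite /xcf mxE.
have -> : nrm2 (eu a i0) = nrm2 (cf u).
  by apply: eq_bigr => l _; apply: eq_Rintegral => x _; rewrite ue.
rewrite hCN; set E := nrm2 _; set M := nrm2 _; set m := nrm2 _ => h.
have -> : (n%:R + 2 * a) ^+ 2 / 4 * (m * m) = (E + M) ^+ 2 / 4 by rewrite h; field.
rewrite -subr_ge0 (_ : _ - _ = ((E - M) / 2) ^+ 2) ?sqr_ge0 //; by field.
Qed.

End Attained.

Unset Implicit Arguments.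

Theorem theorem1 (R : realType) (N : nat) (hN : (3 <= N)%N) :
  (* the inequality *)
  (forall (u : 'rV[R]_N -> 'rV[R]_N) (G : 'rV[R]_N -> 'M[R]_N),
     inD u G -> solenoidal u ->
     ((CN R N)%:E * (mass2 u * mass2 u) <= grad2 G * mom2 u)%E) /\
  (* the constant is best possible *)
  (forall c : R, CN R N < c ->
     exists (u : 'rV[R]_N -> 'rV[R]_N) (G : 'rV[R]_N -> 'M[R]_N),
       [/\ inD u G, solenoidal u, (0 < mass2 u)%E &
           (grad2 G * mom2 u < c%:E * (mass2 u * mass2 u))%E]) /\
  (* the constant is attained *)
  (exists (u : 'rV[R]_N -> 'rV[R]_N) (G : 'rV[R]_N -> 'M[R]_N),
     [/\ inD u G, solenoidal u, (0 < mass2 u)%E &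
         (grad2 G * mom2 u = (CN R N)%:E * (mass2 u * mass2 u))%E]).
Proof.
split; first by move=> u G; exact: uncertainty_inequality.
have [u [G [uD us u0 e]]] := uncertainty_attained R hN.
split; last by exists u, G.
(* The extremal field itself serves for every larger c; strictness needs its mass to be finite as
   well as positive. *)
move=> c cc; exists u, G; split=> //; rewrite e.
have uf : mass2 u = (nrm2 (cf u))%:E.
  by rewrite -iint_sumsq_L2m // => l; have [] := inD_approx uD.
move: u0; rewrite uf -!EFinM !lte_fin => u0.
by rewrite ltr_pM2r // mulr_gt0.
Qed.
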